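(* Let $\beta>0$ and let $g=g_{d,s}$ with $0\le s<d/2$ be one of the admissible potentials on $\mathbb{D}\in\{\mathbb{R}^d,\mathbb{T}^d\}$. Let $f\in L^1\cap L^\infty(\Omega)$ be a probability density on $\Omega=\mathbb{D}\times\mathbb{R}^d$ with $\rho_f\in L^\infty(\mathbb{D})$. If $s=0$, assume further that there exist $a,b>0$ such that $M_{a,b}=\int_\Omega e^{a|x|^b}f(z)\,\mathrm{d}z<\infty$, where $z=(x,v)$. Let $\overline{\mathbb{Q}}_{N,\beta}=\overline{\mathbb{Q}}_{N,\beta}(f)$ be the modulated Gibbs measure associated with $f$. Then there is a constant $C_\beta>0$, independent of $N$ (and depending on $f$ only through $\|\rho_f\|_{L^\infty(\mathbb{D})}$ and, if $s=0$, through $M_{a,b}$), such that for all $N$ $$\mathcal{H}_N\big(\overline{\mathbb{Q}}_{N,\beta}\,|\,f^{\otimes N}\big)\le\frac{C_\beta}{N},\qquad \mathcal{H}_N\big(f^{\otimes N}\,|\,\overline{\mathbb{Q}}_{N,\beta}\big)\le\frac{C_\beta}{N}.$$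
   Context: Setting: $\Omega=\mathbb{D}\times\mathbb{R}^d$ with $\mathbb{D}=\mathbb{T}^d$ or $\mathbb{R}^d$; $z_i=(x_i,v_i)\in\Omega$, $Z_N=(z_1,\dots,z_N)$, $X_N=(x_1,\dots,x_N)$; $\rho_f(x)=\int_{\mathbb{R}^d}f(x,v)\,\mathrm{d}v$. Admissible potentials: on $\mathbb{R}^d$, $g_{d,s}(x)=-c_d\log|x|$ if $s=0$ and $g_{d,s}(x)=c_{d,s}|x|^{-s}$ if $0<s<d/2$, with positive normalization constants $c_d,c_{d,s}$ (so that $\widehat{g_{d,s}}(\xi)=|\xi|^{-(d-s)}$ for $s>0$). On $\mathbb{T}^d$, $g_{d,s}$ denotes the natural periodization, i.e. the zero-mean periodic function with Fourier coefficients proportional (with the same normalization) to $|2\pi k|^{-(d-s)}$, $k\in\mathbb{Z}^d\setminus\{0\}$. Modulated energy: with $\mu_N=\frac1N\sum_{i=1}^N\delta_{x_i}$ and $\Delta$ the diagonal of $\mathbb{D}^2$, for a probability density $\rho$ on $\mathbb{D}$, $$\mathcal{W}_N(X_N;\rho)=\frac12\iint_{\mathbb{D}^2\setminus\Delta}g(x-y)\,\mathrm{d}(\mu_N-\rho)(x)\,\mathrm{d}(\mu_N-\rho)(y).$$ Modulated Gibbs measure associated with a bounded probability density $f$ on $\Omega$, with parameter $\beta$: $$\overline{\mathbb{Q}}_{N,\beta}(f)=\frac{1}{\overline{Z}_{N,\beta}}\exp\big(-\beta N\,\mathcal{W}_N(X_N;\rho_f)\big)f^{\otimes N}(Z_N),\qquad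 \overline{Z}_{N,\beta}=\int_{\Omega^N}\exp\big(-\beta N\,\mathcal{W}_N(X_N;\rho_f)\big)f^{\otimes N}(Z_N)\,\mathrm{d}Z_N .$$ Normalized relative entropy of probability measures $\mu,\nu$ on $E^N$: $\mathcal{H}_N(\mu|\nu)=\frac1N\int_{E^N}\log\frac{\mathrm{d}\mu}{\mathrm{d}\nu}\,\mathrm{d}\mu$ if $\mu\ll\nu$, and $+\infty$ otherwise. The parameters $d,s,\mathbb{D}$ (and $a,b$ if $s=0$) are regarded as fixed in the dependence of constants. *)

(* Defs.v *)
From HB Require Import structures.
From mathcomp Require Import all_boot all_order all_algebra.
From mathcomp Require Import all_classical all_reals all_analysis.
From mathcomp Require Import measurable_realfun.

Set Implicit Arguments.
Unset Strict Implicit.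
Unset Printing Implicit Defensive.
Import Order.TTheory GRing.Theory Num.Def Num.Theory.
Import numFieldNormedType.Exports.

Local Open Scope classical_set_scope.
Local Open Scope charge_scope.
Local Open Scope ring_scope.

(* n-fold product measures on n.-tuple T. The factor mu is put on the right of
   the binary product so that only mu has to be sigma-finite in the recursion. *)
Section mpow.
Local Open Scope ereal_scope.
Context d (T : measurableType d) (R : realType).

Definition tuple_cons n (p : n.-tuple T * T) : n.+1.-tuple T :=
  [tuple of p.2 :: p.1].

Definition tuple_uncons n (t : n.+1.-tuple T) : n.-tuple T * T :=
  ([tuple of behead t], thead t).

Fixpoint mpow (mu : set T -> \bar R) n {struct n} : set (n.-tuple T) -> \bar R :=
  match n with
  | 0 => dirac [tuple]
  | m.+1 => pushforward (@mpow mu m \x mu) (@tuple_cons m)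
  end.
Arguments mpow mu n : clear implicits.

Lemma measurable_tuple_cons n : measurable_fun setT (@tuple_cons n).
Proof. exact: measurable_cons. Qed.

Lemma measurable_tuple_uncons n : measurable_fun setT (@tuple_uncons n).
Proof.
apply/measurable_fun_pairP; split; first exact: measurable_behead.
exact: measurable_tnth.
Qed.

Lemma tuple_unconsK n : cancel (@tuple_uncons n) (@tuple_cons n).
Proof. by move=> t; rewrite [RHS]tuple_eta; apply/val_inj. Qed.

Lemma tuple_consK n : cancel (@tuple_cons n) (@tuple_uncons n).
Proof.
move=> -[t x]; rewrite /tuple_uncons /tuple_cons /=.
by congr pair; apply/val_inj.
Qed.

Section cons_measure.
Variables (n : nat) (m1 : {sigma_finite_measure set (n.-tuple T) -> \bar R}).
Variable m2 : {sigma_finite_measure set T -> \bar R}.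

Let m : {measure set (n.-tuple T * T)%type -> \bar R} := m1 \x m2.

Let m_sigma_finite : sigma_finite setT m.
Proof.
have /sigma_finiteP[F [TF ndF Foo]] := sigma_finiteT m1.
have /sigma_finiteP[G [TG ndG Goo]] := sigma_finiteT m2.
exists (fun n => F n `*` G n).
  rewrite -setXTT TF TG predeqE => -[x y]; split.
    move=> [/= [i _ Fx] [k _ Gy]]; exists (maxn i k) => //; split.
    - by move: x Fx; exact/subsetPset/ndF/leq_maxl.
    - by move: y Gy; exact/subsetPset/ndG/leq_maxr.
  by move=> [i _ []/= ? ?]; split; exists i.
move=> k; have [? ?] := Foo k; have [? ?] := Goo k.
split; first exact: measurableX.
by rewrite /m /= product_measure1E// lte_mul_pinfty// ge0_fin_numE.
Qed.

Let cons_measure := pushforward m (@tuple_cons n).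

Let cons0 : cons_measure set0 = 0.
Proof. by rewrite /cons_measure /pushforward preimage_set0 measure0. Qed.

Let cons_ge0 A : 0 <= cons_measure A.
Proof. by have mf := @measurable_tuple_cons n; exact: measure_ge0. Qed.

Let cons_sigma_additive : semi_sigma_additive cons_measure.
Proof.
have mf := @measurable_tuple_cons n.
exact: (@measure_semi_sigma_additive _ _ _ (pushforward m (@tuple_cons n))).
Qed.

HB.instance Definition _ := isMeasure.Build _ _ _ cons_measure
  cons0 cons_ge0 cons_sigma_additive.

Let cons_sigma_finite : sigma_finite setT cons_measure.
Proof.
have [F FT Foo] := m_sigma_finite.
exists (fun k => (@tuple_uncons n) @^-1` F k).
  by rewrite -preimage_bigcup -FT preimage_setT.
move=> k; have [mF Fkoo] := Foo k; split.
  by rewrite -[X in measurable X]setTI; exact: measurable_tuple_uncons.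
rewrite /cons_measure /pushforward -comp_preimage.
rewrite (_ : _ \o _ = id) ?preimage_id//.
by apply/funext => x /=; exact: tuple_consK.
Qed.

HB.instance Definition _ := Measure_isSigmaFinite.Build _ _ _ cons_measure
  cons_sigma_finite.

Definition mcons : {sigma_finite_measure set (n.+1.-tuple T) -> \bar R} :=
  cons_measure.

End cons_measure.

Section mpow_sigma_finite.
Variable mu : {sigma_finite_measure set T -> \bar R}.

Lemma mpow_sigma_finite_ex n :
  exists m : {sigma_finite_measure set (n.-tuple T) -> \bar R},
    mpow mu n = m :> (set _ -> _).
Proof.
elim: n => [|n [m mE]]; first by exists (dirac [tuple]).
by exists (mcons m mu); rewrite /= mE.
Qed.

Variable n : nat.

Let mpow0 : mpow mu n set0 = 0.
Proof. by have [m ->] := mpow_sigma_finite_ex n. Qed.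

Let mpow_ge0 A : 0 <= mpow mu n A.
Proof. by have [m ->] := mpow_sigma_finite_ex n. Qed.

Let mpow_sigma_additive : semi_sigma_additive (mpow mu n).
Proof.
have [m ->] := mpow_sigma_finite_ex n; exact: measure_semi_sigma_additive.
Qed.

HB.instance Definition _ := isMeasure.Build _ _ _ (mpow mu n)
  mpow0 mpow_ge0 mpow_sigma_additive.

Let mpow_sigma_finite : sigma_finite setT (mpow mu n).
Proof. by have [m ->] := mpow_sigma_finite_ex n; exact: sigma_finiteT. Qed.

HB.instance Definition _ := Measure_isSigmaFinite.Build _ _ _ (mpow mu n)
  mpow_sigma_finite.

End mpow_sigma_finite.

Section mpow_probability.
Variables (P : probability T R) (n : nat).

Let mpow_setT : mpow P n setT = 1.
Proof.
elim: n => [|k ih] /=; first by rewrite diracT.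
rewrite /pushforward preimage_setT -setXTT product_measure1E//.
by rewrite [X in X * _]ih [X in 1 * X]probability_setT mule1.
Qed.

HB.instance Definition _ := Measure_isProbability.Build _ _ _ (mpow P n)
  mpow_setT.

End mpow_probability.

End mpow.
Arguments mpow {d T R} mu n _ : simpl never.

Section mweight.
Local Open Scope ereal_scope.
Context d (T : measurableType d) (R : realType).
Variables (mu : {measure set T -> \bar R}) (h : T -> R).
Hypotheses (mh : measurable_fun setT h) (h_ge0 : forall x, (0 <= h x)%R).

Definition mweight of measurable_fun setT h & (forall x, (0 <= h x)%R) :=
  fun A => \int[mu]_(x in A) (h x)%:E.

Local Notation wmu := (mweight mh h_ge0).

Let mweight0 : wmu set0 = 0.
Proof. by rewrite /mweight integral_set0. Qed.

Let mweight_ge0 A : 0 <= wmu A.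
Proof. by apply: integral_ge0 => x _; rewrite lee_fin. Qed.

Let mweight_sigma_additive : semi_sigma_additive wmu.
Proof.
move=> F mF tF mUF; rewrite /mweight ge0_integral_bigcup//=.
- apply: is_cvg_ereal_nneg_natsum_cond => n _ _.
  by apply: integral_ge0 => x _; rewrite lee_fin.
- by apply/measurable_EFinP; exact: measurable_funTS.
- by move=> x _; rewrite lee_fin.
Qed.

HB.instance Definition _ := isMeasure.Build _ _ _ wmu
  mweight0 mweight_ge0 mweight_sigma_additive.

End mweight.

Section density.
Local Open Scope ereal_scope.
Context d (T : measurableType d) (R : realType).
Variable mu : {measure set T -> \bar R}.

Record density := Density {
  density_fun :> T -> R;
  measurable_density : measurable_fun setT density_fun;
  density_ge0 : forall x, (0 <= density_fun x)%R;
  integral_density : \int[mu]_x (density_fun x)%:E = 1 }.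

Variable f : density.

Definition density_prob :=
  mweight mu (measurable_density f) (density_ge0 f).

HB.instance Definition _ := Measure.on density_prob.

HB.instance Definition _ := Measure_isProbability.Build _ _ _ density_prob
  (integral_density f).

End density.

Definition rel_entropy d (E : measurableType d) (R : realType) (N : nat)
    (P Q : probability (N.-tuple E) R) : \bar R :=
  if pselect (P `<< Q) then
    ((N%:R^-1)%:E * \int[P]_z lne (('d (charge_of_finite_measure P) '/d Q) z))%E
  else +oo%E.


Definition rvec (R : realType) d := d.-tuple (measurableTypeR R).

Definition vsub (R : realType) d (x y : rvec R d) : rvec R d :=
  [tuple (tnth x i - tnth y i : measurableTypeR R) | i < d].

Definition enorm (R : realType) d (x : rvec R d) : R :=
  Num.sqrt (\sum_(i < d) tnth x i ^+ 2).

(* The spatial domain is T^d or R^d. The torus (R/Z)^d is represented by its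
   fundamental cell [-1/2, 1/2[^d in R^d, i.e. a function on T^d is a function
   on R^d considered on the cell only. There enorm x is the distance of x to 0
   on the torus, and distinct points of the cell are distinct on the torus. *)
Inductive domain := Torus | Whole.

Definition side (R : realType) (D : domain) : set (measurableTypeR R) :=
  match D with
  | Torus => `[(- 2^-1)%R, (2^-1)%R[%classic
  | Whole => setT
  end.

Lemma measurable_side (R : realType) (D : domain) : measurable (@side R D).
Proof. by case: D => //=; exact: measurable_itv. Qed.

Section side_measure.
Context (R : realType) (D : domain).

Definition leb_side : set (measurableTypeR R) -> \bar R :=
  mrestr lebesgue_measure (@measurable_side R D).

HB.instance Definition _ := Measure.on leb_side.

Let leb_side_sigma_finite : sigma_finite setT leb_side.
Proof.
have [F FT Foo] := sigma_finiteT (@lebesgue_measure R).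
exists F => // k; have [mF Fkoo] := Foo k; split => //.
apply: le_lt_trans Fkoo; rewrite /leb_side /mrestr le_measure ?inE//.
by apply: measurableI => //; exact: measurable_side.
Qed.

HB.instance Definition _ := Measure_isSigmaFinite.Build _ _ _ leb_side
  leb_side_sigma_finite.

End side_measure.

Definition space_measure (R : realType) (D : domain) (d : nat) :
    {sigma_finite_measure set (rvec R d) -> \bar R} :=
  mpow (@leb_side R D) d.

Definition velocity_measure (R : realType) (d : nat) :
    {sigma_finite_measure set (rvec R d) -> \bar R} :=
  mpow (@lebesgue_measure R) d.

Definition phase (R : realType) d := (rvec R d * rvec R d)%type.

Definition phase_measure (R : realType) (D : domain) (d : nat) :
    {measure set (phase R d) -> \bar R} :=
  (space_measure R D d \x velocity_measure R d)%E.

(* On a null set the velocity integral may be +oo; Rintegral is then 0. *)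
Definition rho (R : realType) d (f : phase R d -> R) (x : rvec R d) : R :=
  \int[velocity_measure R d]_v f (x, v).

Definition exp_moment (R : realType) (D : domain) d (a b : R)
    (f : phase R d -> R) : \bar R :=
  \int[phase_measure R D d]_z (expR (a * enorm z.1 `^ b) * f z)%:E.

Definition gamma_fun (R : realType) (z : R) : R :=
  \int[lebesgue_measure]_(t in `]0, +oo[) (t `^ (z - 1) * expR (- t)).

(* c_{d,s} = Gamma(s/2) / (2^(d-s) pi^(d/2) Gamma((d-s)/2)), which for s > 0
   makes the Fourier transform (int g(x) e^(-i x.xi) dx) of c_{d,s} |x|^(-s)
   equal to |xi|^(-(d-s)). For s = 0 the constant cd = c_d > 0 is free. *)
Definition riesz_const (R : realType) (d : nat) (s : R) : R :=
  gamma_fun (s / 2) /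
  (2 `^ (d%:R - s) * pi `^ (d%:R / 2) * gamma_fun ((d%:R - s) / 2)).

Definition riesz (R : realType) (d : nat) (s cd : R) (x : rvec R d) : R :=
  if s == 0 then - cd * ln (enorm x)
  else riesz_const d s * enorm x `^ (- s).

(* The constant kappa for which riesz has Fourier transform
   kappa |xi|^(-(d-s)), away from xi = 0 if s = 0. *)
Definition fourier_const (R : realType) (d : nat) (s cd : R) : R :=
  if s == 0 then
    cd * (2 `^ (d%:R - 1) * pi `^ (d%:R / 2) * gamma_fun (d%:R / 2))
  else 1.

Section torus_kernel.
Context (R : realType) (d : nat).
Implicit Types (k : d.-tuple int) (g : rvec R d -> R).

Definition vaddz (x : rvec R d) k : rvec R d :=
  [tuple (tnth x i + (tnth k i)%:~R : measurableTypeR R) | i < d].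

Definition phase_angle k (x : rvec R d) : R :=
  2 * pi * \sum_(i < d) (tnth k i)%:~R * tnth x i.

Definition freq_norm k : R :=
  2 * pi * Num.sqrt (\sum_(i < d) (tnth k i)%:~R ^+ 2).

(* g is the Z^d-periodic function whose Fourier coefficients
   int_{T^d} g(x) e^(-2 i pi k.x) dx are 0 for k = 0 and
   kappa |2 pi k|^(-(d-s)) for k != 0. *)
Definition periodic_riesz (s cd : R) g : Prop :=
  [/\ forall x k, g (vaddz x k) = g x,
      (space_measure R Torus d).-integrable setT (EFin \o g),
      \int[space_measure R Torus d]_x g x = 0 &
      forall k, (exists i, tnth k i != 0) ->
        \int[space_measure R Torus d]_x (g x * cos (phase_angle k x)) =
          fourier_const d s cd * freq_norm k `^ (- (d%:R - s)) /\
        \int[space_measure R Torus d]_x (g x * sin (phase_angle k x)) = 0].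

End torus_kernel.

Definition admissible (R : realType) (D : domain) (d : nat) (s cd : R)
    (g : rvec R d -> R) : Prop :=
  match D with
  | Torus => periodic_riesz s cd g
  | Whole => g =1 riesz s cd
  end.

Section modulated_gibbs.
Context (R : realType) (D : domain) (d N : nat).

(* Integral of phi against the signed measure mu_N - r(x) dx, where mu_N is the
   empirical measure of X. Iterating it in x and y integrates against the tensor
   square of that signed measure; the diagonal is removed by the test x == y. *)
Definition fluct (X : N.-tuple (rvec R d)) (r : rvec R d -> R)
    (phi : rvec R d -> R) : R :=
  N%:R^-1 * (\sum_(i < N) phi (tnth X i)) -
  \int[space_measure R D d]_x (phi x * r x).

Definition modulated_energy (g : rvec R d -> R) (r : rvec R d -> R)
    (X : N.-tuple (rvec R d)) : R :=
  2^-1 * fluct X r (fun x =>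
    fluct X r (fun y => if x == y then 0 else g (vsub x y))).

Definition positions (Z : N.-tuple (phase R d)) : N.-tuple (rvec R d) :=
  [tuple (tnth Z i).1 | i < N].

Definition gibbs_weight (beta : R) (g : rvec R d -> R) (f : phase R d -> R)
    (Z : N.-tuple (phase R d)) : R :=
  expR (- beta * N%:R * modulated_energy g (rho f) (positions Z)).

End modulated_gibbs.

Section measurability.
Context (R : realType).

Lemma measurable_fun_param_Rintegral d1 d2 (S : measurableType d1)
    (T : measurableType d2) (m : {sigma_finite_measure set T -> \bar R})
    (F : S * T -> R) : measurable_fun setT F ->
  measurable_fun setT (fun s => \int[m]_y F (s, y)).
Proof.
move=> mF; apply: measurableT_comp => //.
have mEF : measurable_fun setT (EFin \o F) by exact/measurable_EFinP.
rewrite (_ : (fun s => _) = (fun s => (\int[m]_y ((EFin \o F)^\+ (s, y)) -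
    \int[m]_y ((EFin \o F)^\- (s, y)))%E)); last first.
  apply/funext => s; rewrite integralE.
  by congr (_ - _)%E; apply: eq_integral => y _; rewrite ?funeposE ?funenegE.
apply: emeasurable_funB.
- apply: (@measurable_fun_fubini_tonelli_F _ _ _ _ _ m ((EFin \o F)^\+)%E).
  + exact: measurable_funepos.
  + by move=> x; exact: funepos_ge0.
- apply: (@measurable_fun_fubini_tonelli_F _ _ _ _ _ m ((EFin \o F)^\-)%E).
  + exact: measurable_funeneg.
  + by move=> x; exact: funeneg_ge0.
Qed.

Lemma measurable_rho d (f : phase R d -> R) : measurable_fun setT f ->
  measurable_fun setT (rho f).
Proof. exact: measurable_fun_param_Rintegral. Qed.

Lemma measurable_vsub d :
  measurable_fun setT (fun p : rvec R d * rvec R d => vsub p.1 p.2).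
Proof.
apply/measurable_fun_tnthP => i.
rewrite (_ : _ \o _ = fun p : rvec R d * rvec R d =>
  (tnth p.1 i - tnth p.2 i : measurableTypeR R)); last first.
  by apply/funext => p; rewrite /= tnth_mktuple.
apply: (@measurable_funB _ _ R setT (fun p : rvec R d * rvec R d => tnth p.1 i)
  (fun p : rvec R d * rvec R d => tnth p.2 i)).
- exact: (measurableT_comp (measurable_tnth i) measurable_fst).
- exact: (measurableT_comp (measurable_tnth i) measurable_snd).
Qed.

Lemma measurable_rvec_eq d :
  measurable_fun setT (fun p : rvec R d * rvec R d => p.1 == p.2).
Proof.
apply: (measurable_fun_bool true).
rewrite setTI (_ : _ @^-1` _ =
  \bigcap_(i in [set: 'I_d]) [set p : rvec R d * rvec R d |
     (tnth p.1 i : R) == (tnth p.2 i : R)]); last first.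
  apply/seteqP; split => [p /= /eqP pp i _ /=|p pE /=]; first by rewrite pp.
  by apply/eqP/eq_from_tnth => i; apply/eqP; exact: (pE i).
apply: fin_bigcap_measurable => // i _.
rewrite -[X in measurable X]setTI.
apply: (@measurable_fun_eqr _ _ R setT (fun p : rvec R d * rvec R d => tnth p.1 i)
  (fun p : rvec R d * rvec R d => tnth p.2 i) _ _ measurableT [set true]) => //.
- exact: (measurableT_comp (measurable_tnth i) measurable_fst).
- exact: (measurableT_comp (measurable_tnth i) measurable_snd).
Qed.

Variables (D : domain) (d N : nat).

Lemma measurable_fluct d1 (S : measurableType d1) (X : S -> N.-tuple (rvec R d))
    (r : rvec R d -> R) (H : S * rvec R d -> R) :
  measurable_fun setT X -> measurable_fun setT r -> measurable_fun setT H ->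
  measurable_fun setT (fun s => fluct D (X s) r (fun x => H (s, x))).
Proof.
move=> mX mr mH; apply: measurable_funB.
  apply: measurable_funM => //; apply: measurable_sum => i.
  apply: (measurableT_comp mH); apply: measurable_fun_pair => //.
  exact: (measurableT_comp (measurable_tnth i) mX).
apply: (@measurable_fun_param_Rintegral _ _ _ _ _ (fun p => H p * r p.2)).
by apply: measurable_funM => //; exact: measurableT_comp.
Qed.

Lemma measurable_modulated_energy (g : {mfun rvec R d >-> R})
    (r : rvec R d -> R) : measurable_fun setT r ->
  measurable_fun setT (@modulated_energy R D d N g r).
Proof.
move=> mr; apply: measurable_funM => //.
apply: (@measurable_fluct _ _ id r (fun p => fluct D p.1 r
  (fun y => if p.2 == y then 0 else g (vsub p.2 y)))) => //.
apply: (@measurable_fluct _ _ fst r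
  (fun q : (N.-tuple (rvec R d) * rvec R d) * rvec R d =>
     if q.1.2 == q.2 then 0 else g (vsub q.1.2 q.2))) => //.
have mq : measurable_fun setT
    (fun q : (N.-tuple (rvec R d) * rvec R d) * rvec R d => (q.1.2, q.2)).
  by apply: measurable_fun_pair => //; exact: measurableT_comp.
apply: measurable_fun_ifT => //.
- exact: (measurableT_comp (@measurable_rvec_eq d) mq).
- apply: measurableT_comp => //.
  exact: (measurableT_comp (@measurable_vsub d) mq).
Qed.

Lemma measurable_positions : measurable_fun setT (@positions R d N).
Proof.
apply/measurable_fun_tnthP => i.
rewrite (_ : _ \o _ = fun Z : N.-tuple (phase R d) => (tnth Z i).1); last first.
  by apply/funext => Z; rewrite /= tnth_mktuple.
exact: (measurableT_comp measurable_fst (measurable_tnth i)).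
Qed.

Lemma measurable_gibbs_weight (beta : R) (g : {mfun rvec R d >-> R})
    (f : phase R d -> R) : measurable_fun setT f ->
  measurable_fun setT (@gibbs_weight R D d N beta g f).
Proof.
move=> mf; apply: measurableT_comp => //; apply: measurable_funM => //.
exact: (measurableT_comp
  (measurable_modulated_energy g (measurable_rho mf)) measurable_positions).
Qed.

Lemma gibbs_weight_ge0 (beta : R) (g : rvec R d -> R) (f : phase R d -> R) Z :
  0 <= @gibbs_weight R D d N beta g f Z.
Proof. exact: expR_ge0. Qed.

End measurability.

Definition phase0 (R : realType) d : phase R d :=
  ([tuple (0 : R) | i < d], [tuple (0 : R) | i < d]).

(* The measure f^{(x) N} dZ_N is the N-fold product of the probability f dz;
   mnormalize divides the weighted measure by its total mass Z_{N,beta}, and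
   falls back to its second argument if that mass were 0 or +oo. *)
Definition modulated_gibbs (R : realType) (D : domain) (d N : nat) (beta : R)
    (g : {mfun rvec R d >-> R}) (f : density (phase_measure R D d)) :
    probability (N.-tuple (phase R d)) R :=
  mnormalize
    (mweight (mpow (density_prob f) N)
       (@measurable_gibbs_weight R D d N beta g f (measurable_density f))
       (@gibbs_weight_ge0 R D d N beta g f))
    (dirac [tuple phase0 R d | i < N]).

Definition density_pow (R : realType) (D : domain) (d N : nat)
    (f : density (phase_measure R D d)) :
    probability (N.-tuple (phase R d)) R :=
  mpow (density_prob f) N.

(* Main.v *)
Require Import Defs.
From HB Require Import structures.
From mathcomp Require Import all_boot all_order all_algebra.
From mathcomp Require Import all_classical all_reals all_analysis.
From mathcomp Require Import measurable_realfun ess_sup_inf hoelder ring lra.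
Set Implicit Arguments.
Unset Strict Implicit.
Unset Printing Implicit Defensive.
Import Order.TTheory GRing.Theory Num.Def Num.Theory.
Import numFieldNormedType.Exports.

Local Open Scope classical_set_scope.
Local Open Scope ring_scope.

(** Let [P] be the probability with density [f], let [K] be the interaction of two
   phase points, symmetrised and set to 0 on the diagonal, and let [psi z] be the
   mean of [K z] and [G] the mean of [psi] under [P]. Then [N] times the modulated
   energy of the positions of [z_1, ..., z_N] is the [energy]
<<
     (1 / 2N) sum_(i, j) K z_i z_j - sum_i psi z_i + N G / 2
>>
   ([modulated_energyE]), whose mean under [P^N] is [- G / 2]. Write [Z_beta] for
   the mean of the Gibbs weight. Bounding the logarithm by the identity, the first
   entropy is at most [Z_(2 beta) / (N Z_beta^2)]; the second one is
   [(ln Z_beta - beta G / 2) / N]; and [Z_beta >= exp (beta G / 2)] by Jensen's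
   inequality. So it is enough to bound [G], and to bound [Z_beta] uniformly in [N]
   for every [beta] ([exp_energy_le], [gibbs_entropy]).

   To this end [K] is split into [A + r]. The kernel [A] is positive definite,
   bounded and constant on the diagonal, so that its energy, diagonal included, is
   nonnegative. The remainder [r] may be singular, but it is bounded below by
   [- eps] and its mean square in either variable is at most [eps^2]. Up to bounded
   terms, [- beta] times the energy is then [- beta / N] times the sum over pairs
   [i < j] of the part of [r] whose means in each variable vanish. That its
   exponential moment is bounded is [exp_moment_degenerate]: the variables are
   integrated out one after the other, each time with [exp t <= 1 + t + 2 t^2] for
   [t <= 1], and the quadratic variation, with a weight that decreases to 0, serves
   as a Lyapunov functional.

   On the whole space [A] is the potential of [sqrt (delta^2 + |x|^2)] in place of
   [|x|], and [0 <= r <= C delta^tau |x|^-(s + tau)] with [2 (s + tau) < d]; since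
   [rho f] is bounded, the square of [r] has a small integral. Positive definiteness
   is proved without Fourier transforms. The function [delta + |xi|^2] is the limit
   of [delta] plus the symbols of random walks, which are constants minus sums of
   cosines, so that minus their logarithms expand into positive combinations of
   products of cosines; this class of functions, [posdef], is closed under sums,
   products, exponentials and limits ([posdef_pow], [posdef_log_walk]).

   On the torus only the Fourier coefficients of [g] are known: they are multiples
   of [l^-alpha], where [l] is the squared frequency and [alpha = (d - s) / 2]. From
   [l^-alpha] one subtracts a truncation at scale [M], positive definite in the
   frequency, that is uniformly small and leaves summable coefficients
   ([trunc_pow]). Finitely many of these make up [A]. Both properties of [r] are
   first proved in duality with trigonometric polynomials. If such a polynomial is
   nonnegative, pairing its coefficients with a positive definite function of the
   frequency gives a nonnegative number, whence the lower bound
   ([rough_part_lower]); and the coefficients of [r] have a small sum of squares,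
   because [s < d / 2], whence the mean square bound ([rough_part_duality]). They
   extend to all test functions because the sets whose indicators are approximable
   by trigonometric polynomials with values between 0 and 1 form a sigma-algebra
   containing all intervals of each coordinate ([approximable_measurable]).
   Finally, integrals of periodic functions over the cell are invariant under
   translations and reflections ([ge0_integral_cell_reflect]), so that the bounds
   hold for [r] as a function of the displacement, whatever its other end point. *)

Local Notation integ mu f := (mu.-integrable setT (EFin \o f)).

(** * Integration against a measure *)

Section integrals.
Context d (T : measurableType d) (R : realType) (mu : {measure set T -> \bar R}).
Implicit Types f g : T -> R.

Lemma integ_measurable f : integ mu f -> measurable_fun setT f.
Proof. by move=> /integrableP[/measurable_EFinP]. Qed.

Lemma integ_dom f g : measurable_fun setT f -> (forall x, `|f x| <= g x) ->
  integ mu g -> integ mu f.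
Proof.
move=> mf fg; apply: le_integrable => //; first exact/measurable_EFinP.
by move=> x _ /=; rewrite lee_fin (le_trans (fg x))// ler_norm.
Qed.

Lemma ge0_integ f (c : R) : measurable_fun setT f -> (forall x, 0 <= f x) ->
  (\int[mu]_x (f x)%:E <= c%:E)%E -> integ mu f.
Proof.
move=> mf f0 fc; apply/integrableP; split; first exact/measurable_EFinP.
under eq_integral do rewrite /= ger0_norm//.
exact: le_lt_trans fc (ltry _).
Qed.

Lemma Rint_EFin f : integ mu f ->
  (\int[mu]_x f x)%:E = (\int[mu]_x (f x)%:E)%E.
Proof. by move=> fi; rewrite /Rintegral fineK//; exact: integrable_fin_num. Qed.

Lemma integD f g : integ mu f -> integ mu g -> integ mu (fun x => f x + g x).
Proof. by move=> fi gi; exact: (integrableD measurableT fi gi). Qed.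

Lemma integB f g : integ mu f -> integ mu g -> integ mu (fun x => f x - g x).
Proof. by move=> fi gi; exact: (integrableB measurableT fi gi). Qed.

Lemma integZ (c : R) f : integ mu f -> integ mu (fun x => c * f x).
Proof. by move=> fi; exact: (integrableZl measurableT c fi). Qed.

Lemma integN f : integ mu f -> integ mu (fun x => - f x).
Proof.
move=> fi; apply: eq_integrable (integZ (-1) fi) => // x _ /=.
by rewrite mulN1r.
Qed.

Lemma integ0 : integ mu (fun=> 0).
Proof. exact: integrable0. Qed.

Lemma integ_sum (I : Type) (s : seq I) (F : I -> T -> R) :
  (forall i, integ mu (F i)) -> integ mu (fun x => \sum_(i <- s) F i x).
Proof.
move=> Fi; elim: s => [|i s IH].
  by apply: eq_integrable integ0 => // x _ /=; rewrite big_nil.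
apply: eq_integrable (integD (Fi i) IH) => // x _ /=.
by rewrite big_cons.
Qed.

Lemma Rint_sum (I : Type) (s : seq I) (F : I -> T -> R) :
  (forall i, integ mu (F i)) ->
  \int[mu]_x (\sum_(i <- s) F i x) = \sum_(i <- s) \int[mu]_x F i x.
Proof.
move=> Fi; elim: s => [|i s IH].
  rewrite big_nil; under eq_Rintegral do rewrite big_nil.
  by rewrite /Rintegral integral0.
rewrite big_cons -IH -RintegralD//; last exact: integ_sum.
by apply: eq_Rintegral => x _; rewrite big_cons.
Qed.

Lemma Rint_le f g : integ mu f -> integ mu g -> (forall x, f x <= g x) ->
  \int[mu]_x f x <= \int[mu]_x g x.
Proof. by move=> fi gi fg; apply: le_Rintegral. Qed.

Lemma RintZ (c : R) f : integ mu f ->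
  \int[mu]_x (c * f x) = c * \int[mu]_x f x.
Proof. by move=> fi; rewrite RintegralZl. Qed.

Lemma RintN f : \int[mu]_x (- f x) = - \int[mu]_x f x.
Proof.
rewrite /Rintegral.
have [fi|/negP nfi] := boolP (mu.-integrable setT (EFin \o f)).
  by rewrite -fineN -integralN//; exact: integrable_add_def.
rewrite (integralE _ _ (fun x => (- f x)%:E)) (integralE _ _ (fun x => (f x)%:E)).
have -> : (fun x => (- f x)%:E)^\+%E = (EFin \o f)^\-%E.
  by apply/funext => x; rewrite funeposE funenegE.
have -> : (fun x => (- f x)%:E)^\-%E = (EFin \o f)^\+%E.
  by apply/funext => x; rewrite funeposE funenegE/= opprK.
set A := integral _ _ _; set B := integral _ _ _.
have A0 : (0 <= A)%E by apply: integral_ge0 => x _; exact: funeneg_ge0.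
have B0 : (0 <= B)%E by apply: integral_ge0 => x _; exact: funepos_ge0.
move: A0 B0; case: A => [u| |]; case: B => [v| |] //= _ _.
- by rewrite opprB.
- by rewrite oppr0.
- by rewrite oppr0.
- by rewrite oppr0.
Qed.

Lemma RintD f g : integ mu f -> integ mu g ->
  \int[mu]_x (f x + g x) = \int[mu]_x f x + \int[mu]_x g x.
Proof. by move=> fi gi; rewrite RintegralD. Qed.

Lemma RintB f g : integ mu f -> integ mu g ->
  \int[mu]_x (f x - g x) = \int[mu]_x f x - \int[mu]_x g x.
Proof. by move=> fi gi; rewrite RintegralB. Qed.

Lemma le_Rint_norm f : integ mu f ->
  `|\int[mu]_x f x| <= \int[mu]_x `|f x|.
Proof. by move=> fi; rewrite le_normr_Rintegral. Qed.

Lemma integ_norm f : integ mu f -> integ mu (fun x => `|f x|).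
Proof. by move=> fi; exact: (integrable_norm fi). Qed.

Definition L2 f := measurable_fun setT f /\ integ mu (fun x => f x ^+ 2).

Lemma L2_mul f g : L2 f -> L2 g -> integ mu (fun x => f x * g x).
Proof.
move=> [mf fi] [mg gi]; apply: (integ_dom _ _ (integD fi gi)).
  exact: measurable_funM.
move=> x; rewrite normrM -(real_normK (num_real (f x))) -(real_normK (num_real (g x))).
by have := normr_ge0 (f x); have := normr_ge0 (g x); nra.
Qed.

Lemma L2D f g : L2 f -> L2 g -> L2 (fun x => f x + g x).
Proof.
move=> [mf fi] [mg gi]; split; first exact: measurable_funD.
apply: (integ_dom _ _ (integZ 2 (integD fi gi))).
  by apply: measurable_funX; exact: measurable_funD.
by move=> x; rewrite ger0_norm ?sqr_ge0//; have := sqr_ge0 (f x - g x); nra.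
Qed.

Lemma L2Z (c : R) f : L2 f -> L2 (fun x => c * f x).
Proof.
move=> [mf fi]; split; first exact: measurable_funM.
by apply: eq_integrable (integZ (c ^+ 2) fi) => // x _ /=; rewrite exprMn.
Qed.

Lemma L2_sum (I : Type) (s : seq I) (F : I -> T -> R) :
  (forall i, L2 (F i)) -> L2 (fun x => \sum_(i <- s) F i x).
Proof.
move=> Fi; elim: s => [|i s IH].
  under eq_fun do rewrite big_nil.
  split; first exact: measurable_cst.
  by under [X in EFin \o X]eq_fun do rewrite expr0n/=; exact: integ0.
under eq_fun do rewrite big_cons.
exact: L2D.
Qed.

(** Positivity of the quadratic polynomial [c |-> \int (f - c g)^2]. *)
Lemma CauchySchwarz f g : L2 f -> L2 g ->
  (\int[mu]_x (f x * g x)) ^+ 2 <=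
  (\int[mu]_x (f x ^+ 2)) * (\int[mu]_x (g x ^+ 2)).
Proof.
move=> hf hg; have fg := L2_mul hf hg; have [_ ff] := hf; have [_ gg] := hg.
set F := \int[mu]_x (f x ^+ 2); set G := \int[mu]_x (g x ^+ 2).
set W := \int[mu]_x _.
have F0 : 0 <= F by apply: Rintegral_ge0 => x _; exact: sqr_ge0.
have G0 : 0 <= G by apply: Rintegral_ge0 => x _; exact: sqr_ge0.
have key c : 0 <= F - 2 * c * W + c ^+ 2 * G.
  have -> : F - 2 * c * W + c ^+ 2 * G = \int[mu]_x ((f x - c * g x) ^+ 2).
    rewrite /F /G /W -!RintZ// -RintB//; last exact: integZ.
    rewrite -RintD//; [|by apply: integB => //; exact: integZ|exact: integZ].
    by apply: eq_Rintegral => x _; ring.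
  by apply: Rintegral_ge0 => x _; exact: sqr_ge0.
have [G00|Gn0] := eqVneq G 0.
  have [->|Wn0] := eqVneq W 0; first by rewrite expr0n /= mulr_ge0.
  exfalso; have := key ((F + 1) / (2 * W)).
  rewrite G00 mulr0 addr0.
  have -> : 2 * ((F + 1) / (2 * W)) * W = F + 1 by field.
  by lra.
have := key (W / G).
have -> : F - 2 * (W / G) * W + (W / G) ^+ 2 * G = F - W ^+ 2 / G by field.
by rewrite subr_ge0 ler_pdivrMr// lt_neqAle eq_sym Gn0.
Qed.

End integrals.

Section probability_integrals.
Context d (T : measurableType d) (R : realType) (P : probability T R).
Implicit Types f g : T -> R.

Lemma integ_cst (c : R) : integ P (fun=> c).
Proof. exact: finite_measure_integrable_cst. Qed.

Lemma Rint_cst (c : R) : \int[P]_x c = c.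
Proof. rewrite Rintegral_cst//.
transitivity (c * fine (1%E : \bar R)); last by rewrite mulr1.
congr (c * fine _); exact: probability_setT.
Qed.

Lemma integ_bdd f (M : R) : measurable_fun setT f -> (forall x, `|f x| <= M) ->
  integ P f.
Proof. by move=> mf fM; exact: (integ_dom mf fM (integ_cst M)). Qed.

Lemma L2_cst (c : R) : L2 P (fun=> c).
Proof. by split; [exact: measurable_cst|exact: integ_cst]. Qed.

Lemma L2_integ f : L2 P f -> integ P f.
Proof.
move=> hf; have := L2_mul hf (L2_cst 1).
by apply: eq_integrable => // x _ /=; rewrite mulr1.
Qed.

Lemma expR_le_quadratic (x : R) : x <= 1 -> expR x <= 1 + x + 2 * x ^+ 2.
Proof.
move=> x1; have y0 : 0 < 1 - x / 2 by lra.
have e : expR (x / 2) <= (1 - x / 2)^-1.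
  rewrite -[leLHS]invrK lef_pV2 ?posrE ?invr_gt0 ?expR_gt0// -expRN.
  by rewrite (le_trans _ (expR_ge1Dx _)).
have -> : x = x / 2 + x / 2 by field.
rewrite expRD (le_trans (ler_pM (expR_ge0 _) (expR_ge0 _) e e))//.
rewrite -invfM -[leLHS]mul1r ler_pdivrMr ?mulr_gt0//.
have -> : x / 2 + x / 2 = x by field.
rewrite -subr_ge0.
have -> : (1 + x + 2 * x ^+ 2) * ((1 - x / 2) * (1 - x / 2)) - 1 =
   x ^+ 2 * ((1 - x) * (5 / 4 - x / 2)) by field.
by apply: mulr_ge0; [exact: sqr_ge0|apply: mulr_ge0; lra].
Qed.

(** The inequality [exp t <= 1 + t + 2 t^2] for [t <= 1] turns a one-sided bound
   and a bound on the variance into an exponential moment. *)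
Lemma exp_centred f (c : R) : L2 P f -> \int[P]_x f x = 0 ->
  (\forall x \ae P, f x <= 1) -> \int[P]_x (f x ^+ 2) <= c ->
  (\int[P]_x (expR (f x))%:E <= (expR (2 * c))%:E)%E.
Proof.
move=> hf f0 f1 fc; have fi := L2_integ hf; have [mf ff] := hf.
apply: (@le_trans _ _ (\int[P]_x (Num.max 0 (1 + f x + 2 * f x ^+ 2))%:E)%E).
  apply: ae_ge0_le_integral => //.
  - by apply/measurable_EFinP; exact: measurableT_comp.
  - by move=> x _; rewrite lee_fin le_max lexx.
  - apply/measurable_EFinP; apply: measurable_maxr => //.
    by apply: measurable_funD; [apply: measurable_funD|apply: measurable_funM => //; apply: measurable_funX].
  - apply: filterS f1 => x fx _; rewrite lee_fin le_max.
    by apply/orP; right; exact: expR_le_quadratic.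
have -> : (fun x => (Num.max 0 (1 + f x + 2 * f x ^+ 2))%:E) =
    (fun x => (1 + f x + 2 * f x ^+ 2)%:E).
  by apply/funext => x; congr _%:E; apply/max_idPr; have := sqr_ge0 (f x + 4^-1); nra.
rewrite -Rint_EFin; last first.
  by apply: integD; [apply: integD => //; exact: integ_cst|exact: integZ].
rewrite lee_fin RintD//; [|by apply: integD => //; exact: integ_cst|exact: integZ].
rewrite RintD//; last exact: integ_cst.
rewrite f0 Rint_cst addr0 (le_trans _ (expR_ge1Dx _))//.
by rewrite lerD2l RintZ// ler_pM2l.
Qed.

End probability_integrals.

(** * Exponential moments of degenerate pair sums *)

Section mpow_integral.
Context d (T : measurableType d) (R : realType) (mu : {sigma_finite_measure set T -> \bar R}).

(** Fubini-Tonelli for the recursion defining the product measure. *)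
Lemma ge0_integral_mpowS n (F : n.+1.-tuple T -> \bar R) :
  measurable_fun setT F -> (forall t, 0 <= F t)%E ->
  (\int[mpow mu n.+1]_t F t =
   \int[mpow mu n]_t \int[mu]_z F (tuple_cons (t, z)))%E.
Proof.
move=> mF F0.
have mc := @measurable_tuple_cons _ T n.
transitivity (\int[pushforward (mpow mu n \x mu)%E (@tuple_cons _ T n)]_t F t)%E.
  by apply: eq_measure_integral => A mA _.
rewrite ge0_integral_pushforward//= preimage_setT.
apply: (@fubini_tonelli1 _ _ _ _ _ (mpow mu n) mu (F \o @tuple_cons _ T n)).
  exact: measurableT_comp.
by move=> x; exact: F0.
Qed.

Lemma integral_mpow0 (F : 0.-tuple T -> \bar R) :
  (\int[mpow mu 0]_t F t = F [tuple])%E.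
Proof.
have mF : measurable_fun setT F.
  move=> _ B mB; rewrite setTI.
  have [FB|nFB] := pselect (B (F [tuple])).
    rewrite (_ : _ @^-1` _ = setT)//; apply/seteqP; split => // t _ /=.
    by rewrite tuple0.
  rewrite (_ : _ @^-1` _ = set0)//; apply/seteqP; split => // t /=.
  by rewrite tuple0.
transitivity (\int[dirac [tuple]]_t F t)%E.
  by apply: eq_measure_integral => A mA _.
by rewrite integral_dirac// diracT mul1e.
Qed.

End mpow_integral.

Section exponential_moment.
Context d (T : measurableType d) (R : realType) (P : probability T R).
Variable k : T -> T -> R.

Definition ksum (s : seq T) (y : T) := \sum_(x <- s) k x y.

Fixpoint pairsum (s : seq T) : R :=
  if s is z :: t then pairsum t + ksum t z else 0.

Hypothesis mk : measurable_fun setT (fun p : T * T => k p.1 p.2).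
Hypothesis ksym : forall x y, k x y = k y x.

Lemma measurable_ksum n :
  measurable_fun setT (fun p : n.-tuple T * T => ksum p.1 p.2).
Proof.
under eq_fun do rewrite /ksum big_tuple.
apply: measurable_sum => i.
apply: (measurableT_comp mk (g := fun p : n.-tuple T * T => (tnth p.1 i, p.2))).
apply: measurable_fun_pair => //=.
exact: (measurableT_comp (measurable_tnth i) measurable_fst).
Qed.

Lemma measurable_pairsum n : measurable_fun setT (fun t : n.-tuple T => pairsum t).
Proof.
elim: n => [|n IH].
  rewrite (_ : (fun t => _) = cst 0); first exact: measurable_cst.
  by apply/funext => t; rewrite tuple0.
rewrite (_ : (fun t => _) = (fun p : n.-tuple T * T => pairsum p.1 + ksum p.1 p.2)
   \o @tuple_uncons _ T n); last first.
  by apply/funext => t; rewrite /= [in LHS](tuple_eta t).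
apply: measurableT_comp; last exact: measurable_tuple_uncons.
apply: measurable_funD; last exact: measurable_ksum.
exact: (measurableT_comp IH measurable_fst).
Qed.

Variables (N : nat) (q : R).
Hypothesis k0 : forall x, \int[P]_y k x y = 0.
Hypothesis k1 : forall x, \forall y \ae P, k x y <= 2^-1.
Hypothesis k2 : forall x, integ P (fun y => k x y ^+ 2).
Hypothesis kq : forall x, \int[P]_y (k x y ^+ 2) <= q.
Hypothesis q1 : 256 * q <= 1.

Lemma measurable_k1 x : measurable_fun setT (k x).
Proof. exact: (measurableT_comp mk (pair1_measurable x)). Qed.

Lemma L2_k x : L2 P (k x).
Proof. by split => //; exact: measurable_k1. Qed.

Lemma L2_ksum s : L2 P (ksum s).
Proof. by apply: L2_sum => x; exact: L2_k. Qed.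

(** The conditional variance of the increment of [pairsum] when a variable is
   added to the configuration. *)
Definition quadvar (s : seq T) := \int[P]_y (ksum s y ^+ 2).

Definition corr (s : seq T) z := \int[P]_y (ksum s y * k z y).

Lemma q_ge0 : 0 <= q.
Proof.
apply: le_trans (kq point); apply: Rintegral_ge0 => x _; exact: sqr_ge0.
Qed.

Lemma quadvar_ge0 s : 0 <= quadvar s.
Proof. by apply: Rintegral_ge0 => x _; exact: sqr_ge0. Qed.

Lemma quadvar_cons z s :
  quadvar (z :: s) <= quadvar s + 2 * corr s z + q.
Proof.
have i1 := (L2_ksum s).2; have i3 := k2 z.
have i2 := L2_mul (L2_ksum s) (L2_k z).
rewrite (_ : quadvar (z :: s) = quadvar s + 2 * corr s z + \int[P]_y (k z y ^+ 2)).
  by rewrite lerD2l.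
rewrite /quadvar /corr -RintZ// -RintD//; last exact: integZ.
rewrite -RintD//; last by apply: integD => //; exact: integZ.
by apply: eq_Rintegral => y _; rewrite /ksum big_cons; ring.
Qed.

Lemma norm_corr s z : `|corr s z| <= (size s)%:R * q.
Proof.
rewrite /corr.
have -> : \int[P]_y (ksum s y * k z y) = \sum_(x <- s) \int[P]_y (k x y * k z y).
  rewrite -Rint_sum => [|x]; last by apply: L2_mul; exact: L2_k.
  by apply: eq_Rintegral => y _; rewrite /ksum mulr_suml.
rewrite (le_trans (ler_norm_sum _ _ _))// -sum1_size natr_sum mulr_suml.
apply: ler_sum => x _; rewrite mul1r.
apply: (le_trans (le_Rint_norm (L2_mul (L2_k x) (L2_k z)))).
apply: (@le_trans _ _ (2^-1 * (\int[P]_y (k x y ^+ 2) + \int[P]_y (k z y ^+ 2)))).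
  rewrite -RintD// -RintZ//; last exact: integD.
  apply: Rint_le.
  - by apply: integ_norm; apply: L2_mul; exact: L2_k.
  - by apply: integZ; exact: integD.
  - move=> y; rewrite normrM -(real_normK (num_real (k x y))).
    rewrite -(real_normK (num_real (k z y))).
    by have := sqr_ge0 (`|k x y| - `|k z y|); nra.
by have := kq x; have := kq z; lra.
Qed.

Lemma corr2 s z : corr s z ^+ 2 <= quadvar s * q.
Proof.
apply: (le_trans (CauchySchwarz (L2_ksum s) (L2_k z))).
by rewrite ler_wpM2l// quadvar_ge0.
Qed.

Lemma measurable_corr s : measurable_fun setT (corr s).
Proof.
apply: (@measurable_fun_param_Rintegral _ _ _ _ _ P
  (fun p : T * T => ksum s p.2 * k p.1 p.2)).
apply: measurable_funM => //.
exact: (measurableT_comp (L2_ksum s).1 measurable_snd).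
Qed.

Lemma L2_corr s : L2 P (corr s).
Proof.
split; first exact: measurable_corr.
apply: (@integ_bdd _ _ _ _ _ (quadvar s * q)).
  by apply: measurable_funX; exact: measurable_corr.
by move=> z; rewrite ger0_norm ?sqr_ge0// corr2.
Qed.

(** Fubini and the symmetry of [k] move the integral in [z] onto [k]. *)
Lemma corr_centred s : \int[P]_z corr s z = 0.
Proof.
pose F := fun p : T * T => ksum s p.2 * k p.1 p.2.
have mF : measurable_fun setT F.
  apply: measurable_funM => //.
  exact: (measurableT_comp (L2_ksum s).1 measurable_snd).
have iF : integ (P \x P)%E F.
  apply/integrable12ltyP; first exact/measurable_EFinP.
  apply: (@le_lt_trans _ _ (\int[P]_x (quadvar s + q)%:E)%E); last first.
    by rewrite -Rint_EFin ?ltry//; exact: integ_cst.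
  apply: ge0_le_integral => //.
  - by move=> x _; exact: integral_ge0.
  - have mF' : measurable_fun setT (fun p => `|(F p)%:E|%E).
      by apply: measurableT_comp => //; exact/measurable_EFinP.
    by apply: (@measurable_fun_fubini_tonelli_F _ _ _ _ _ P _ mF') => p; exact: abse_ge0.
  move=> x _.
  have i : integ P (fun y => F (x, y)) by apply: L2_mul; [exact: L2_ksum|exact: L2_k].
  have := Rint_EFin (integ_norm i) => /= <-; rewrite lee_fin.
  apply: (@le_trans _ _ (quadvar s + \int[P]_y (k x y ^+ 2))); last by rewrite lerD2l.
  rewrite -RintD//; last exact: (L2_ksum s).2.
  apply: Rint_le; first exact: integ_norm.
    by apply: integD => //; exact: (L2_ksum s).2.
  move=> y; rewrite /F/= normrM -(real_normK (num_real (k x y))).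
  rewrite -(real_normK (num_real (ksum s y))).
  by have := normr_ge0 (k x y); have := normr_ge0 (ksum s y); nra.
have i1 x : integ P (fun y => F (x, y)) by apply: L2_mul; [exact: L2_ksum|exact: L2_k].
have := Fubini iF; rewrite /=.
have -> : (\int[P]_x \int[P]_y (F (x, y))%:E = \int[P]_z (corr s z)%:E)%E.
  by apply: eq_integral => z _; rewrite -Rint_EFin.
have -> : (\int[P]_y \int[P]_x (F (x, y))%:E = 0)%E.
  apply: integral0_eq => y _.
  have -> : (\int[P]_x (F (x, y))%:E = \int[P]_x (ksum s y * k y x)%:E)%E.
    by apply: eq_integral => x _; rewrite /F/= (ksym x).
  rewrite -Rint_EFin; last by apply: integZ; exact: L2_integ (L2_k y).
  by rewrite RintZ ?k0 ?mulr0//; exact: L2_integ (L2_k y).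
by rewrite /Rintegral => ->.
Qed.

Lemma ksum_le n (t : n.-tuple T) : \forall y \ae P, ksum t y <= n%:R * 2^-1.
Proof.
suff /(_ t) : forall s : seq T, \forall y \ae P, ksum s y <= (size s)%:R * 2^-1.
  by rewrite size_tuple.
elim=> [|x s IH].
  by apply: aeW => y; rewrite /ksum big_nil mul0r.
apply: filterS2 (k1 x) IH => y kx ks.
rewrite /ksum big_cons/= -/(ksum s y) -natr1; lra.
Qed.

Lemma ksum_centred s : \int[P]_y ksum s y = 0.
Proof.
rewrite Rint_sum => [|x]; last exact: L2_integ (L2_k x).
by under eq_bigr do rewrite k0; rewrite big1.
Qed.

(** One step of the induction: integrating out the newest variable costs a
   multiple of the quadratic variation and a constant. The bounds on [a] and [q]
   keep the exponent, once centred, below 1. *)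
Lemma exp_step n (t : n.-tuple T) (a : R) : (n < N)%N -> 0 <= a ->
  a * N%:R <= 8 ->
  (\int[P]_z (expR (pairsum (z :: t) / N%:R + a * quadvar (z :: t)))%:E <=
   (expR (pairsum t / N%:R + (a + 4 / N%:R ^+ 2 + 16 * q * a ^+ 2) * quadvar t +
     a * q))%:E)%E.
Proof.
move=> nN a0 aN.
have N0 : 0 < N%:R :> R by rewrite ltr0n (leq_ltn_trans _ nN).
pose X z := N%:R^-1 * ksum t z + (2 * a) * corr t z.
have hX : L2 P X by apply: L2D; apply: L2Z; [exact: L2_ksum|exact: L2_corr].
have q0 := q_ge0.
have X0 : \int[P]_z X z = 0.
  have ik := L2_integ (L2_ksum t); have ic := L2_integ (L2_corr t).
  rewrite RintD; [|exact: integZ|exact: integZ].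
  by rewrite !RintZ// ksum_centred corr_centred !mulr0 addr0.
have X1 : \forall z \ae P, X z <= 1.
  apply: filterS (ksum_le t) => z kz; rewrite /X.
  have c1 : N%:R^-1 * ksum t z <= 2^-1.
    rewrite mulrC ler_pdivrMr// (le_trans kz)// mulrC ler_wpM2l// ler_nat; exact: ltnW.
  have c2 : 2 * a * corr t z <= 2^-1.
    have := norm_corr t z; rewrite size_tuple => nc.
    have : corr t z <= N%:R * q.
      apply: le_trans (ler_norm _) (le_trans nc _).
      by rewrite ler_wpM2r// ler_nat ltnW.
    move=> cz.
    have : 2 * a * corr t z <= 2 * a * (N%:R * q) by rewrite ler_wpM2l// mulr_ge0.
    move=> /le_trans; apply.
    rewrite (_ : 2 * a * (N%:R * q) = (a * N%:R) * (2 * q)); last by ring.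
    apply: (@le_trans _ _ (8 * (2 * q))); last by have := q1; lra.
    by rewrite ler_wpM2r// mulr_ge0.
  by lra.
have X2 : \int[P]_z (X z ^+ 2) <=
    (2 / N%:R ^+ 2 + 8 * q * a ^+ 2) * quadvar t.
  apply: (@le_trans _ _ (\int[P]_z ((2 / N%:R ^+ 2) * ksum t z ^+ 2 +
       (8 * q * a ^+ 2) * quadvar t))).
    apply: Rint_le.
    - exact: hX.2.
    - apply: integD; last exact: integ_cst.
      by apply: integZ; exact: (L2_ksum t).2.
    - move=> z; rewrite /X; have := corr2 t z.
      set u := N%:R^-1 * _; set w := corr t z => cz.
      have -> : 2 / N%:R ^+ 2 * ksum t z ^+ 2 = 2 * u ^+ 2.
        by rewrite /u exprMn exprVn -mulrA.
      apply: (@le_trans _ _ (2 * u ^+ 2 + 2 * (2 * a * w) ^+ 2)).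
        by have := sqr_ge0 (u - 2 * a * w); nra.
      rewrite lerD2l exprMn exprMn.
      have -> : 8 * q * a ^+ 2 * quadvar t = 2 * (2 ^+ 2 * a ^+ 2 * (quadvar t * q)) by ring.
      by rewrite ler_wpM2l// ler_wpM2l// mulr_ge0 ?sqr_ge0.
  rewrite RintD ?Rint_cst; last exact: integ_cst.
    rewrite RintZ; last exact: (L2_ksum t).2.
    by rewrite [leRHS]mulrDl.
  by apply: integZ; exact: (L2_ksum t).2.
have mX := hX.1.
apply: (@le_trans _ _ (\int[P]_z
   ((expR (pairsum t / N%:R + a * quadvar t + a * q))%:E * (expR (X z))%:E))%E).
  apply: ge0_le_integral => //.
  - apply/measurable_EFinP; apply: measurableT_comp => //.
    apply: measurable_funD.
      apply: measurable_funM => //=; apply: measurable_funD => //.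
      exact: (L2_ksum t).1.
    apply: measurable_funM => //.
    apply: (@measurable_fun_param_Rintegral _ _ _ _ _ P
      (fun p : T * T => ksum (p.1 :: t) p.2 ^+ 2)).
    apply: measurable_funX; rewrite /ksum.
    under eq_fun do rewrite big_cons; apply: measurable_funD => //.
    exact: (measurableT_comp (L2_ksum t).1 measurable_snd).
  - by apply/measurable_EFinP; apply: measurable_funM => //; exact: measurableT_comp.
  - move=> z _; rewrite -EFinM lee_fin -expRD ler_expR /X /=.
    have := quadvar_cons z t => qc.
    have : a * quadvar (z :: t) <= a * (quadvar t + 2 * corr t z + q) by rewrite ler_wpM2l.
    by rewrite mulrDl (mulrC N%:R^-1); lra.
rewrite ge0_integralZl//; last by apply/measurable_EFinP; exact: measurableT_comp.
apply: (@le_trans _ _ ((expR (pairsum t / N%:R + a * quadvar t + a * q))%:E *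
   (expR (2 * ((2 / N%:R ^+ 2 + 8 * q * a ^+ 2) * quadvar t)))%:E)%E).
  rewrite lee_pmul2l// ?lte_fin ?expR_gt0//.
  exact: exp_centred.
rewrite -EFinM lee_fin -expRD ler_expR.
by rewrite le_eqVlt; apply/orP; left; apply/eqP; ring.
Qed.

(** The Lyapunov functional: the quadratic variation enters with a weight that
   decreases to 0 as the last variable is reached, so that each integration of
   a variable is paid for by the decrease of the weight. *)
Lemma exp_lyapunov n : (n <= N)%N -> (0 < N)%N ->
  (\int[mpow P n]_t (expR (pairsum t / N%:R +
     8 * (N - n)%:R / N%:R ^+ 2 * quadvar t))%:E <=
   (expR (8 * q * n%:R / N%:R))%:E)%E.
Proof.
move=> + N0; have NR : 0 < N%:R :> R by rewrite ltr0n.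
elim: n => [_|n IH nN].
  rewrite integral_mpow0/= mul0r add0r.
  have -> : quadvar [::] = 0.
    rewrite /quadvar; under eq_Rintegral do rewrite /ksum big_nil expr0n/=.
    by rewrite Rint_cst.
  by rewrite mulr0 mulr0 mul0r.
have mF m (c : R) : measurable_fun setT
    (fun t : m.-tuple T => (expR (pairsum t / N%:R + c * quadvar t))%:E).
  apply/measurable_EFinP; apply: measurableT_comp => //.
  apply: measurable_funD.
    by apply: measurable_funM => //; exact: measurable_pairsum.
  apply: measurable_funM => //.
  apply: (@measurable_fun_param_Rintegral _ _ _ _ _ P
    (fun p : m.-tuple T * T => ksum p.1 p.2 ^+ 2)).
  by apply: measurable_funX; exact: measurable_ksum.
set a := 8 * (N - n.+1)%:R / N%:R ^+ 2.
have a0 : 0 <= a by rewrite /a divr_ge0 ?mulr_ge0 ?sqr_ge0.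
have q0 := q_ge0.
have aN : a * N%:R <= 8.
  rewrite /a.
  have -> : 8 * (N - n.+1)%:R / N%:R ^+ 2 * N%:R = 8 * (N - n.+1)%:R / N%:R :> R.
    by field; rewrite gt_eqF.
  by rewrite ler_pdivrMr// ler_wpM2l// ler_nat leq_subr.
rewrite ge0_integral_mpowS//.
apply: (@le_trans _ _ (\int[mpow P n]_t ((expR (8 * q / N%:R))%:E *
   (expR (pairsum t / N%:R + 8 * (N - n)%:R / N%:R ^+ 2 * quadvar t))%:E))%E).
  apply: ge0_le_integral => //.
  - by move=> t _; apply: integral_ge0 => z _; rewrite lee_fin expR_ge0.
  - have mG := measurableT_comp (mF n.+1 a) (@measurable_tuple_cons _ T n).
    by apply: (@measurable_fun_fubini_tonelli_F _ _ _ _ _ P _ mG) => p; rewrite lee_fin expR_ge0.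
  - by apply: measurable_funeM; exact: mF.
  move=> t _; apply: (le_trans (exp_step t nN a0 aN)).
  rewrite -EFinM lee_fin -expRD ler_expR.
  have v0 := quadvar_ge0 t.
  have i0 : 0 <= N%:R^-1 :> R by rewrite invr_ge0 ltW.
  have aq : a * q <= 8 * q / N%:R.
    rewrite ler_pdivlMr//.
    rewrite (_ : a * q * N%:R = (a * N%:R) * q); last by ring.
    by rewrite ler_wpM2r.
  have -> : 8 * (N - n)%:R / N%:R ^+ 2 = a + 8 / N%:R ^+ 2 :> R.
    have -> : (N - n)%:R = (N - n.+1)%:R + 1 :> R by rewrite natr1 subnSK.
    by rewrite /a; field; rewrite gt_eqF.
  have a2 : 16 * q * a ^+ 2 <= 4 / N%:R ^+ 2.
    rewrite ler_pdivlMr ?exprn_gt0//.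
    rewrite (_ : 16 * q * a ^+ 2 * N%:R ^+ 2 = 16 * q * (a * N%:R) ^+ 2); last by ring.
    apply: (@le_trans _ _ (16 * q * 8 ^+ 2)); last by have := q1; lra.
    rewrite ler_wpM2l ?mulr_ge0// lerXn2r ?nnegrE// mulr_ge0// ltW//.
  have : (a + 4 / N%:R ^+ 2 + 16 * q * a ^+ 2) * quadvar t <=
     (a + 8 / N%:R ^+ 2) * quadvar t.
    rewrite ler_wpM2r// -addrA lerD2l.
    have -> : 8 / N%:R ^+ 2 = 4 / N%:R ^+ 2 + 4 / N%:R ^+ 2 :> R by rewrite -mulrDl; congr (_ / _); ring.
    by rewrite lerD2l.
  by lra.
rewrite ge0_integralZl//; last exact: mF.
apply: (@le_trans _ _ ((expR (8 * q / N%:R))%:E * (expR (8 * q * n%:R / N%:R))%:E)%E).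
  by rewrite lee_pmul2l// ?lte_fin ?expR_gt0//; apply: IH; exact: ltnW.
rewrite -EFinM lee_fin -expRD ler_expR -natr1.
by rewrite le_eqVlt; apply/orP; left; apply/eqP; field; rewrite gt_eqF.
Qed.

(** Seen as a function of the number of variables, [pairsum] is a martingale with
   increments bounded above by a fraction of [N] and variance at most [N^2 q],
   so that dividing by [N] leaves an exponential moment independent of [N]. *)
Theorem exp_moment_degenerate : (0 < N)%N ->
  (\int[mpow P N]_t (expR (pairsum t / N%:R))%:E <= (expR (8 * q))%:E)%E.
Proof.
move=> N0; have := exp_lyapunov (leqnn N) N0.
rewrite subnn mulr0 mul0r; under eq_integral do rewrite mul0r addr0.
by rewrite -mulrA divff ?mulr1// pnatr_eq0 -lt0n.
Qed.

End exponential_moment.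

(** * Relative entropy of a tilted measure *)

Section change_of_variables.
Local Open Scope ereal_scope.
Context d (T : measurableType d) (R : realType) (mu : {measure set T -> \bar R}).
Variables (h : T -> R).
Hypotheses (mh : measurable_fun setT h) (h0 : forall x, (0 <= h x)%R).

Import HBNNSimple.

(** The weighted measure is defined by integrals of indicators; monotone
   convergence extends the formula from simple functions. *)
Lemma ge0_integral_mweight (f : T -> \bar R) :
  measurable_fun setT f -> (forall x, 0 <= f x) ->
  \int[mweight mu mh h0]_x f x = \int[mu]_x (f x * (h x)%:E).
Proof.
move=> mf f0; set nu := mweight mu mh h0.
pose u := nnsfun_approx measurableT mf.
have mhE : measurable_fun setT (EFin \o h) by exact/measurable_EFinP.
have ux x : EFin \o u ^~ x @ \oo --> f x by apply: cvg_nnsfun_approx.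
have -> : \int[nu]_x f x = limn (fun n => \int[nu]_x (EFin \o u n) x).
  under eq_integral do rewrite -(cvg_lim _ (ux _))//.
  apply: monotone_convergence => //.
  - by move=> n; apply/measurable_EFinP.
  - by move=> n x _; rewrite lee_fin.
  - by move=> x _ a b ab; rewrite lee_fin; exact/lefP/nd_nnsfun_approx.
have -> : \int[mu]_x (f x * (h x)%:E) =
    limn (fun n => \int[mu]_x ((EFin \o u n) x * (h x)%:E)).
  have uhx x : (EFin \o u n) x * (h x)%:E @[n --> \oo] --> f x * (h x)%:E.
    exact: cvgeZr (ux x).
  under eq_integral do rewrite -(cvg_lim _ (uhx _))//.
  apply: monotone_convergence => //.
  - by move=> n; apply/emeasurable_funM => //; exact/measurable_EFinP.
  - by move=> n x _; rewrite mule_ge0// lee_fin.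
  - move=> x _ a b ab; rewrite lee_wpmul2r ?lee_fin//.
    exact/lefP/nd_nnsfun_approx.
suff suf n : \int[mu]_x ((EFin \o u n) x * (h x)%:E) = \int[nu]_x (EFin \o u n) x.
  by under eq_fun do rewrite -suf.
transitivity (\int[nu]_x
   (\sum_(y \in range (u n)) (y * \1_(u n @^-1` [set y]) x)%:E)); last first.
  by apply: eq_integral => t tE; rewrite /= fimfunE -fsumEFin.
have indich m r : measurable_fun setT (fun x => (r * \1_(u m @^-1` [set r]) x)%:E).
  by apply: (measurable_comp measurableT) => //; exact: measurable_funM.
rewrite ge0_integral_fsum//; last by move=> m y Ey; exact: nnfun_muleindic_ge0.
transitivity (\int[mu]_x (\sum_(y \in range (u n))
    (y * \1_(u n @^-1` [set y]) x)%:E * (h x)%:E)).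
  under [RHS]eq_integral => x xE.
    rewrite -ge0_mule_fsuml => [|y]; last exact: nnfun_muleindic_ge0.
    rewrite fsumEFin // -(fimfunE _ x); over.
  by [].
rewrite ge0_integral_fsum//; last 2 first.
- by move=> y; apply: emeasurable_funM; [exact: indich|exact: mhE].
- by move=> m y Ey; rewrite mule_ge0//; [exact: nnfun_muleindic_ge0|rewrite lee_fin].
apply: eq_fsbigr => r rhn.
under [RHS]eq_integral do rewrite EFinM.
rewrite integralZl_indic_nnsfun => //.
under eq_integral do rewrite EFinM -muleA.
rewrite ge0_integralZl//.
- under eq_integral do rewrite muleC.
  rewrite (eq_integral ((EFin \o h) \_ (u n @^-1` [set r]))); last first.
    by move=> x xE; rewrite epatch_indic.
  by rewrite -integral_mkcondr integral_indic// setTI setIT.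
- by apply: emeasurable_funM; first exact/measurable_EFinP.
- by move=> t Et; rewrite mule_ge0 ?lee_fin.
- by move: rhn; rewrite inE => -[t _ <-]; rewrite lee_fin.
Qed.

End change_of_variables.

Section entropy.
Local Open Scope ereal_scope.
Local Open Scope charge_scope.
Context d (E : measurableType d) (R : realType) (N : nat).
Variable M : probability (N.-tuple E) R.
Variables (w : N.-tuple E -> R) (mw : measurable_fun setT w).
Hypothesis w0 : forall x, (0 <= w x)%R.
Variable d0 : probability (N.-tuple E) R.
Hypothesis w_gt0 : forall x, (0 < w x)%R.
Hypothesis wi : integ M w.
Let Z := (\int[M]_x w x)%R.
Hypothesis Z0 : (0 < Z)%R.

Let Q : probability (N.-tuple E) R := mnormalize (mweight M mw w0) d0.

Let v x := (w x / Z)%R.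

Let mv : measurable_fun setT v.
Proof. exact: measurable_funM. Qed.

Let v_gt0 x : (0 < v x)%R. Proof. exact: divr_gt0. Qed.

Let v_ge0 x : (0 <= v x)%R. Proof. exact/ltW. Qed.

Let QE A : measurable A -> Q A = mweight M mv v_ge0 A.
Proof.
move=> mA; rewrite /Q /= /mnormalize; set z := (X in fine X).
have zE : z = Z%:E by rewrite /z /= /mweight -Rint_EFin.
case: ifPn => [/orP[/eqP z0|/eqP zy]|_].
- have : Z%:E = 0 by rewrite -zE; exact: z0.
  by move=> [] Z00; move: Z0; rewrite Z00 ltxx.
- by have : Z%:E = +oo by rewrite -zE; exact: zy.
rewrite zE /= /mweight /v.
under [RHS]eq_integral do rewrite EFinM.
rewrite ge0_integralZr//.
- by apply/measurable_EFinP; exact: measurable_funTS.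
- by move=> x _; rewrite lee_fin.
- by rewrite lee_fin invr_ge0 ltW.
Qed.

Let integral_Q (f : N.-tuple E -> \bar R) : measurable_fun setT f ->
  (forall x, 0 <= f x) -> \int[Q]_x f x = \int[M]_x (f x * (v x)%:E).
Proof.
move=> mf f0; rewrite -(ge0_integral_mweight _ mv v_ge0)//.
by apply: eq_measure_integral => A mA _; exact: QE.
Qed.

Let QM : Q `<< M.
Proof.
apply/null_content_dominatesP => A mA A0; rewrite QE// /mweight.
by apply: null_set_integral => //; apply/measurable_EFinP; exact: measurable_funTS.
Qed.

Let MQ : M `<< Q.
Proof.
apply/null_content_dominatesP => A mA QA0.
have A0 : \int[M]_(x in A) (v x)%:E = 0 by rewrite -[LHS](QE mA).
have mvA : measurable_fun A (EFin \o v).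
  by apply/measurable_EFinP; exact: measurable_funTS.
have /(ae_eq_integral_abs M mA mvA) : \int[M]_(x in A) `|(EFin \o v) x| = 0.
  by under eq_integral do rewrite /= ger0_norm//.
move=> [B [mB B0 sB]]; apply: (subset_measure0 mA mB _ B0).
apply: subset_trans sB => x Ax /= /(_ Ax) /eqP.
by rewrite /= eqe gt_eqF.
Qed.

Let RNQM : ae_eq M setT (EFin \o v) ('d (charge_of_finite_measure Q) '/d M).
Proof.
have iv : integ M v.
  apply: eq_integrable (integZ Z^-1 wi) => // x _ /=; by rewrite mulrC.
apply: integral_ae_eq => //.
move=> A _ mA; rewrite -Radon_Nikodym_integral//.
exact/esym/QE.
Qed.

Let RNMQ : ae_eq Q setT (fun x => ((v x)^-1)%:E)
  ('d (charge_of_finite_measure M) '/d Q).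
Proof.
have mvV : measurable_fun setT (fun x => ((v x)^-1)%:E).
  rewrite (_ : (fun x => _) = fun x => (expR (- ln (v x)))%:E); last first.
    by apply/funext => x; rewrite expRN lnK// posrE.
  apply/measurable_EFinP; apply: measurableT_comp => //; apply: measurableT_comp => //.
  by apply: measurableT_comp => //; exact: measurable_ln.
have key A : measurable A -> \int[Q]_(x in A) ((v x)^-1)%:E = M A.
  move=> mA; rewrite integral_mkcond integral_Q; last 2 first.
  - by apply/measurable_restrict => //; exact: measurable_funTS.
  - by move=> x; rewrite patchE; case: ifP => // _; rewrite lee_fin invr_ge0.
  transitivity (\int[M]_x (\1_A x)%:E); last by rewrite integral_indic// setIT.
  apply: eq_integral => x _; rewrite patchE indicE; case: ifP => _.
    by rewrite -EFinM mulVf// gt_eqF.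
  by rewrite mul0e.
apply: integral_ae_eq => //.
- apply/integrableP; split=> //.
  under eq_integral do rewrite gee0_abs ?lee_fin ?invr_ge0//.
  rewrite key//; apply: le_lt_trans (ltry 1).
  exact: probability_le1.
- by move=> A _ mA; rewrite key// -Radon_Nikodym_integral.
Qed.

Let measurable_lne_comp (f : N.-tuple E -> \bar R) :
  measurable_fun setT f -> (forall x, f x \is a fin_num) ->
  measurable_fun setT (fun x => lne (f x)).
Proof.
move=> mf ff.
rewrite (_ : (fun x => lne (f x)) = fun x => if (fine (f x) <= 0)%R then -oo else (ln (fine (f x)))%:E); last first.
  by apply/funext => x /=; rewrite -[in LHS](fineK (ff x)).
have mff : measurable_fun setT (fine \o f) by exact: measurableT_comp.
apply: measurable_fun_ifT => //.
- exact: measurable_fun_ler.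
- by apply/measurable_EFinP; apply: measurableT_comp => //; exact: measurable_ln.
Qed.

(** The bound ln x <= x trades the entropy for the second moment of the weight. *)
Lemma entropy_tilt_le (C : R) : integ M (fun x => w x ^+ 2)%R ->
  (\int[M]_x (w x ^+ 2) <= C * Z ^+ 2)%R ->
  rel_entropy Q M <= (C / N%:R)%:E.
Proof.
move=> w2i hC; rewrite /rel_entropy; case: pselect => [QM'|//].
rewrite (_ : (C / N%:R)%:E = (N%:R^-1)%:E * C%:E); last by rewrite -EFinM mulrC.
apply: lee_wpmul2l; first by rewrite lee_fin invr_ge0.
have iRN : M.-integrable setT ('d (charge_of_finite_measure Q) '/d M).
  exact: Radon_Nikodym_integrable.
have mL : measurable_fun setT (fun x => lne (('d (charge_of_finite_measure Q) '/d M) x)).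
  apply: measurable_lne_comp; first exact: measurable_int iRN.
  by move=> x; exact: Radon_Nikodym_fin_num.
rewrite integralE; apply: (@le_trans _ _ (\int[Q]_x ((v x)%:E))).
  apply: (@le_trans _ _ (\int[Q]_z (fun x => lne (('d (charge_of_finite_measure Q) '/d M) x))^\+ z)).
    by rewrite -[leRHS]adde0 leeD// oppe_le0 integral_ge0.
  apply: ae_ge0_le_integral => //.
  - exact: measurable_funepos.
  - by move=> x _; rewrite lee_fin.
  - exact/measurable_EFinP.
  apply: filterS (null_dominates_ae_eq measurableT QM RNQM) => x /(_ I) /= RNx _.
  rewrite [X in X <= _](_ : _ = (fun y => lne (v y)%:E)^\+ x); last first.
    by rewrite !funeposE; congr (maxe (lne _) _); exact/esym/RNx.
  rewrite funeposE lne_EFin// -EFin_max lee_fin ge_max v_ge0 andbT.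
  exact/ltW/ln_sublinear.
rewrite integral_Q//; last exact/measurable_EFinP.
under eq_integral do rewrite -EFinM.
have -> : (fun x => (v x * v x)%:E) = EFin \o (fun x => Z ^- 2 * w x ^+ 2)%R.
  by apply/funext => x; rewrite /v /= -expr2 exprMn exprVn mulrC.
rewrite -[leLHS]Rint_EFin; last exact: integZ.
rewrite RintZ// lee_fin mulrC ler_pdivrMr ?exprn_gt0//.
Qed.

Lemma entropy_untilt : integ M (fun x => ln (w x)) ->
  rel_entropy M Q = ((ln Z - \int[M]_x ln (w x)) / N%:R)%:E.
Proof.
move=> lwi; rewrite /rel_entropy; case: pselect => [MQ'|//].
have iRN : Q.-integrable setT ('d (charge_of_finite_measure M) '/d Q).
  exact: Radon_Nikodym_integrable.
have mL : measurable_fun setT (fun x => lne (('d (charge_of_finite_measure M) '/d Q) x)).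
  apply: measurable_lne_comp; first exact: measurable_int iRN.
  by move=> x; exact: Radon_Nikodym_fin_num.
have mlw : measurable_fun setT (fun x => ln Z - ln (w x))%R.
  by apply: measurable_funB => //; exact: (integ_measurable lwi).
rewrite (@ae_eq_integral _ _ _ _ _ (fun x => (ln Z - ln (w x))%:E))//.
- rewrite -[X in _ * X]Rint_EFin; last by apply: integB => //; exact: integ_cst.
  by rewrite RintB ?Rint_cst//; [rewrite -EFinM mulrC|exact: integ_cst].
- exact/measurable_EFinP.
apply: filterS (null_dominates_ae_eq measurableT MQ RNMQ) => x /(_ I) /= <- _.
rewrite lne_EFin ?invr_gt0// /v invf_div ln_div// posrE//.
Qed.

End entropy.

(** * Energies of configurations *)

Section mpow_expectation.
Context d (T : measurableType d) (R : realType) (P : probability T R).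

(** Fubini for signed functions, the last clause of the hypotheses giving the
   integrability that the conclusion asserts. *)
Lemma mpowS_expectation n (F : n.+1.-tuple T -> R) :
  measurable_fun setT F ->
  (forall t, integ P (fun z => F (tuple_cons (t, z)))) ->
  integ (mpow P n) (fun t => \int[P]_z `|F (tuple_cons (t, z))|) ->
  integ (mpow P n.+1) F /\
  \int[mpow P n.+1]_t F t = \int[mpow P n]_t \int[P]_z F (tuple_cons (t, z)).
Proof.
move=> mF Fi Hi; have mc := @measurable_tuple_cons _ T n.
have mFc : measurable_fun setT (F \o @tuple_cons _ T n) by exact: measurableT_comp.
have iFc : integ (mpow P n \x P)%E (F \o @tuple_cons _ T n).
  apply/integrable12ltyP; first exact/measurable_EFinP.
  move/integrableP : Hi => [_]; apply: le_lt_trans; rewrite le_eqVlt.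
  apply/orP; left; apply/eqP; apply: eq_integral => t _ /=.
  have := Rint_EFin (integ_norm (Fi t)) => /= <-.
  by rewrite ger0_norm//; apply: Rintegral_ge0 => x _.
split.
  apply/integrableP; split; first exact/measurable_EFinP.
  rewrite ge0_integral_mpowS//; last first.
    by apply: measurableT_comp => //; exact/measurable_EFinP.
  by move/integrable12ltyP : iFc; apply; exact/measurable_EFinP.
rewrite {1}/Rintegral.
have -> : (\int[mpow P n.+1]_t (F t)%:E =
    \int[pushforward (mpow P n \x P)%E (@tuple_cons _ T n)]_t (F t)%:E)%E.
  by apply: eq_measure_integral => A mA _.
rewrite integral_pushforward//=; last first.
  exact/measurable_EFinP.
rewrite preimage_setT -(integral12_prod_meas1 iFc) /Rintegral; congr fine.
apply: eq_integral => t _; rewrite /fubini_F /=.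
by have := Rint_EFin (Fi t) => /= ->.
Qed.

Definition addsum (u : T -> R) (s : seq T) := \sum_(x <- s) u x.

Lemma measurable_addsum n (u : T -> R) : measurable_fun setT u ->
  measurable_fun setT (fun t : n.-tuple T => addsum u t).
Proof.
move=> mu; under eq_fun do rewrite /addsum big_tuple.
by apply: measurable_sum => i; exact: (measurableT_comp mu (measurable_tnth i)).
Qed.

Lemma integral0_mpow0 (F : 0.-tuple T -> R) :
  integ (mpow P 0) F /\ \int[mpow P 0]_t F t = F [tuple].
Proof.
have FE : F = cst (F [tuple]) by apply/funext => t; rewrite [t]tuple0.
split; first by rewrite FE; exact: integ_cst.
by rewrite /Rintegral integral_mpow0.
Qed.

Lemma addsum_expectation n (u : T -> R) : integ P u ->
  integ (mpow P n) (addsum u) /\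
  \int[mpow P n]_t addsum u t = n%:R * \int[P]_x u x.
Proof.
move=> ui; have mu := integ_measurable ui.
elim: n => [|n [IHi IH]].
  have [i ->] := integral0_mpow0 (fun t => addsum u t).
  by rewrite /addsum big_nil mul0r.
have E t z : addsum u (tuple_cons (t : n.-tuple T, z)) = u z + addsum u t.
  by rewrite /addsum /= big_cons.
have Fi t : integ P (fun z => addsum u (tuple_cons (t : n.-tuple T, z))).
  by under [X in EFin \o X]eq_fun do rewrite E; apply: integD => //; exact: integ_cst.
have ma k : measurable_fun setT (fun t : k.-tuple T => addsum u t).
  exact: measurable_addsum.
have [|i ->] := mpowS_expectation (ma n.+1) Fi.
  apply: (integ_dom _ _ (integD (integ_cst (mpow P n) (\int[P]_x `|u x|)) (integ_norm IHi))).
    apply: (@measurable_fun_param_Rintegral _ _ _ _ _ P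
      (fun p => `|addsum u (tuple_cons p)|)).
    apply: measurableT_comp => //.
    apply: (measurableT_comp (ma n.+1)).
    exact: measurable_tuple_cons.
  move=> t; rewrite ger0_norm; last by apply: Rintegral_ge0 => x _.
  rewrite -[X in _ <= _ + X](Rint_cst P) -RintD; [|exact: integ_norm|exact: integ_cst].
  apply: Rint_le; first exact: integ_norm.
    by apply: integD; [exact: integ_norm|exact: integ_cst].
  by move=> z; rewrite E ler_normD.
split => //; under eq_Rintegral => t _.
  under eq_Rintegral do rewrite E.
  rewrite RintD// ?Rint_cst; last exact: integ_cst.
  over.
rewrite RintD// ?Rint_cst; last exact: integ_cst.
by rewrite IH -natr1 mulrDl mul1r addrC.
Qed.

End mpow_expectation.

Section energy.
Context d (T : measurableType d) (R : realType) (P : probability T R).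
Implicit Types K A r : T -> T -> R.

Definition potential K x := \int[P]_y K x y.

Definition selfenergy K := \int[P]_x potential K x.

(** [N] times the modulated energy of the configuration [s] for the
   interaction [K], diagonal included. *)
Definition energy K N (s : seq T) : R :=
  (2 * N%:R)^-1 * (\sum_(x <- s) \sum_(y <- s) K x y) - addsum (potential K) s
  + N%:R / 2 * selfenergy K.

Definition kernel K := [/\ measurable_fun setT (fun p : T * T => K p.1 p.2),
  forall x y, K x y = K y x, forall x, integ P (K x) &
  integ P (fun x => \int[P]_y `|K x y|)].

Lemma measurable_potential K :
  measurable_fun setT (fun p : T * T => K p.1 p.2) ->
  measurable_fun setT (potential K).
Proof. exact: (@measurable_fun_param_Rintegral _ _ _ _ _ P (fun p => K p.1 p.2)). Qed.

Lemma integ_potential K : kernel K -> integ P (potential K).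
Proof.
move=> [mK _ Ki Ka]; apply: (integ_dom _ _ Ka); first exact: measurable_potential.
by move=> x; exact: le_Rint_norm.
Qed.

Lemma kernelD K A : kernel K -> kernel A -> kernel (fun x y => K x y + A x y).
Proof.
move=> [mK sK Ki Ka] [mA sA Ai Aa].
have m : measurable_fun setT (fun p : T * T => K p.1 p.2 + A p.1 p.2).
  exact: measurable_funD.
split => //.
- by move=> x y; rewrite sK sA.
- by move=> x; exact: integD.
apply: (integ_dom _ _ (integD Ka Aa)).
  apply: (@measurable_fun_param_Rintegral _ _ _ _ _ P
    (fun p => `|K p.1 p.2 + A p.1 p.2|)); exact: measurableT_comp.
move=> x; rewrite ger0_norm; last by apply: Rintegral_ge0 => y _.
rewrite -RintD; [|exact: integ_norm|exact: integ_norm].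
apply: Rint_le.
- by apply: integ_norm; exact: integD.
- by apply: integD; exact: integ_norm.
- by move=> y; exact: ler_normD.
Qed.

Lemma potentialD K A : kernel K -> kernel A ->
  potential (fun x y => K x y + A x y) = fun x => potential K x + potential A x.
Proof. by move=> [_ _ Ki _] [_ _ Ai _]; apply/funext => x; exact: RintD. Qed.

Lemma selfenergyD K A : kernel K -> kernel A ->
  selfenergy (fun x y => K x y + A x y) = selfenergy K + selfenergy A.
Proof.
move=> hK hA; rewrite /selfenergy potentialD// RintD//; exact: integ_potential.
Qed.

Lemma energyD K A N s : kernel K -> kernel A ->
  energy (fun x y => K x y + A x y) N s = energy K N s + energy A N s.
Proof.
move=> hK hA; rewrite /energy potentialD// selfenergyD//.
have -> : \sum_(x <- s) \sum_(y <- s) (K x y + A x y) =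
    \sum_(x <- s) \sum_(y <- s) K x y + \sum_(x <- s) \sum_(y <- s) A x y.
  by rewrite -big_split/=; apply: eq_bigr => x _; rewrite big_split.
by rewrite /addsum big_split/=; ring.
Qed.

Lemma double_sumE K s : (forall x y, K x y = K y x) ->
  \sum_(x <- s) \sum_(y <- s) K x y = \sum_(x <- s) K x x + 2 * pairsum K s.
Proof.
move=> sK; elim: s => [|z s IH]; first by rewrite !big_nil /= mulr0 addr0.
rewrite !big_cons/=.
under [X in _ + _ + X = _]eq_bigr do rewrite big_cons.
rewrite big_split/= IH /ksum.
by under [\sum_(j <- s) K z j]eq_bigr do rewrite sK; ring.
Qed.

(** Centring the interaction in each variable changes the sum over pairs by
   one-body terms only. *)
Lemma pairsum_affine K (u : T -> R) (m : R) s :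
  pairsum (fun x y => K x y - u x - u y + m) s = pairsum K s
  - ((size s)%:R - 1) * addsum u s + (size s)%:R * ((size s)%:R - 1) / 2 * m.
Proof.
elim: s => [|z s IH]; first by rewrite /addsum big_nil /=; ring.
rewrite /= IH /ksum.
have -> : \sum_(x <- s) (K x z - u x - u z + m) =
    \sum_(x <- s) K x z - addsum u s - (size s)%:R * u z + (size s)%:R * m.
  rewrite /addsum; elim: s {IH} => [|y s IH]; first by rewrite !big_nil/=; ring.
  by rewrite !big_cons IH/= -!natr1; ring.
by rewrite /addsum big_cons -!natr1; field.
Qed.

Lemma pairsumZ K c s : pairsum (fun x y => c * K x y) s = c * pairsum K s.
Proof.
elim: s => [|z s IH] /=; first by rewrite mulr0.
by rewrite IH mulrDr /ksum mulr_sumr.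
Qed.

Lemma pairsum_expectation K n : kernel K ->
  integ (mpow P n) (pairsum K) /\
  \int[mpow P n]_t pairsum K t = n%:R * (n%:R - 1) / 2 * selfenergy K.
Proof.
move=> hK; have [mK sK Ki Ka] := hK.
have mp k : measurable_fun setT (fun t : k.-tuple T => pairsum K t).
  exact: measurable_pairsum.
have ip := integ_potential hK.
elim: n => [|n [IHi IH]].
  have [i ->] := integral0_mpow0 P (fun t => pairsum K t).
  by split => //=; ring.
have ki t : integ P (ksum K t) by apply: integ_sum => x; exact: Ki.
have E t z : pairsum K (tuple_cons (t : n.-tuple T, z)) = pairsum K t + ksum K t z by [].
have Fi t : integ P (fun z => pairsum K (tuple_cons (t : n.-tuple T, z))).
  by under [X in EFin \o X]eq_fun do rewrite E; apply: integD => //; exact: integ_cst.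
have [ia Ea] := addsum_expectation n Ka.
have [|i ->] := mpowS_expectation (mp n.+1) Fi.
  apply: (integ_dom _ _ (integD (integ_norm IHi) ia)).
    apply: (@measurable_fun_param_Rintegral _ _ _ _ _ P
      (fun p => `|pairsum K (tuple_cons p)|)).
    apply: measurableT_comp => //.
    by apply: (measurableT_comp (mp _)); exact: measurable_tuple_cons.
  move=> t; rewrite ger0_norm; last by apply: Rintegral_ge0 => x _.
  rewrite -[X in X + _](Rint_cst P) /addsum.
  rewrite -(Rint_sum _ (fun x => integ_norm (Ki x))).
  rewrite -RintD; [|exact: integ_cst|by apply: integ_sum => x; exact: integ_norm].
  apply: Rint_le; first exact: integ_norm.
    apply: integD; first exact: integ_cst.
    by apply: integ_sum => x; exact: integ_norm.
  by move=> z; rewrite E (le_trans (ler_normD _ _))// lerD2l ler_norm_sum.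
split => //; under eq_Rintegral => t _.
  under eq_Rintegral do rewrite E.
  rewrite RintD// ?Rint_cst; last exact: integ_cst.
  rewrite /ksum Rint_sum//.
  rewrite -[X in _ + X]/(addsum (potential K) t).
  over.
have [ip' Ep] := addsum_expectation n ip.
by rewrite RintD// IH Ep -/(selfenergy K) -natr1; field.
Qed.

(** Only the diagonal terms, absent from the double sum, leave a trace. *)
Lemma energy_expectation K N : (0 < N)%N -> kernel K -> (forall x, K x x = 0) ->
  integ (mpow P N) (energy K N) /\
  \int[mpow P N]_t energy K N t = - selfenergy K / 2.
Proof.
move=> N0 hK K0; have [mK sK Ki Ka] := hK.
have [i1 E1] := pairsum_expectation N hK.
have [i2 E2] := addsum_expectation N (integ_potential hK).
have E : (fun t : N.-tuple T => energy K N t) = fun t : N.-tuple T =>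
   N%:R^-1 * pairsum K t - addsum (potential K) t + N%:R / 2 * selfenergy K.
  apply/funext => t; rewrite /energy double_sumE// (eq_bigr (fun=> 0))//.
  by rewrite big1_eq add0r; field; rewrite pnatr_eq0 -lt0n.
have i3 : integ (mpow P N) (fun t => N%:R^-1 * pairsum K t - addsum (potential K) t).
  by apply: integB; first exact: integZ.
split.
  have := integD i3 (integ_cst _ (N%:R / 2 * selfenergy K)).
  by apply: eq_integrable => // t _; rewrite /= -(congr1 (@^~ t) E).
rewrite E RintD ?Rint_cst//; last exact: integ_cst.
rewrite RintB//; last exact: integZ.
rewrite RintZ// E1 E2 -/(selfenergy K); field.
by rewrite pnatr_eq0 -lt0n.
Qed.

Lemma measurable_energy K n N :
  measurable_fun setT (fun p : T * T => K p.1 p.2) ->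
  measurable_fun setT (fun t : n.-tuple T => energy K N t).
Proof.
move=> mK; apply: measurable_funD => //; apply: measurable_funB.
  apply: measurable_funM => //.
  under eq_fun do rewrite big_tuple; apply: measurable_sum => i.
  under eq_fun do rewrite big_tuple; apply: measurable_sum => j.
  apply: (measurableT_comp mK (g := fun t : n.-tuple T => (tnth t i, tnth t j))).
  by apply: measurable_fun_pair => //=; exact: measurable_tnth.
by apply: measurable_addsum; exact: measurable_potential.
Qed.

End energy.

(** * Entropy bounds from a splitting of the interaction *)

Section gibbs.
Context d (T : measurableType d) (R : realType) (P : probability T R).
Variables K A : T -> T -> R.
Variables (A0 eps : R).
Hypothesis hK : kernel P K.
Hypothesis K0 : forall x, K x x = 0.
Hypothesis mA : measurable_fun setT (fun p : T * T => A p.1 p.2).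
Hypothesis sA : forall x y, A x y = A y x.
Hypothesis AE : forall x, A x x = A0.
Hypothesis A_pos : forall N s, (0 < N)%N -> size s = N -> 0 <= energy P A N s.
Hypothesis eps0 : 0 < eps.
Let r x y := K x y - A x y.
Hypothesis r_ge : forall x, \forall y \ae P, - eps <= r x y.
Hypothesis r2 : forall x, (\int[P]_y (r x y ^+ 2)%:E <= (eps ^+ 2)%:E)%E.

Let mr : measurable_fun setT (fun p : T * T => r p.1 p.2).
Proof. by apply: measurable_funB => //; case: hK. Qed.

Let sr x y : r x y = r y x.
Proof. by case: hK => _ sK _ _; rewrite /r sK sA. Qed.

Let mr1 x : measurable_fun setT (r x).
Proof. exact: (measurableT_comp mr (pair1_measurable x)). Qed.

Let L2r x : L2 P (r x).
Proof.
split; first exact: mr1.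
apply: (@ge0_integ _ _ _ _ _ (eps ^+ 2)) => //.
  by apply: measurable_funX; exact: mr1.
by move=> y; exact: sqr_ge0.
Qed.

Let r2' x : \int[P]_y (r x y ^+ 2) <= eps ^+ 2.
Proof. by rewrite -lee_fin Rint_EFin//; case: (L2r x). Qed.

Let potr x : `|potential P r x| <= eps.
Proof.
have := CauchySchwarz (L2r x) (L2_cst P 1).
under eq_Rintegral do rewrite mulr1.
under [X in _ <= _ * X -> _]eq_Rintegral do rewrite expr1n.
rewrite Rint_cst mulr1 => /le_trans /(_ (r2' x)).
rewrite -(real_normK (num_real (\int[P]_y r x y))).
by rewrite ler_pXn2r// nnegrE// ltW.
Qed.

Let kr : kernel P r.
Proof.
split => //; first by move=> x; exact: L2_integ.
apply: (@integ_bdd _ _ _ _ _ (1 + eps ^+ 2)).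
  apply: (@measurable_fun_param_Rintegral _ _ _ _ _ P (fun p => `|r p.1 p.2|)).
  exact: measurableT_comp.
move=> x; rewrite ger0_norm; last by apply: Rintegral_ge0.
apply: le_trans (_ : 1 + \int[P]_y (r x y ^+ 2) <= _); last by rewrite lerD2l.
rewrite -(Rint_cst P 1) -RintD; [|exact: integ_cst|exact: (L2r x).2].
apply: Rint_le.
- by apply: integ_norm; exact: L2_integ.
- by apply: integD; [exact: integ_cst|exact: (L2r x).2].
- move=> y; rewrite -(real_normK (num_real (r x y))).
  by have := sqr_ge0 (`|r x y| - 1); nra.
Qed.

Let kA : kernel P A.
Proof.
have [mK sK Ki Ka] := hK; have [_ _ ri ra] := kr.
have Ai x : integ P (A x).
  have := integB (Ki x) (ri x); apply: eq_integrable => // y _ /=.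
  by rewrite /r opprB addrC subrK.
split => //.
apply: (integ_dom _ _ (integD Ka ra)).
  apply: (@measurable_fun_param_Rintegral _ _ _ _ _ P (fun p => `|A p.1 p.2|)).
  exact: measurableT_comp.
move=> x; rewrite ger0_norm; last by apply: Rintegral_ge0.
rewrite -RintD; [|exact: integ_norm|by apply: integ_norm; exact: ri].
apply: Rint_le; first exact: integ_norm.
  by apply: integD; apply: integ_norm => //; exact: ri.
move=> y; have -> : A x y = K x y - r x y by rewrite /r opprB addrC subrK.
exact: ler_normB.
Qed.

Let m := selfenergy P r.

Let m_le : `|m| <= eps.
Proof.
rewrite (le_trans (le_Rint_norm (integ_potential kr)))//.
rewrite -[leRHS](Rint_cst P); apply: Rint_le => //.
- exact/integ_norm/integ_potential.
- exact: integ_cst.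
Qed.

Variable beta : R.
Hypothesis beta0 : 0 < beta.
Hypothesis beta_eps : 64 * (beta * eps) <= 1.

(** The centred (degenerate) part of [r], with the sign of the exponent. *)
Let h x y := r x y - potential P r x - potential P r y + m.
Let k x y := - beta * h x y.

Let mk : measurable_fun setT (fun p : T * T => k p.1 p.2).
Proof.
have mp := measurable_potential P mr.
apply: measurable_funM => //; apply: measurable_funD => //.
apply: measurable_funB; last exact: (measurableT_comp mp measurable_snd).
by apply: measurable_funB => //; exact: (measurableT_comp mp measurable_fst).
Qed.

Let ih x : integ P (h x).
Proof.
apply: integD; last exact: integ_cst.
apply: integB; last exact: integ_potential.
by apply: integB; [exact: L2_integ|exact: integ_cst].
Qed.

Let k0 x : \int[P]_y k x y = 0.
Proof.
rewrite RintZ//; have ri := L2_integ (L2r x); have ip := integ_potential kr.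
have -> : \int[P]_y h x y = 0.
  have i1 : integ P (fun y => r x y - potential P r x).
    by apply: integB => //; exact: integ_cst.
  rewrite RintD ?Rint_cst; [|exact: integB|exact: integ_cst].
  rewrite RintB// RintB ?Rint_cst//; last exact: integ_cst.
  by rewrite -/(potential P r x) -/(selfenergy P r) -/m; ring.
by rewrite mulr0.
Qed.

Let k1 x : \forall y \ae P, k x y <= 2^-1.
Proof.
apply: filterS (r_ge x) => y rxy.
have := potr x; have := potr y; have := m_le.
rewrite !ler_norml => /andP[m1 m2] /andP[y1 y2] /andP[x1 x2].
apply: le_trans (_ : beta * (4 * eps) <= _); last by have := beta_eps; lra.
by rewrite /k mulNr -mulrN ler_wpM2l// ?(ltW beta0)// /h; lra.
Qed.

Let k2 x y : k x y ^+ 2 <= beta ^+ 2 * (4 * r x y ^+ 2 + 12 * eps ^+ 2).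
Proof.
rewrite /k exprMn sqrrN ler_wpM2l ?sqr_ge0//.
have sq (u : R) : `|u| <= eps -> u ^+ 2 <= eps ^+ 2.
  by move=> ue; rewrite -(real_normK (num_real u)) ler_pXn2r// nnegrE// ltW.
have := sq _ (potr x); have := sq _ (potr y); have := sq _ m_le.
rewrite /h; set a := potential P r x; set b := potential P r y; set c := r x y.
have := sqr_ge0 (c + a); have := sqr_ge0 (c + b); have := sqr_ge0 (c - m).
have := sqr_ge0 (a - b); have := sqr_ge0 (a + m); have := sqr_ge0 (b + m).
nra.
Qed.

Let ib x : integ P (fun y => beta ^+ 2 * (4 * r x y ^+ 2 + 12 * eps ^+ 2)).
Proof.
apply: integZ; apply: integD; last exact: integ_cst.
by apply: integZ; exact: (L2r x).2.
Qed.

Let ik2 x : integ P (fun y => k x y ^+ 2).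
Proof.
apply: (integ_dom _ _ (ib x)).
  by apply: measurable_funX; exact: (measurableT_comp mk (pair1_measurable x)).
by move=> y; rewrite ger0_norm ?sqr_ge0.
Qed.

Let kq x : \int[P]_y (k x y ^+ 2) <= 256^-1.
Proof.
apply: (le_trans (Rint_le (ik2 x) (ib x) (k2 x))).
have i1 : integ P (fun y => 4 * r x y ^+ 2) by apply: integZ; exact: (L2r x).2.
rewrite RintZ; last by apply: integD => //; exact: integ_cst.
rewrite RintD ?Rint_cst//; last exact: integ_cst.
rewrite RintZ; last exact: (L2r x).2.
apply: le_trans (_ : 16 * (beta * eps) ^+ 2 <= _).
  have -> : 16 * (beta * eps) ^+ 2 = beta ^+ 2 * (4 * eps ^+ 2 + 12 * eps ^+ 2) by ring.
  by rewrite ler_wpM2l ?sqr_ge0// lerD2r ler_wpM2l.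
have be0 : 0 <= beta * eps by rewrite mulr_ge0// ltW.
have : beta * eps <= 64^-1 by have := beta_eps; lra.
move=> be; apply: le_trans (_ : 16 * 64^-1 ^+ 2 <= _); last by lra.
by rewrite ler_wpM2l// ler_pXn2r// nnegrE// invr_ge0.
Qed.

(** Centring [r] absorbs the potential term of its energy, because each variable
   occurs in [N - 1] pairs; what is left over are the diagonal terms and terms of
   order [eps]. *)
Let energy_r N (t : N.-tuple T) : (0 < N)%N ->
  - beta * energy P r N t <=
  pairsum k t / N%:R + (beta * A0 / 2 + 3 / 2 * (beta * eps)).
Proof.
move=> N0; have NR : 0 < N%:R :> R by rewrite ltr0n.
have NR0 : N%:R != 0 :> R by rewrite gt_eqF.
have -> : energy P r N t = pairsum h t / N%:R - addsum (potential P r) t / N%:R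
    + m / 2 - A0 / 2.
  have := pairsum_affine r (potential P r) m t; rewrite size_tuple -/h => ->.
  rewrite /energy double_sumE//.
  have -> : \sum_(x <- t) r x x = - A0 * N%:R.
    rewrite (eq_bigr (fun=> - A0)) => [|x _]; last by rewrite /r K0 AE sub0r.
    by rewrite big_const_seq iter_addr_0 count_predT size_tuple mulr_natr.
  rewrite -/m; field.
  by [].
rewrite /k pairsumZ.
have : addsum (potential P r) t / N%:R <= eps.
  rewrite ler_pdivrMr// /addsum.
  apply: le_trans (_ : \sum_(x <- t) eps <= _).
    by apply: ler_sum => x _; exact: le_trans (ler_norm _) (potr x).
  by rewrite big_const_seq iter_addr_0 count_predT size_tuple mulr_natr.
move=> pe; have := ler_normlW; have := m_le; rewrite ler_norml => /andP[m1 m2] _.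
have : beta * (addsum (potential P r) t / N%:R) <= beta * eps.
  by rewrite ler_wpM2l// ltW.
have : beta * - m <= beta * eps by rewrite ler_wpM2l ?(ltW beta0)// lerNl.
by lra.
Qed.

(** The regular part has nonnegative energy; the singular part is a small
   degenerate pair interaction up to bounded terms. *)
Theorem exp_energy_le N : (0 < N)%N ->
  (\int[mpow P N]_t (expR (- beta * energy P K N t))%:E <=
   (expR (beta * A0 / 2 + 1))%:E)%E.
Proof.
move=> N0.
have q1 : 256 * 256^-1 <= 1 :> R by lra.
have sk x y : k x y = k y x by rewrite /k /h (sr x y); ring.
have := exp_moment_degenerate mk sk k0 k1 ik2 kq q1 N0 => main.
have mps : measurable_fun setT (fun t : N.-tuple T => pairsum k t).
  exact: (measurable_pairsum mk).
set c := beta * A0 / 2 + 3 / 2 * (beta * eps).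
apply: (@le_trans _ _ (\int[mpow P N]_t ((expR c)%:E * (expR (pairsum k t / N%:R))%:E))%E).
  apply: ge0_le_integral => //.
  - apply/measurable_EFinP; apply: measurableT_comp => //.
    apply: measurable_funM => //; apply: measurable_energy; by case: hK.
  - apply: measurable_funeM; apply/measurable_EFinP; apply: measurableT_comp => //.
    exact: measurable_funM.
  move=> t _; rewrite -EFinM lee_fin -expRD ler_expR.
  have -> : energy P K N t = energy P r N t + energy P A N t.
    rewrite -(energyD N t kr kA); congr (energy P _ _ _).
    by apply/funext => x; apply/funext => y; rewrite /r subrK.
  have EA := A_pos N0 (size_tuple t).
  have := energy_r t N0; rewrite -/c.
  have : 0 <= beta * energy P A N t by rewrite mulr_ge0// ltW.
  by lra.
rewrite ge0_integralZl//; last first.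
  by apply/measurable_EFinP; apply: measurableT_comp => //; exact: measurable_funM.
apply: (@le_trans _ _ ((expR c)%:E * (expR (8 * 256^-1))%:E)%E).
  by rewrite lee_pmul2l// lte_fin expR_gt0.
rewrite -EFinM lee_fin -expRD ler_expR /c; have := beta_eps; lra.
Qed.

End gibbs.

Section jensen.
Context d (T : measurableType d) (R : realType) (P : probability T R).

Lemma expR_Rint (X : T -> R) : integ P X -> integ P (fun x => expR (X x)) ->
  expR (\int[P]_x X x) <= \int[P]_x expR (X x).
Proof.
move=> iX iE; set c := \int[P]_x X x.
have i1 : integ P (fun x => (1 - c) + X x) by apply: integD => //; exact: integ_cst.
have -> : expR c = \int[P]_x (expR c * ((1 - c) + X x)).
  rewrite RintZ// RintD ?Rint_cst//; last exact: integ_cst.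
  by rewrite -/c subrK mulr1.
apply: Rint_le => //; first exact: integZ.
move=> x; have := expR_ge1Dx (X x - c); rewrite expRB ler_pdivlMr ?expR_gt0//.
by rewrite mulrC; apply: le_trans; rewrite le_eqVlt; apply/orP; left; apply/eqP; ring.
Qed.

End jensen.

Section gibbs_entropy.
Context d (T : measurableType d) (R : realType) (P : probability T R).
Variables K A : T -> T -> R.
Variables (A0 eps CG beta : R).
Hypothesis hK : kernel P K.
Hypothesis K0 : forall x, K x x = 0.
Hypothesis mA : measurable_fun setT (fun p : T * T => A p.1 p.2).
Hypothesis sA : forall x y, A x y = A y x.
Hypothesis AE : forall x, A x x = A0.
Hypothesis A_pos : forall N s, (0 < N)%N -> size s = N -> 0 <= energy P A N s.
Hypothesis eps0 : 0 < eps.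
Hypothesis r_ge : forall x, \forall y \ae P, - eps <= K x y - A x y.
Hypothesis r2 : forall x,
  (\int[P]_y ((K x y - A x y) ^+ 2)%:E <= (eps ^+ 2)%:E)%E.
Hypothesis beta0 : 0 < beta.
Hypothesis beta_eps : 64 * (2 * beta * eps) <= 1.
Hypothesis hCG : `|selfenergy P K| <= CG.

Variables (N : nat) (w : N.-tuple T -> R).
Hypothesis N0 : (0 < N)%N.
Hypothesis mw : measurable_fun setT w.
Hypothesis w0 : forall t, 0 <= w t.
Hypothesis wE : forall t, w t = expR (- beta * energy P K N t).
Variable d0 : probability (N.-tuple T) R.

Let Q : probability (N.-tuple T) R := mnormalize (mweight (mpow P N) mw w0) d0.

(** With [Z_b] the mean of the weight at inverse temperature [b], the first entropy
   is at most [Z_(2 beta) / (N Z_beta^2)] and the second is [1 / N] times [ln Z_beta]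
   minus the mean of the exponent, [beta / 2] times the self-energy. The same mean
   bounds [Z_beta] from below by Jensen's inequality, so everything follows from
   the upper bound on the partition functions. *)
Theorem gibbs_entropy (C := expR (beta * `|A0| + 1 + beta * CG)) :
  (rel_entropy Q (mpow P N) <= (C / N%:R)%:E)%E /\
  (rel_entropy (mpow P N) Q <= (C / N%:R)%:E)%E.
Proof.
have NR : 0 < N%:R :> R by rewrite ltr0n.
have be0 : 0 < beta * eps by exact: mulr_gt0.
have be1 : 64 * (beta * eps) <= 1 by move: beta_eps be0; lra.
have U1 := exp_energy_le hK K0 mA sA AE A_pos eps0 r_ge r2 beta0 be1 N0.
have b20 : 0 < 2 * beta by exact: mulr_gt0.
have U2 := exp_energy_le hK K0 mA sA AE A_pos eps0 r_ge r2 b20 beta_eps N0.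
have iw : integ (mpow P N) w.
  apply: (ge0_integ mw w0 (c := expR (beta * A0 / 2 + 1))).
  by under eq_integral do rewrite wE.
have w2E t : w t ^+ 2 = expR (- (2 * beta) * energy P K N t).
  by rewrite wE expr2 -expRD; congr expR; ring.
have U2' : (\int[mpow P N]_t (w t ^+ 2)%:E <= (expR (2 * beta * A0 / 2 + 1))%:E)%E.
  by under eq_integral do rewrite w2E.
have iw2 : integ (mpow P N) (fun t => w t ^+ 2).
  apply: (ge0_integ _ _ U2') => [|t]; first exact: measurable_funX.
  exact: sqr_ge0.
have [iE EE] := energy_expectation N0 hK K0.
have ilw : integ (mpow P N) (fun t => - beta * energy P K N t) by exact: integZ.
have lwE : \int[mpow P N]_t (- beta * energy P K N t) = beta * selfenergy P K / 2.
  by rewrite RintZ// EE; field.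
set Z := \int[mpow P N]_t w t.
have ZE : Z = \int[mpow P N]_t expR (- beta * energy P K N t).
  by apply: eq_Rintegral => t _.
have Zge : expR (beta * selfenergy P K / 2) <= Z.
  rewrite ZE -lwE; apply: expR_Rint => //.
  by apply: eq_integrable iw => // t _ /=; rewrite wE.
have Z0 : 0 < Z by exact: lt_le_trans (expR_gt0 _) Zge.
have Zle : Z <= expR (beta * A0 / 2 + 1).
  rewrite -lee_fin Rint_EFin//; by under eq_integral do rewrite wE.
have wgt t : 0 < w t by rewrite wE expR_gt0.
move: hCG; rewrite ler_norml => /andP[G1 G2].
have bG1 : beta * - CG <= beta * selfenergy P K by rewrite ler_wpM2l// ltW.
have bG2 : beta * selfenergy P K <= beta * CG by rewrite ler_wpM2l// ltW.
have bA : beta * A0 <= beta * `|A0| by rewrite ler_wpM2l ?ler_norm// ltW.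
have bA0 : 0 <= beta * `|A0| by rewrite mulr_ge0// ltW.
split.
  apply: (@entropy_tilt_le _ _ _ _ _ _ mw w0 d0 wgt iw Z0) => //.
  rewrite -lee_fin Rint_EFin//; apply: le_trans U2' _; rewrite lee_fin -/Z.
  apply: le_trans (_ : C * expR (beta * selfenergy P K / 2) ^+ 2 <= _).
    rewrite /C expr2 -!expRD ler_expR; lra.
  rewrite ler_wpM2l ?expR_ge0// lerXn2r// nnegrE ?expR_ge0//; exact: ltW.
have lwi : integ (mpow P N) (fun x => ln (w x)).
  by apply: eq_integrable ilw => // t _ /=; rewrite wE expRK.
rewrite (@entropy_untilt _ _ _ _ _ _ mw w0 d0 wgt iw Z0 lwi) lee_fin ler_wpM2r ?invr_ge0 ?(ltW NR)//.
have -> : \int[mpow P N]_x ln (w x) = beta * selfenergy P K / 2.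
  by rewrite -lwE; apply: eq_Rintegral => t _; rewrite wE expRK.
rewrite -/Z; have : ln Z <= beta * A0 / 2 + 1.
  by rewrite -[leRHS]expRK ler_ln// posrE ?expR_gt0.
have := expR_ge1Dx (beta * `|A0| + 1 + beta * CG); rewrite -/C.
by lra.
Qed.

End gibbs_entropy.

(** * Positions and the modulated energy *)

Section position_density.
Context (R : realType) (D : domain) (d : nat).
Variable f : density (phase_measure R D d).
Let P := density_prob f.
Notation mx := (space_measure R D d).
Notation mv := (velocity_measure R d).

Let mf : measurable_fun setT (density_fun f) := measurable_density f.

Let fi : integ (mx \x mv)%E (density_fun f).
Proof.
apply: (@ge0_integ _ _ _ _ _ 1) => //; first exact: density_ge0.
by have := integral_density f; rewrite /phase_measure => ->.
Qed.

(** For almost every position the velocity integral is finite, and [rho] is it. *)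
Let rhoE : \forall x \ae mx, (\int[mv]_v (f (x, v))%:E = (rho f x)%:E)%E.
Proof.
apply: filterS (ae_integrable1 fi) => x ix.
by rewrite /rho -Rint_EFin.
Qed.

Let mrho : measurable_fun setT (rho f) := measurable_rho mf.

Lemma rho_ge0 x : 0 <= rho f x.
Proof. by apply: Rintegral_ge0 => v _; exact: density_ge0. Qed.

Lemma ge0_integral_position (phi : rvec R d -> \bar R) :
  measurable_fun setT phi -> (forall x, 0 <= phi x)%E ->
  (\int[P]_z phi z.1 = \int[mx]_x (phi x * (rho f x)%:E))%E.
Proof.
move=> mphi phi0.
have mphi1 : measurable_fun setT (fun z : phase R d => phi z.1).
  exact: measurableT_comp.
rewrite ge0_integral_mweight// /phase_measure.
have mF : measurable_fun setT (fun z : phase R d => phi z.1 * (f z)%:E)%E.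
  by apply: emeasurable_funM => //; exact/measurable_EFinP.
rewrite (@fubini_tonelli1 _ _ _ _ _ mx mv _ mF); last first.
  by move=> z; rewrite mule_ge0// lee_fin density_ge0.
apply: ge0_ae_eq_integral => //.
- apply: (@measurable_fun_fubini_tonelli_F _ _ _ _ _ mv _ mF).
  by move=> z; rewrite mule_ge0// lee_fin density_ge0.
- by apply: emeasurable_funM => //; exact/measurable_EFinP.
- by move=> x _; apply: integral_ge0 => v _; rewrite mule_ge0// lee_fin density_ge0.
- by move=> x _; rewrite mule_ge0// lee_fin rho_ge0.
apply: filterS rhoE => x rx _; rewrite /fubini_F /=.
rewrite ge0_integralZl ?rx//.
- by apply/measurable_EFinP; exact: (measurableT_comp mf (pair1_measurable x)).
- by move=> v _; rewrite lee_fin density_ge0.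
Qed.

Lemma Rint_position (phi : rvec R d -> R) : measurable_fun setT phi ->
  integ P (fun z => phi z.1) ->
  \int[mx]_x (phi x * rho f x) = \int[P]_z phi z.1.
Proof.
move=> mphi iphi.
have mE : measurable_fun setT (EFin \o phi) by exact/measurable_EFinP.
rewrite /Rintegral; congr fine; rewrite integralE [RHS]integralE; congr (_ - _)%E.
- have h := ge0_integral_position (measurable_funepos mE) (fun x => funepos_ge0 _ x).
  transitivity (\int[mx]_x ((EFin \o phi)^\+ x * (rho f x)%:E))%E; last first.
    by rewrite -h; apply: eq_integral => z _; rewrite !funeposE.
  apply: eq_integral => x _; rewrite !funeposE -!EFin_max -EFinM.
  by rewrite maxr_pMl ?rho_ge0// mul0r.
- have h := ge0_integral_position (measurable_funeneg mE) (fun x => funeneg_ge0 _ x).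
  transitivity (\int[mx]_x ((EFin \o phi)^\- x * (rho f x)%:E))%E; last first.
    by rewrite -h; apply: eq_integral => z _; rewrite !funenegE.
  apply: eq_integral => x _; rewrite !funenegE -!EFin_max -EFinM.
  by rewrite maxr_pMl ?rho_ge0// mul0r mulNr.
Qed.

Lemma rho_le_Lnorm :
  ('N[mx]_(+oo)[EFin \o rho f] < +oo)%E ->
  \forall x \ae mx, rho f x <= fine ('N[mx]_(+oo)[EFin \o rho f])%E.
Proof.
set L := ('N[mx]_(+oo)[EFin \o rho f])%E => Loo.
have L0 : (0 <= L)%E by exact: Lnorm_ge0.
have LE : (fine L)%:E = L by rewrite fineK// ge0_fin_numE.
have [m0|m0] := ltP 0%E (mx setT).
  have Less : L = ess_sup mx (abse \o (EFin \o rho f)) by rewrite /L unlock m0.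
  have : \forall x \ae mx, ((abse \o (EFin \o rho f)) x <= L)%E.
    by rewrite Less; exact: ess_sup_ge.
  apply: filterS => x; rewrite -LE /= lee_fin; apply: le_trans.
  exact: ler_norm.
exists setT; split => //; apply/eqP; rewrite eq_le m0/=; exact: measure_ge0.
Qed.

Lemma ge0_integral_position_le (L : R) (phi : rvec R d -> \bar R) :
  (\forall x \ae mx, rho f x <= L) -> 0 <= L ->
  measurable_fun setT phi -> (forall x, 0 <= phi x)%E ->
  (\int[P]_z phi z.1 <= L%:E * \int[mx]_x phi x)%E.
Proof.
move=> rL L0 mphi phi0; rewrite ge0_integral_position// -ge0_integralZl//.
apply: ae_ge0_le_integral => //.
- by move=> x _; rewrite mule_ge0// lee_fin rho_ge0.
- by apply: emeasurable_funM => //; exact/measurable_EFinP.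
- by move=> x _; rewrite mule_ge0.
- exact: measurable_funeM.
by apply: filterS rL => x rx _; rewrite muleC lee_wpmul2r// lee_fin.
Qed.

End position_density.

Section energy_translation.
Context (R : realType) (D : domain) (d : nat).
Variable f : density (phase_measure R D d).
Let P : probability (phase R d) R := density_prob f.
Variable g : {mfun rvec R d >-> R}.

Definition paircut (x y : rvec R d) : R := if x == y then 0 else g (vsub x y).

(** The interaction entering the modulated energy, symmetrised because on the
   torus the even symmetry of [g] is only known almost everywhere. *)
Definition pairker (z w : phase R d) : R :=
  2^-1 * (paircut z.1 w.1 + paircut w.1 z.1).

Lemma measurable_paircut :
  measurable_fun setT (fun p : rvec R d * rvec R d => paircut p.1 p.2).
Proof.
apply: measurable_fun_ifT => //; first exact: measurable_rvec_eq.
apply: measurableT_comp => //; exact: measurable_vsub.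
Qed.

Let mk12 : measurable_fun setT (fun p : phase R d * phase R d => paircut p.1.1 p.2.1).
Proof.
apply: (measurableT_comp measurable_paircut
  (g := fun p : phase R d * phase R d => (p.1.1, p.2.1))).
by apply: measurable_fun_pair; apply: measurableT_comp.
Qed.

Let mk21 : measurable_fun setT (fun p : phase R d * phase R d => paircut p.2.1 p.1.1).
Proof.
apply: (measurableT_comp measurable_paircut
  (g := fun p : phase R d * phase R d => (p.2.1, p.1.1))).
by apply: measurable_fun_pair; apply: measurableT_comp.
Qed.

Hypothesis kl : forall x, integ P (fun z => paircut x z.1).
Hypothesis kr : forall x, integ P (fun z => paircut z.1 x).
Hypothesis kla : integ P (fun z => \int[P]_w `|paircut z.1 w.1|).
Hypothesis kra : integ P (fun z => \int[P]_w `|paircut w.1 z.1|).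

Lemma kernel_pairker : kernel P pairker.
Proof.
have mk : measurable_fun setT (fun p : phase R d * phase R d => pairker p.1 p.2).
  by apply: measurable_funM => //; exact: measurable_funD.
split => //.
- by move=> x y; rewrite /pairker addrC.
- by move=> x; apply: integZ; exact: integD.
- apply: (integ_dom _ _ (integZ 2^-1 (integD kla kra))).
    apply: (@measurable_fun_param_Rintegral _ _ _ _ _ P (fun p => `|pairker p.1 p.2|)).
    exact: measurableT_comp.
  move=> z; rewrite ger0_norm; last by apply: Rintegral_ge0.
  rewrite -RintD; [|exact: integ_norm|exact: integ_norm].
  rewrite -RintZ; last by apply: integD; exact: integ_norm.
  apply: Rint_le.
  + by apply: integ_norm; apply: integZ; exact: integD.
  + by apply: integZ; apply: integD; exact: integ_norm.
  + by move=> w; rewrite normrM ger0_norm// ler_wpM2l// ler_normD.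
Qed.

Let ul (x : rvec R d) := \int[P]_z paircut x z.1.
Let ur (x : rvec R d) := \int[P]_z paircut z.1 x.

Let mpc1 x : measurable_fun setT (paircut x).
Proof. exact: (measurableT_comp measurable_paircut (pair1_measurable x)). Qed.

Let mpc2 x : measurable_fun setT (paircut ^~ x).
Proof. exact: (measurableT_comp measurable_paircut (pair2_measurable x)). Qed.

Let mul : measurable_fun setT ul.
Proof.
apply: (@measurable_fun_param_Rintegral _ _ _ _ _ P
  (fun p : rvec R d * phase R d => paircut p.1 p.2.1)).
apply: (measurableT_comp measurable_paircut
  (g := fun p : rvec R d * phase R d => (p.1, p.2.1))).
by apply: measurable_fun_pair => //; apply: measurableT_comp.
Qed.

Let iul : integ P (fun z => ul z.1).
Proof.
apply: (integ_dom _ _ kla); first exact: measurableT_comp.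
by move=> z; exact: le_Rint_norm.
Qed.

Let iur : integ P (fun z => ur z.1).
Proof.
apply: (integ_dom _ _ kra).
  exact: (@measurable_fun_param_Rintegral _ _ _ _ _ P (fun p => paircut p.2.1 p.1.1)).
by move=> z; exact: le_Rint_norm.
Qed.

Let swap : \int[P]_z ul z.1 = \int[P]_z ur z.1.
Proof.
have iF : integ (P \x P)%E (fun p => paircut p.1.1 p.2.1).
  apply/integrable12ltyP; first exact/measurable_EFinP.
  move/integrableP : kla => [_]; apply: le_lt_trans; rewrite le_eqVlt.
  apply/orP; left; apply/eqP; apply: eq_integral => z _ /=.
  have := Rint_EFin (integ_norm (kl z.1)) => /= <-.
  by rewrite ger0_norm//; apply: Rintegral_ge0.
have := Fubini iF => /= F.
have E : (\int[P]_z (ul z.1)%:E = \int[P]_z (ur z.1)%:E)%E.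
  transitivity (\int[P]_x \int[P]_y (paircut x.1 y.1)%:E)%E.
    by apply: eq_integral => z _; rewrite /ul Rint_EFin.
  by rewrite F; apply: eq_integral => z _; rewrite /ur Rint_EFin.
by rewrite /Rintegral E.
Qed.

(** The two fluctuations are expanded by bilinearity. The mixed terms integrate the
   interaction once in each argument, which is why the symmetrised one appears. *)
Lemma modulated_energyE N (Z : N.-tuple (phase R d)) : (0 < N)%N ->
  N%:R * modulated_energy D g (rho f) (positions Z) = energy P pairker N Z.
Proof.
move=> N0; have NR : N%:R != 0 :> R by rewrite pnatr_eq0 -lt0n.
have fluctE (phi : rvec R d -> R) : measurable_fun setT phi ->
    integ P (fun z => phi z.1) ->
    fluct D (positions Z) (rho f) phi =
      N%:R^-1 * addsum (fun z => phi z.1) Z - \int[P]_z phi z.1.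
  move=> mphi iphi; rewrite /fluct (Rint_position mphi iphi); congr (_ * _ - _).
  by rewrite /addsum big_tuple; apply: eq_bigr => i _; rewrite tnth_mktuple.
rewrite /modulated_energy.
set inner := fun x => fluct _ _ _ _.
have innerE x : inner x = N%:R^-1 * addsum (fun z => paircut x z.1) Z - ul x.
  exact: (fluctE _ (mpc1 x) (kl x)).
move: inner innerE => inner innerE.
have minner : measurable_fun setT inner.
  rewrite (_ : inner = fun x => N%:R^-1 * addsum (fun z => paircut x z.1) Z - ul x).
    apply: measurable_funB; last exact: mul.
    apply: measurable_funM; first exact: measurable_cst.
    by rewrite /addsum; apply: measurable_sum => z; exact: mpc2.
  exact/funext.
have iS : integ P (fun z => addsum (fun w => paircut z.1 w.1) Z).
  by apply: integ_sum => w; exact: kr.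
have iin : integ P (fun z => inner z.1).
  have := integB (integZ N%:R^-1 iS) iul.
  by apply: eq_integrable; [exact: measurableT|move=> z _; rewrite /= innerE].
rewrite (fluctE _ minner iin).
have -> : \int[P]_z inner z.1 = N%:R^-1 * addsum (fun w => ur w.1) Z - \int[P]_z ul z.1.
  under eq_Rintegral do rewrite innerE.
  rewrite (RintB (integZ _ iS) iul) (RintZ _ iS); congr (_ * _ - _).
  by rewrite /addsum Rint_sum// => w; exact: kr.
have -> : addsum (fun z => inner z.1) Z =
   N%:R^-1 * (\sum_(z <- Z) \sum_(w <- Z) paircut z.1 w.1) - addsum (fun z => ul z.1) Z.
  rewrite /addsum mulr_sumr -sumrB; apply: eq_bigr => z _.
  by rewrite innerE.
rewrite /energy.
have -> : \sum_(z <- Z) \sum_(w <- Z) pairker z w = \sum_(z <- Z) \sum_(w <- Z) paircut z.1 w.1.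
  rewrite /pairker; under eq_bigr do rewrite -mulr_sumr big_split/=.
  rewrite -mulr_sumr big_split/= [X in _ * (_ + X)]exchange_big/=.
  by field.
have potE z : potential P pairker z = 2^-1 * (ul z.1 + ur z.1).
  rewrite /potential /pairker RintZ; last exact: integD.
  by rewrite RintD.
have -> : addsum (potential P pairker) Z =
    2^-1 * (addsum (fun z => ul z.1) Z + addsum (fun z => ur z.1) Z).
  rewrite /addsum; under eq_bigr do rewrite potE.
  by rewrite -mulr_sumr big_split.
have -> : selfenergy P pairker = \int[P]_z ul z.1.
  rewrite /selfenergy; under eq_Rintegral do rewrite potE.
  rewrite RintZ; last exact: integD.
  rewrite (RintD iul iur) -swap; move: (\int[P]_z ul z.1) => I.
  by field.
by field.
Qed.

End energy_translation.

(** * Elementary limits and the logarithmic series *)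

Section limits.
Context {R : realType}.
Implicit Types (u e : nat -> R).

Lemma cvg_err u e l : (forall n, `|u n - l| <= e n) ->
  e n @[n --> \oo] --> 0 -> u n @[n --> \oo] --> l.
Proof.
move=> ue e0; apply: cvg_zero; apply/norm_cvg0P.
apply: (@squeeze_cvgr _ _ _ _ (cst 0) e) => //; last exact: cvg_cst.
by apply: nearW => n; rewrite normr_ge0/=; exact: ue.
Qed.

Lemma cvg_lel u l c : (forall n, c <= u n) -> u n @[n --> \oo] --> l -> c <= l.
Proof.
move=> cu ul; rewrite -(cvg_lim _ ul)//; apply: limr_ge; first exact: cvgP ul.
exact: nearW.
Qed.

Lemma cvg_lerr u l c : (forall n, u n <= c) -> u n @[n --> \oo] --> l -> l <= c.
Proof.
move=> cu ul; rewrite -(cvg_lim _ ul)//; apply: limr_le; first exact: cvgP ul.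
exact: nearW.
Qed.

Lemma cvg_ge0 u l : (forall n, 0 <= u n) -> u n @[n --> \oo] --> l -> 0 <= l.
Proof. exact: cvg_lel. Qed.

Lemma cvg_seq_sum (I : Type) (s : seq I) (F : I -> nat -> R) (l : I -> R) :
  (forall i, F i n @[n --> \oo] --> l i) ->
  (\sum_(i <- s) F i n) @[n --> \oo] --> \sum_(i <- s) l i.
Proof.
move=> Fl; elim: s => [|i s IH].
  rewrite big_nil; under eq_fun do rewrite big_nil; exact: cvg_cst.
by rewrite big_cons; under eq_fun do rewrite big_cons; exact: cvgD.
Qed.

Lemma cvg_contlim (f : R -> R) u l : {for l, continuous f} ->
  u n @[n --> \oo] --> l -> f (u n) @[n --> \oo] --> f l.
Proof. by move=> cf ul; apply: continuous_cvg. Qed.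

Lemma cvg_invn : (n.+1%:R^-1 : R) @[n --> \oo] --> 0.
Proof. exact: cvg_harmonic. Qed.

End limits.

Section elementary.
Context {R : realType}.
Implicit Types x t : R.

Lemma sin_le_norm x : `|sin x| <= `|x|.
Proof.
have H (z : R) : 0 <= z -> `|sin z| <= z.
  move=> z0.
  have [c _] := @MVT_segment R sin cos 0 z z0 (fun x _ => is_derive_sin x)
    (continuous_subspaceT (@continuous_sin R)).
  rewrite sin0 !subr0 => ->; rewrite normrM (ger0_norm z0).
  by rewrite ler_piMl// cos_max.
have [y0|y0] := leP 0 x; first by rewrite (ger0_norm y0) H.
rewrite -normrN -sinN (ltr0_norm y0); apply: H; lra.
Qed.

Lemma le_cos_quad x : 0 <= 1 - cos x <= x ^+ 2 / 2.
Proof.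
have -> : 1 - cos x = 2 * sin (x / 2) ^+ 2.
  have {1}-> : x = (x / 2) *+ 2 by rewrite -mulr_natr; field.
  by rewrite cos_mulr2n cos2sin2 -mulr_natr; ring.
rewrite mulr_ge0 ?sqr_ge0//=.
have -> : x ^+ 2 / 2 = 2 * `|x / 2| ^+ 2 by rewrite real_normK ?num_real//; field.
rewrite ler_wpM2l// -(real_normK (num_real (sin _))).
by rewrite ler_pXn2r// ?nnegrE// sin_le_norm.
Qed.

Lemma sin_sub_le x : `|x - sin x| <= `|x| ^+ 3.
Proof.
have H (z : R) : 0 <= z -> `|z - sin z| <= z ^+ 3.
  move=> z0.
  have dv (y : R) : is_derive y 1 ((id : R -> R) - sin) (1 - cos y).
    by apply: is_deriveB.
  have [//|c /[!in_itv]/= /andP[c0 cz]] := @MVT_segment R ((id : R -> R) - sin) (fun y => 1 - cos y) 0 z z0 (fun x _ => dv x).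
    apply: continuous_subspaceT => y.
    by apply: differentiable_continuous; apply/derivable1_diffP; apply: ex_derive.
  rewrite /= !fctE sin0 !subr0 => ->; have /andP[q0 q1] := le_cos_quad c.
  rewrite normrM (ger0_norm z0) (ger0_norm q0) exprSr ler_wpM2r//.
  by apply: le_trans q1 _; rewrite ler_pdivrMr//; nra.
have [y0|y0] := leP 0 x; first by rewrite (ger0_norm y0) H.
have -> : x - sin x = - (- x - sin (- x)) by rewrite sinN; ring.
rewrite normrN (ltr0_norm y0).
by apply: H; lra.
Qed.

Lemma cvg_walk_symbol x :
  (2 * n.+1%:R ^+ 2 * (1 - cos (x / n.+1%:R))) @[n --> \oo] --> x ^+ 2.
Proof.
have -> : (fun n => 2 * n.+1%:R ^+ 2 * (1 - cos (x / n.+1%:R))) =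
   (fun n => 4 * (n.+1%:R * sin (x / n.+1%:R / 2)) ^+ 2).
  apply/funext => n.
  have {1}-> : x / n.+1%:R = (x / n.+1%:R / 2) *+ 2 by rewrite -mulr_natr; field.
  by rewrite cos_mulr2n cos2sin2 -mulr_natr; ring.
have -> : x ^+ 2 = 4 * ((x / 2) * (x / 2)) by field.
apply: cvgM; first exact: cvg_cst.
have H : (n.+1%:R * sin (x / n.+1%:R / 2)) @[n --> \oo] --> x / 2.
  apply: (@cvg_err _ _ (fun n => `|x / 2| ^+ 3 * n.+1%:R^-1)).
    move=> n; have := sin_sub_le (x / n.+1%:R / 2).
    set y := x / n.+1%:R / 2 => h.
    have n0 : 0 < n.+1%:R :> R by [].
    have -> : n.+1%:R * sin y - x / 2 = - (n.+1%:R * (y - sin y)).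
      by rewrite /y; field.
    rewrite normrN normrM ger0_norm ?(ltW n0)//.
    apply: le_trans (_ : n.+1%:R * `|y| ^+ 3 <= _); first by rewrite ler_wpM2l.
    have -> : `|y| = `|x / 2| / n.+1%:R.
      by rewrite /y !normrM !normfV (ger0_norm (ltW n0)) mulrAC.
    have n1 : 1 <= n.+1%:R :> R by rewrite ler1n.
    have -> : n.+1%:R * (`|x / 2| / n.+1%:R) ^+ 3 =
      (`|x / 2| ^+ 3 * n.+1%:R^-1) * n.+1%:R^-1 by field.
    by rewrite ler_piMr ?mulr_ge0 ?exprn_ge0// invf_le1.
  rewrite -[X in _ --> X](mulr0 (`|x / 2| ^+ 3)).
  by apply: cvgM; [exact: cvg_cst|exact: cvg_invn].
rewrite (_ : (fun n => _) = (fun n => (n.+1%:R * sin (x / n.+1%:R / 2)) *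
  (n.+1%:R * sin (x / n.+1%:R / 2)))); last by apply/funext => n; rewrite expr2.
exact: cvgM.
Qed.

Lemma walk_symbol_le x n :
  0 <= 2 * n.+1%:R ^+ 2 * (1 - cos (x / n.+1%:R)) <= x ^+ 2.
Proof.
have /andP[h1 h2] := le_cos_quad (x / n.+1%:R).
rewrite !mulr_ge0//= ?sqr_ge0//.
apply: le_trans (_ : 2 * n.+1%:R ^+ 2 * ((x / n.+1%:R) ^+ 2 / 2) <= _).
  by rewrite ler_wpM2l// mulr_ge0// sqr_ge0.
by rewrite le_eqVlt; apply/orP; left; apply/eqP; field.
Qed.

Definition logtaylor n t := \sum_(i < n) t ^+ i.+1 / i.+1%:R.

Lemma is_derive_logtaylor n t :
  is_derive t 1 (logtaylor n) (\sum_(i < n) t ^+ i).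
Proof.
rewrite (_ : logtaylor n = \sum_(i < n) (i.+1%:R^-1 : R) *: ((id : R -> R) ^+ i.+1)); last first.
  apply/funext => u; rewrite fct_sumE /logtaylor; apply: eq_bigr => i _.
  by rewrite !fctE mulrC.
apply: is_derive_sum => i.
have h := @is_deriveZ R R R ((id : R -> R) ^+ i.+1) (i.+1%:R^-1) t 1 _
  (@is_deriveX R R id i.+1 t 1 1 (is_derive_id _ _)).
apply: is_derive_eq h _.
by rewrite /GRing.scale /= mulr1 mulKf// pnatr_eq0.
Qed.

Definition logrem n t := - ln (1 - t) - logtaylor n t.

Lemma is_derive_logrem n t : t < 1 ->
  is_derive t 1 (logrem n) (t ^+ n / (1 - t)).
Proof.
move=> t1.
have t10 : 0 < 1 - t by lra.
have d1 : is_derive t 1 (fun u : R => 1 - u) (- 1).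
  have := @is_deriveB R R R (cst 1) id t 1 0 1 (is_derive_cst _ _ _) (is_derive_id _ _).
  by rewrite sub0r.
have d2 := @is_derive1_comp R (@ln R) (fun u => 1 - u) t _ _ (is_derive1_ln t10) d1.
have := is_deriveB (is_deriveN d2) (is_derive_logtaylor n t).
set f := (X in is_derive _ _ X _); have -> : f = logrem n by [].
move=> h; apply: is_derive_eq h _.
have -> : \sum_(i < n) t ^+ i = (1 - t ^+ n) / (1 - t).
  apply: (@mulIf _ (1 - t)); first by rewrite gt_eqF.
  rewrite divfK ?gt_eqF//; have := subrX1 t n => e.
  by rewrite -(opprB (t ^+ n)) e -mulNr opprB mulrC.
by field; rewrite gt_eqF.
Qed.

(** The derivative of the remainder, [t^n / (1 - t)], is explicit: the mean value
   theorem replaces any estimate of the tail of the series. *)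
Lemma logrem_mvt n t : `|t| < 1 ->
  exists2 c, `|c| <= `|t| /\ (0 <= t -> 0 <= c) & logrem n t = c ^+ n / (1 - c) * t.
Proof.
move=> t1.
have r0 : logrem n 0 = 0.
  by rewrite /logrem subr0 ln1 oppr0 sub0r /logtaylor big1 ?oppr0// => i _; rewrite expr0n mul0r.
have ct (a b : R) : b < 1 -> {within `[a, b], continuous (logrem n)}.
  move=> b1; apply: derivable_within_continuous => x; rewrite in_itv/= => /andP[_ xb].
  by have [] := @is_derive_logrem n x (le_lt_trans xb b1).
have [t0|t0] := leP 0 t.
  rewrite ger0_norm// in t1 *.
  have [x|c] := @MVT_segment R (logrem n) (fun x => x ^+ n / (1 - x)) 0 t t0 _ (ct _ _ t1).
    rewrite in_itv/= => /andP[_ xt]; apply: is_derive_logrem; exact: lt_trans t1.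
  rewrite in_itv/= r0 !subr0 => /andP[c0 ctt] ->; exists c => //.
  by rewrite ger0_norm.
have [x|c] := @MVT_segment R (logrem n) (fun x => x ^+ n / (1 - x)) t 0 (ltW t0) _ (ct _ _ ltr01).
  rewrite in_itv/= => /andP[_ xt]; apply: is_derive_logrem; exact: lt_trans ltr01.
rewrite in_itv/= r0 !sub0r => /andP[tc c0] /eqP; rewrite eqr_oppLR => /eqP ->.
exists c; last by ring.
split=> //.
by rewrite ler0_norm// ltr0_norm// lerN2.
Qed.

Lemma logtaylor_rem n t : `|t| < 1 ->
  `|- ln (1 - t) - logtaylor n t| <= `|t| ^+ n.+1 / (1 - `|t|).
Proof.
move=> t1; have [c [ct _]] := logrem_mvt n t1; rewrite /logrem => ->.
have c1 : 1 - `|t| <= 1 - c by rewrite lerD2l lerN2 (le_trans (ler_norm _)).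
have t0 : 0 < 1 - `|t| by rewrite subr_gt0.
have c0 : 0 < 1 - c by exact: lt_le_trans c1.
rewrite normrM normrM normfV normrX (gtr0_norm c0) exprSr [leRHS]mulrAC.
rewrite ler_wpM2r// ler_pM ?invr_ge0 ?exprn_ge0 ?(ltW c0)// ?lerXn2r ?nnegrE//.
by rewrite lef_pV2.
Qed.

Lemma logtaylor_le n t : 0 <= t -> t < 1 -> logtaylor n t <= - ln (1 - t).
Proof.
move=> t0 t1; have t1' : `|t| < 1 by rewrite ger0_norm.
have [c [ct /(_ t0) c0]] := logrem_mvt n t1'.
rewrite -subr_ge0 -/(logrem n t) => ->.
rewrite !mulr_ge0 ?exprn_ge0// invr_ge0 subr_ge0.
by move: ct; rewrite !ger0_norm// => /le_trans; apply; exact: ltW.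
Qed.

End elementary.

(** * Positive definite functions and their energies *)

Section posdef.
Context {R : realType} {d : nat}.
Implicit Types (x y z : rvec R d) (F G : rvec R d -> R).

Definition dot y x : R := \sum_(i < d) tnth y i * tnth x i.

Definition rvec0 : rvec R d := [tuple (0 : R) | i < d].

(** Positive-definite functions of Bochner type: the closure of the nonnegative
   combinations of cosines under pointwise limits. *)
Inductive posdef : (rvec R d -> R) -> Prop :=
| posdef_cos (w : R) y of 0 <= w : posdef (fun x => w * cos (dot y x))
| posdef_add F G of posdef F & posdef G : posdef (fun x => F x + G x)
| posdef_lim (F_ : nat -> rvec R d -> R) F of (forall n, posdef (F_ n)) &
    (forall x, F_ n x @[n --> \oo] --> F x) : posdef F.

Lemma dotB y z x : dot (vsub y z) x = dot y x - dot z x.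
Proof.
rewrite /dot -sumrB; apply: eq_bigr => i _.
by rewrite tnth_mktuple mulrBl.
Qed.

Lemma dotC x y : dot x y = dot y x.
Proof. by apply: eq_bigr => i _; rewrite mulrC. Qed.

Lemma dotBr y z x : dot x (vsub y z) = dot x y - dot x z.
Proof. by rewrite dotC dotB !(dotC _ x). Qed.

Lemma dot0 x : dot rvec0 x = 0.
Proof. by rewrite /dot big1// => i _; rewrite tnth_mktuple mul0r. Qed.

Lemma dot0r x : dot x rvec0 = 0. Proof. by rewrite dotC dot0. Qed.

Lemma measurable_tnth_rvec i : measurable_fun setT (fun x : rvec R d => (tnth x i : R)).
Proof. exact: measurable_tnth. Qed.

Lemma measurable_dot y : measurable_fun setT (dot y).
Proof.
apply: measurable_sum => i; apply: measurable_funM => //.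
exact: measurable_tnth_rvec.
Qed.

Lemma posdef_measurable F : posdef F -> measurable_fun setT F.
Proof.
elim=> [w y _|F1 G1 _ mF _ mG|F_ F1 _ mF FF].
- apply: measurable_funM => //; apply: measurableT_comp; last exact: measurable_dot.
  exact: (continuous_measurable_fun (@continuous_cos R)).
- exact: measurable_funD.
- by apply: (measurable_fun_cvg mF) => x _; exact: FF.
Qed.

Lemma posdef_bound F : posdef F -> forall x, `|F x| <= F rvec0.
Proof.
elim=> [w y w0|F1 G1 _ mF _ mG|F_ F1 _ mF FF] x.
- rewrite dot0r cos0 mulr1 normrM ger0_norm// ler_piMr//.
  exact: cos_max.
- by rewrite (le_trans (ler_normD _ _))// lerD.
- have h : (F_ n rvec0 - `|F_ n x|) @[n --> \oo] --> F1 rvec0 - `|F1 x|.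
    by apply: cvgB => //; apply: cvg_norm.
  by rewrite -subr_ge0; apply: cvg_ge0 h => n; rewrite subr_ge0.
Qed.

Lemma posdef_even F : posdef F -> forall x y, F (vsub x y) = F (vsub y x).
Proof.
elim=> [w z w0|F1 G1 _ mF _ mG|F_ F1 _ mF FF] x y.
- by rewrite !dotBr -cosN opprB.
- by rewrite mF mG.
- have h : F_ n (vsub x y) @[n --> \oo] --> F1 (vsub y x).
    by rewrite (_ : (fun n => _) = (fun n => F_ n (vsub y x)));
      [exact: FF|apply/funext => n; exact: mF].
  by rewrite -(cvg_lim _ h)// -[LHS](cvg_lim _ (FF (vsub x y))).
Qed.

Lemma posdef_ext F G : posdef F -> F =1 G -> posdef G.
Proof. by move=> + /funext <-. Qed.

Lemma posdef_cst (c : R) : 0 <= c -> posdef (fun=> c).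
Proof.
move=> c0; apply: posdef_ext (posdef_cos rvec0 c0) _ => x.
by rewrite dot0 cos0 mulr1.
Qed.

(** The product of two cosines is half a sum of two cosines. *)
Lemma posdefM F G : posdef F -> posdef G -> posdef (fun x => F x * G x).
Proof.
move=> pF pG; elim: pF => [w y w0|F1 F2 _ h1 _ h2|F_ F1 _ h FF].
- elim: pG => [w' y' w'0|G1 G2 _ h1 _ h2|G_ G1 _ h GG].
  + have w2 : 0 <= w * w' / 2 by rewrite divr_ge0// mulr_ge0.
    apply: posdef_ext (posdef_add (posdef_cos (vsub y y') w2)
      (posdef_cos (vsub y (vsub rvec0 y')) w2)) _ => x.
    by rewrite !dotB dot0 sub0r opprK cosB cosD; field.
  + by apply: posdef_ext (posdef_add h1 h2) _ => x; rewrite mulrDr.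
  + by apply: posdef_lim h _ => x; apply: cvgM => //; exact: cvg_cst.
- by apply: posdef_ext (posdef_add h1 h2) _ => x; rewrite mulrDl.
- by apply: posdef_lim h _ => x; apply: cvgM => //; exact: cvg_cst.
Qed.

Lemma posdefZ c F : 0 <= c -> posdef F -> posdef (fun x => c * F x).
Proof. by move=> c0; exact/posdefM/posdef_cst. Qed.

Lemma posdefX F n : posdef F -> posdef (fun x => F x ^+ n).
Proof.
move=> pF; elim: n => [|n IH].
  by apply: posdef_ext (posdef_cst ler01) _ => x; rewrite expr0.
by apply: posdef_ext (posdefM pF IH) _ => x; rewrite exprS.
Qed.

Lemma posdef_sum (I : Type) (s : seq I) (F : I -> rvec R d -> R) :
  (forall i, posdef (F i)) -> posdef (fun x => \sum_(i <- s) F i x).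
Proof.
move=> pF; elim: s => [|i s IH].
  by apply: posdef_ext (posdef_cst (lexx 0)) _ => x; rewrite big_nil.
by apply: posdef_ext (posdef_add (pF i) IH) _ => x; rewrite big_cons.
Qed.

Lemma posdef_expR F : posdef F -> posdef (fun x => expR (F x)).
Proof.
move=> pF; apply: (@posdef_lim (fun n x => series (exp_coeff (F x)) n)).
  move=> n; apply: posdef_ext (posdef_sum (index_iota 0 n)
    (F := fun i x => i`!%:R^-1 * F x ^+ i) _) _ => [i|x].
    by apply: posdefZ => //; exact: posdefX.
  by rewrite /series /=; apply: eq_bigr => i _; rewrite /exp_coeff /= mulrC.
by move=> x; exact: is_cvg_series_exp_coeff.
Qed.

Lemma posdef_nlog F (t : R) : posdef F -> (forall x, `|F x| <= t) -> t < 1 ->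
  posdef (fun x => - ln (1 - F x)).
Proof.
move=> pF Ft t1; have t0 : 0 <= t by exact: le_trans (normr_ge0 _) (Ft rvec0).
apply: (@posdef_lim (fun n x => logtaylor n (F x))).
  move=> n; apply: posdef_ext (posdef_sum (index_enum 'I_n)
    (F := fun i x => i.+1%:R^-1 * F x ^+ i.+1) _) _ => [i|x].
    by apply: posdefZ => //; exact: posdefX.
  by rewrite /logtaylor; apply: eq_bigr => i _; rewrite mulrC.
move=> x; apply: (@cvg_err _ _ (fun n => t ^+ n.+1 / (1 - t))).
  move=> n; have Fx1 : `|F x| < 1 by exact: le_lt_trans (Ft x) t1.
  rewrite distrC (le_trans (logtaylor_rem n Fx1))//.
  rewrite ler_pM ?exprn_ge0 ?invr_ge0 ?subr_ge0 ?(ltW Fx1)//.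
    by rewrite lerXn2r// nnegrE.
  by rewrite lef_pV2 ?posrE ?subr_gt0// lerD2l lerN2.
rewrite (_ : (fun n => _) = geometric (t / (1 - t)) t); last first.
  by apply/funext => n; rewrite /geometric /= exprS; ring.
by apply: cvg_geometric; rewrite ger0_norm.
Qed.

Definition sqnorm x : R := \sum_(i < d) tnth x i ^+ 2.

(** The symbol of the simple random walk with step 1/(n+1): minus its
   generator, which approximates the Laplacian. *)
Definition walk n x : R :=
  \sum_(i < d) 2 * n.+1%:R ^+ 2 * (1 - cos (tnth x i / n.+1%:R)).

Lemma walk_ge0 n x : 0 <= walk n x.
Proof. by apply: sumr_ge0 => i _; case/andP: (walk_symbol_le (tnth x i) n). Qed.

Lemma walk_le n x : walk n x <= sqnorm x.
Proof. by apply: ler_sum => i _; case/andP: (walk_symbol_le (tnth x i) n). Qed.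

Lemma cvg_walk x : walk n x @[n --> \oo] --> sqnorm x.
Proof. by apply: cvg_seq_sum => i; exact: cvg_walk_symbol. Qed.

Lemma sqnorm_ge0 x : 0 <= sqnorm x.
Proof. by apply: sumr_ge0 => i _; exact: sqr_ge0. Qed.

Variable delta : R.
Hypothesis delta0 : 0 < delta.

Definition walk_max n : R := delta + 2 * n.+1%:R ^+ 2 * d%:R.

Lemma walk_max_gt0 n : 0 < walk_max n.
Proof. by rewrite ltr_pwDl// !mulr_ge0// sqr_ge0. Qed.

(** [delta + walk] is a constant minus a sum of cosines, so minus its logarithm
   expands into powers of that sum with positive coefficients. *)
Lemma posdef_log_walk n : posdef (fun x => ln (walk_max n) - ln (delta + walk n x)).
Proof.
have C0 := walk_max_gt0 n.
pose e (i : 'I_d) : rvec R d := [tuple (if j == i then n.+1%:R^-1 else 0 : R) | j < d].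
have dote i x : dot (e i) x = tnth x i / n.+1%:R.
  rewrite /dot (bigD1 i)//= big1 => [|j ji].
    by rewrite tnth_mktuple eqxx addr0 mulrC.
  by rewrite tnth_mktuple (negbTE ji) mul0r.
pose c := 2 * n.+1%:R ^+ 2 / walk_max n.
have c0 : 0 <= c by rewrite divr_ge0 ?mulr_ge0 ?sqr_ge0// ltW.
pose G x := \sum_(i < d) c * cos (dot (e i) x).
have pG : posdef G by apply: posdef_sum => i; exact: posdef_cos.
have GC x : 1 - G x = (delta + walk n x) / walk_max n.
  rewrite /G /walk -mulr_sumr -mulr_sumr sumrB.
  under eq_bigr do rewrite dote.
  rewrite sumr_const card_ord.
  apply: (@mulIf _ (walk_max n)); first by rewrite gt_eqF.
  rewrite divfK ?gt_eqF// mulrBl mul1r {1}/walk_max /c -[_ *+ d]mulr_natr mul1r.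
  by field; rewrite gt_eqF.
have dw x : 0 < delta + walk n x by rewrite ltr_pwDl// walk_ge0.
have Gb x : `|G x| <= G rvec0 by exact: posdef_bound.
have G1 : G rvec0 < 1.
  by rewrite -subr_gt0 GC divr_gt0.
apply: posdef_ext (posdef_nlog pG Gb G1) _ => x.
by rewrite GC ln_div ?posrE// opprB.
Qed.

(** A negative power is the exponential of a multiple of minus the logarithm,
   applied to the symbol of the walk and then to its limit. *)
Lemma posdef_pow (a : R) : 0 <= a -> posdef (fun x => (delta + sqnorm x) `^ (- a)).
Proof.
move=> a0.
have d0 x : 0 < delta + sqnorm x by rewrite ltr_pwDl// sqnorm_ge0.
have dw n x : 0 < delta + walk n x by rewrite ltr_pwDl// walk_ge0.
apply: (@posdef_lim (fun n x => (delta + walk n x) `^ (- a))).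
  move=> n; apply: posdef_ext (posdefM (posdef_cst (powR_ge0 (walk_max n) (- a)))
    (posdef_expR (posdefZ a0 (posdef_log_walk n)))) _ => x.
  rewrite /powR !gt_eqF ?walk_max_gt0// -expRD; congr expR; ring.
move=> x; rewrite {2}/powR gt_eqF//.
rewrite (_ : (fun n => _) = fun n => expR (- a * ln (delta + walk n x))); last first.
  by apply/funext => n; rewrite /powR gt_eqF.
apply: cvg_contlim; first exact: continuous_expR.
apply: cvgM; first exact: cvg_cst.
apply: cvg_contlim; first exact: continuous_ln.
by apply: cvgD; [exact: cvg_cst|exact: cvg_walk].
Qed.

End posdef.

Section posdef_energy.
Context d0 (T : measurableType d0) (R : realType) (P : probability T R) (d : nat).
Variable X : T -> rvec R d.
Hypothesis mX : measurable_fun setT X.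

Lemma Rint_dominated (f_ : nat -> T -> R) (f g : T -> R) :
  (forall n, measurable_fun setT (f_ n)) ->
  (forall x, f_ n x @[n --> \oo] --> f x) ->
  (forall n x, `|f_ n x| <= g x) -> integ P g ->
  integ P f /\ \int[P]_x f_ n x @[n --> \oo] --> \int[P]_x f x.
Proof.
move=> mf_ ff fg ig.
have mf : measurable_fun setT f by apply: (measurable_fun_cvg mf_) => x _; exact: ff.
have [] := @dominated_convergence _ _ _ P setT measurableT (fun n => EFin \o f_ n)
  (EFin \o f) (EFin \o g).
- by move=> n; exact/measurable_EFinP.
- exact/measurable_EFinP.
- by apply: aeW => x _; apply: cvg_EFin; [exact: nearW|exact: ff].
- exact: ig.
- by apply: aeW => x n _ /=; rewrite lee_fin.
move=> fi _ h; split => //.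
apply: fine_cvg; rewrite (Rint_EFin fi); exact: h.
Qed.

Lemma kernel_bdd (K : T -> T -> R) (M : R) :
  measurable_fun setT (fun p : T * T => K p.1 p.2) ->
  (forall x y, K x y = K y x) -> (forall x y, `|K x y| <= M) -> kernel P K.
Proof.
move=> mK sK KM; split => //.
  move=> x; apply: (@integ_bdd _ _ _ _ _ M) => //.
  exact: (measurableT_comp mK (pair1_measurable x)).
apply: (@integ_bdd _ _ _ _ _ M).
  apply: (@measurable_fun_param_Rintegral _ _ _ _ _ P (fun p => `|K p.1 p.2|)).
  exact: measurableT_comp.
move=> x; rewrite ger0_norm; last exact: Rintegral_ge0.
rewrite -(Rint_cst P M); apply: Rint_le => //; last exact: integ_cst.
apply: (@integ_bdd _ _ _ _ _ M).
  by apply: measurableT_comp => //; exact: (measurableT_comp mK (pair1_measurable x)).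
by move=> y; rewrite normr_id.
Qed.

(** Dominated convergence passes to the limit in each term of the energy. *)
Lemma energy_lim (K_ : nat -> T -> T -> R) (K D : T -> T -> R) N s :
  (forall n, kernel P (K_ n)) -> kernel P D ->
  (forall n x y, `|K_ n x y| <= D x y) ->
  (forall x y, K_ n x y @[n --> \oo] --> K x y) ->
  energy P (K_ n) N s @[n --> \oo] --> energy P K N s.
Proof.
move=> kK [mD sD Di Da] KD KK.
have pot x : potential P (K_ n) x @[n --> \oo] --> potential P K x.
  apply: (Rint_dominated (g := D x) _ _ _ (Di x)).2 => //.
  by move=> n; have [_ _ /(_ x) /integ_measurable] := kK n.
have self : selfenergy P (K_ n) @[n --> \oo] --> selfenergy P K.
  apply: (Rint_dominated (g := fun x => \int[P]_y `|D x y|) _ _ _ Da).2 => //.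
    by move=> n; have [mk _ _ _] := kK n; exact: measurable_potential.
  move=> n x; have [_ _ /(_ x) ki _] := kK n.
  rewrite (le_trans (le_Rint_norm ki))//; apply: Rint_le; [exact: integ_norm..|].
  by move=> y; rewrite (le_trans (KD n x y))// ler_norm.
rewrite /energy; apply: cvgD; last first.
  by apply: cvgM => //; exact: cvg_cst.
apply: cvgB.
  apply: cvgM; first exact: cvg_cst.
  by apply: cvg_seq_sum => x; apply: cvg_seq_sum => y.
exact: cvg_seq_sum.
Qed.

Let diffker (F : rvec R d -> R) x y := F (vsub (X x) (X y)).

Lemma measurable_diffker F : measurable_fun setT F ->
  measurable_fun setT (fun p : T * T => diffker F p.1 p.2).
Proof.
move=> mF; apply: measurableT_comp => //.
apply: (measurableT_comp (@measurable_vsub R d) (g := fun p : T * T => (X p.1, X p.2))).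
by apply: measurable_fun_pair; apply: measurableT_comp.
Qed.

Lemma kernel_posdef F : posdef F -> kernel P (diffker F).
Proof.
move=> pF; apply: (@kernel_bdd _ (F rvec0)).
- by apply: measurable_diffker; exact: posdef_measurable.
- by move=> x y; exact: posdef_even.
- by move=> x y; exact: posdef_bound.
Qed.

(** For a cosine the energy is [N / 2] times the squared modulus of a Fourier
   coefficient of the fluctuation; sums and limits preserve the sign. *)
Lemma energy_posdef_ge0 F : posdef F -> forall N s, (0 < N)%N -> size s = N ->
  0 <= energy P (diffker F) N s.
Proof.
move=> pF N s N0 sN; have NR : 0 < N%:R :> R by rewrite ltr0n.
elim: pF => [w y w0|F1 F2 p1 h1 p2 h2|F_ F1 p h FF].
- pose c x := cos (dot y (X x)); pose s' x := sin (dot y (X x)).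
  have mdX : measurable_fun setT (fun x => dot y (X x)).
    exact: (measurableT_comp (measurable_dot y) mX).
  have ic : integ P c.
    apply: (@integ_bdd _ _ _ _ _ 1) => [|x]; last exact: cos_max.
    exact: (measurableT_comp (continuous_measurable_fun (@continuous_cos R))).
  have is' : integ P s'.
    apply: (@integ_bdd _ _ _ _ _ 1) => [|x]; last exact: sin_max.
    exact: (measurableT_comp (continuous_measurable_fun (@continuous_sin R))).
  have KE x z : diffker (fun x => w * cos (dot y x)) x z = w * (c x * c z + s' x * s' z).
    by rewrite /diffker dotBr cosB.
  set C := \int[P]_x c x; set S := \int[P]_x s' x.
  have potE x : potential P (diffker (fun x => w * cos (dot y x))) x =
      w * (c x * C + s' x * S).
    rewrite /potential; under eq_Rintegral do rewrite KE.
    rewrite RintZ; last by apply: integD; exact: integZ.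
    by rewrite RintD ?RintZ//; exact: integZ.
  have icC : integ P (fun x => c x * C).
    by apply: eq_integrable (integZ C ic) => // x _ /=; rewrite mulrC.
  have isS : integ P (fun x => s' x * S).
    by apply: eq_integrable (integZ S is') => // x _ /=; rewrite mulrC.
  have selfE : selfenergy P (diffker (fun x => w * cos (dot y x))) = w * (C ^+ 2 + S ^+ 2).
    rewrite /selfenergy; under eq_Rintegral do rewrite potE.
    rewrite RintZ; last exact: integD.
    rewrite RintD//; congr (_ * (_ + _)).
      by under eq_Rintegral do rewrite mulrC; rewrite RintZ.
    by under eq_Rintegral do rewrite mulrC; rewrite RintZ.
  have -> : energy P (diffker (fun x => w * cos (dot y x))) N s =
      w / (2 * N%:R) * ((addsum c s - N%:R * C) ^+ 2 + (addsum s' s - N%:R * S) ^+ 2).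
    rewrite /energy selfE.
    have -> : addsum (potential P (diffker (fun x => w * cos (dot y x)))) s =
        w * (addsum c s * C + addsum s' s * S).
      rewrite /addsum !mulr_suml -big_split/= mulr_sumr.
      by apply: eq_bigr => x _; rewrite potE.
    have -> : \sum_(x <- s) \sum_(z <- s) diffker (fun x => w * cos (dot y x)) x z =
        w * (addsum c s ^+ 2 + addsum s' s ^+ 2).
      under eq_bigr => x _.
        under eq_bigr do rewrite KE.
        rewrite -mulr_sumr big_split/= -!mulr_sumr.
        over.
      by rewrite -mulr_sumr big_split/= -!mulr_suml -!expr2.
    by field; rewrite gt_eqF.
  by rewrite mulr_ge0 ?divr_ge0 ?mulr_ge0 ?addr_ge0 ?sqr_ge0 ?(ltW NR).
- have := energyD N s (kernel_posdef p1) (kernel_posdef p2).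
  by rewrite -[X in X = _ -> _]/(energy P (diffker (fun x => F1 x + F2 x)) N s) => ->; rewrite addr_ge0.
- have [B FB] : exists B, forall n, F_ n rvec0 <= B.
    have /cvg_seq_bounded [B [_ HB]] := cvgP _ (FF rvec0).
    exists (B + 1) => n; have := HB (B + 1); rewrite ltrDl ltr01 => /(_ isT n I).
    by apply: le_trans; rewrite ler_norm.
  have kB : kernel P (fun _ _ => B).
    by apply: (@kernel_bdd _ `|B|).
  have := @energy_lim (fun n => diffker (F_ n)) (diffker F1) (fun _ _ => B) N s
    (fun n => kernel_posdef (p n)) kB.
  move=> H; apply: cvg_ge0 (H _ _) => //.
  + by move=> n x z; exact: le_trans (posdef_bound (p n) _) (FB n).
  + by move=> x z; exact: FF.
Qed.

(** The energy only sees fluctuations, which have zero total mass: constants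
   do not matter. *)
Lemma energy_cst N s (c : R) : (0 < N)%N -> size s = N ->
  energy P (fun _ _ => c) N s = 0.
Proof.
move=> N0 sN; rewrite /energy /selfenergy /potential.
have potE : potential P (fun _ _ => c) = fun=> c.
  by apply/funext => x; rewrite /potential Rint_cst.
rewrite -/(potential P (fun _ _ => c)) potE !Rint_cst /addsum.
have S (v : R) : \sum_(x <- s) v = N%:R * v.
  by rewrite big_const_seq iter_addr_0 count_predT sN mulr_natl.
by rewrite !S; field; rewrite pnatr_eq0 -lt0n.
Qed.

End posdef_energy.

(** * Reduction to uniform regularisations *)

Section assembly.
Context (R : realType) (D : domain) (d : nat) (g : {mfun rvec R d >-> R}).
Local Notation dens := (density (phase_measure R D d)).
Local Notation prob f := (density_prob f : probability (phase R d) R).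

Definition summable_interaction (f : dens) (CG : R) :=
  [/\ forall x, integ (prob f) (fun z => paircut g x z.1),
      forall x, integ (prob f) (fun z => paircut g z.1 x),
      integ (prob f) (fun z => \int[prob f]_w `|paircut g z.1 w.1|),
      integ (prob f) (fun z => \int[prob f]_w `|paircut g w.1 z.1|) &
      `|selfenergy (prob f) (pairker g)| <= CG].

(** A splitting of the interaction into a regular part of nonnegative energy
   and a remainder of size [eps], bounded below and small in mean square. *)
Definition regularisation (f : dens) (eps A0 : R) (A : phase R d -> phase R d -> R) :=
  [/\ measurable_fun setT (fun p : phase R d * phase R d => A p.1 p.2) /\
      (forall x, A x x = A0),
      forall x y, A x y = A y x,
      forall N s, (0 < N)%N -> size s = N -> 0 <= energy (prob f) A N s,
      forall x, \forall y \ae prob f, - eps <= pairker g x y - A x y &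
      forall x, (\int[prob f]_y ((pairker g x y - A x y) ^+ 2)%:E <= (eps ^+ 2)%:E)%E].

(** What the entropy bounds use of a class of densities: constants common to the
   class, and splittings whose remainder is as small as one likes. *)
Definition controlled (Cl : dens -> Prop) :=
  (exists CG, forall f, Cl f -> summable_interaction f CG) /\
  (forall eps, 0 < eps -> exists A0, forall f, Cl f ->
     exists A, regularisation f eps A0 A).

(** The size of the remainder is tuned to twice the inverse temperature, because the
   second moment of the Gibbs weight enters. *)
Lemma controlled_entropy (Cl : dens -> Prop) (beta : R) : 0 < beta ->
  controlled Cl ->
  exists2 K : R, 0 < K & forall f, Cl f -> forall N, (0 < N)%N ->
    (rel_entropy (modulated_gibbs N beta g f) (density_pow N f)
       <= (K / N%:R)%:E)%E /\
    (rel_entropy (density_pow N f) (modulated_gibbs N beta g f)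
       <= (K / N%:R)%:E)%E.
Proof.
move=> b0 [[CG hCG] hA].
have eps0 : 0 < (128 * beta)^-1 by rewrite invr_gt0 mulr_gt0.
have [A0 HA] := hA _ eps0.
exists (expR (beta * `|A0| + 1 + beta * CG)); first exact: expR_gt0.
move=> f Clf N N0; have [kl kr kla kra G] := hCG f Clf.
have [A [[mA AE] sA Apos r_ge r2]] := HA f Clf.
have be : 64 * (2 * beta * (128 * beta)^-1) <= 1.
  rewrite le_eqVlt; apply/orP; left; apply/eqP; field; rewrite gt_eqF//.
have kp := kernel_pairker kl kr kla kra.
have K0 z : pairker g z z = 0 by rewrite /pairker /paircut eqxx addr0 mulr0.
apply: (gibbs_entropy kp K0 mA sA AE Apos eps0 r_ge r2 b0 be G N0) => Z.
rewrite /gibbs_weight; congr expR; rewrite -mulrA; congr (_ * _).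
exact: (@modulated_energyE R D d f g kl kr kla kra N Z N0).
Qed.

End assembly.

Section final.
Context (R : realType) (D : domain) (d : nat) (s beta cd a b : R).
Variable (g : {mfun rvec R d >-> R}).
Hypotheses (hbeta : 0 < beta).

(** The bounds through which the constant may depend on the density. *)
Definition dens_class (L M : R) (f : density (phase_measure R D d)) :=
  (\forall x \ae space_measure R D d, rho f x <= L) /\
  (s = 0 -> (exp_moment D a b f <= M%:E)%E).

(** The constant is chosen for each value of the two bounds before the density is
   given, hence is a function of them alone. *)
Lemma entropy_of_controlled :
  (forall L M, 0 <= L -> controlled g (dens_class L M)) ->
  exists C : R -> R -> R,
    forall f : density (phase_measure R D d),
      ('N[phase_measure R D d]_(+oo)[EFin \o f] < +oo)%E ->
      ('N[space_measure R D d]_(+oo)[EFin \o rho f] < +oo)%E ->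
      (s = 0 -> (exp_moment D a b f < +oo)%E) ->
      let K := C (fine ('N[space_measure R D d]_(+oo)[EFin \o rho f])%E)
                 (if s == 0 then fine (exp_moment D a b f) else 0) in
      0 < K /\
      forall N : nat, (0 < N)%N ->
        (rel_entropy (modulated_gibbs N beta g f) (density_pow N f)
           <= (K / N%:R)%:E)%E /\
        (rel_entropy (density_pow N f) (modulated_gibbs N beta g f)
           <= (K / N%:R)%:E)%E.
Proof.
move=> ctrl.
have H (p : R * R) : exists K : R, 0 <= p.1 -> 0 < K /\
    forall f, dens_class p.1 p.2 f -> forall N, (0 < N)%N ->
    (rel_entropy (modulated_gibbs N beta g f) (density_pow N f)
       <= (K / N%:R)%:E)%E /\
    (rel_entropy (density_pow N f) (modulated_gibbs N beta g f)
       <= (K / N%:R)%:E)%E.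
  have [p0|p0] := leP 0 p.1; last by exists 0.
  by have [K K0 HK] := controlled_entropy hbeta (ctrl p.1 p.2 p0); exists K.
have [C HC] := choice H.
exists (fun L M => C (L, M)) => f _ rhof mom K.
have L0 : 0 <= fine ('N[space_measure R D d]_(+oo)[EFin \o rho f])%E.
  by rewrite fine_ge0// Lnorm_ge0.
have [K0 HK] := HC (_, if s == 0 then fine (exp_moment D a b f) else 0) L0.
split => // N N0; apply: HK => //; split => /=; first exact: rho_le_Lnorm.
move=> s0; rewrite s0 eqxx fineK// ge0_fin_numE ?mom//.
by apply: integral_ge0 => z _; rewrite lee_fin mulr_ge0 ?expR_ge0 ?density_ge0.
Qed.

End final.

(** * Integrals of negative powers *)

Section power_products.
Context d0 (T : measurableType d0) (R : realType).
Variable mu : {sigma_finite_measure set T -> \bar R}.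

Lemma measurable_integral_tuple_cons n (F : n.+1.-tuple T -> \bar R) :
  measurable_fun setT F -> (forall t, 0 <= F t)%E ->
  measurable_fun setT (fun t : n.-tuple T => \int[mu]_z F (tuple_cons (t, z)))%E.
Proof.
move=> mF F0.
have mG := measurableT_comp mF (@measurable_tuple_cons _ T n).
by apply: (@measurable_fun_fubini_tonelli_F _ _ _ _ _ mu _ mG) => p; exact: F0.
Qed.

Lemma measurable_tuple_prod n (u : nat -> T -> R) :
  (forall i, measurable_fun setT (u i)) ->
  measurable_fun setT (fun t : n.-tuple T => \prod_(i < n) u i (tnth t i)).
Proof.
move=> mu_; apply: measurable_prod => i _.
exact: (measurableT_comp (mu_ i) (measurable_tnth i)).
Qed.

Lemma mpow_prod_le n (u : nat -> T -> R) (c : R) : 0 <= c ->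
  (forall i, measurable_fun setT (u i)) -> (forall i x, 0 <= u i x) ->
  (forall i, \int[mu]_x (u i x)%:E <= c%:E)%E ->
  (\int[mpow mu n]_t (\prod_(i < n) u i (tnth t i))%:E <= (c ^+ n)%:E)%E.
Proof.
move=> c0; elim: n u => [|n IH] u mu_ u0 uc.
  by rewrite integral_mpow0 big_ord0 expr0.
have mF := measurable_tuple_prod (n := n.+1) mu_.
have F0 (t : n.+1.-tuple T) : (0 <= (\prod_(i < n.+1) u i (tnth t i))%:E)%E.
  by rewrite lee_fin; apply: prodr_ge0 => i _; exact: u0.
have mFE : measurable_fun setT
    (fun t : n.+1.-tuple T => (\prod_(i < n.+1) u i (tnth t i))%:E).
  exact/measurable_EFinP.
rewrite (ge0_integral_mpowS mu mFE F0).
pose v i := u i.+1.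
have E t z : (\prod_(i < n.+1) u i (tnth (tuple_cons (t : n.-tuple T, z)) i))%:E =
    ((\prod_(i < n) v i (tnth t i))%:E * (u 0%N z)%:E)%E.
  rewrite -EFinM big_ord_recl mulrC tnth0; congr (_ * _)%:E.
  by apply: eq_bigr => i _; rewrite tnthS.
have mv i : measurable_fun setT (v i) by exact: mu_.
have mV := measurable_tuple_prod (n := n) mv.
have V0 (t : n.-tuple T) : (0 <= (\prod_(i < n) v i (tnth t i))%:E)%E.
  by rewrite lee_fin; apply: prodr_ge0 => i _; exact: u0.
apply: (@le_trans _ _ (\int[mpow mu n]_t
    ((\prod_(i < n) v i (tnth t i))%:E * c%:E))%E).
  apply: ge0_le_integral => //.
  - by move=> t _; apply: integral_ge0 => z _; exact: F0.
  - exact: measurable_integral_tuple_cons mFE F0.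
  - by apply: emeasurable_funM => //; exact/measurable_EFinP.
  move=> t _; under eq_integral do rewrite E.
  rewrite ge0_integralZl; [|exact: measurableT|exact/measurable_EFinP|
    by move=> z _; rewrite lee_fin|exact: V0].
  by rewrite lee_wpmul2l.
rewrite ge0_integralZr//; last exact/measurable_EFinP.
rewrite exprSr EFinM; apply: lee_wpmul2r; first by rewrite lee_fin.
by apply: IH => // i; [exact: u0|exact: uc].
Qed.

End power_products.

Section singular_integral.
Context (R : realType) (D : domain) (d : nat).
Notation mx := (space_measure R D d).

Lemma dist_itv (u v h : R) : `|u - v| <= h -> u - h <= v <= u + h.
Proof. by rewrite ler_norml => /andP[h1 h2]; apply/andP; split; lra. Qed.

Lemma leb_side_itv_le (x y : R) : x <= y ->
  (@leb_side R D `[x, y]%classic <= (y - x)%:E)%E.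
Proof.
move=> xy; rewrite /leb_side /mrestr.
apply: (@le_trans _ _ (lebesgue_measure (`[x, y]%classic : set R))).
  apply: le_measure; rewrite ?inE; last exact: subIsetl.
    by apply: measurableI; [exact: measurable_itv|exact: measurable_side].
  exact: measurable_itv.
rewrite lebesgue_measure_itv/=; case: ifPn => // _.
by rewrite lee_fin subr_ge0.
Qed.

Definition box (x : rvec R d) (h : R) (y : rvec R d) : R :=
  \prod_(i < d) \1_(`[(tnth x i - h), (tnth x i + h)]%classic : set R) (tnth y i).

Lemma box_ge0 x h y : 0 <= box x h y.
Proof. exact: prodr_ge0. Qed.

Lemma measurable_box x h : measurable_fun setT (box x h).
Proof.
apply: measurable_prod => i _.
by apply: measurableT_comp; [exact: measurable_indic|exact: measurable_tnth].
Qed.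

Lemma integral_box_le x h : 0 <= h ->
  (\int[mx]_y (box x h y)%:E <= ((2 * h) ^+ d)%:E)%E.
Proof.
move=> h0.
pose u (i : nat) : measurableTypeR R -> R :=
  \1_(`[(nth 0 (x : seq R) i - h), (nth 0 (x : seq R) i + h)]%classic : set R).
have bE y : box x h y = \prod_(i < d) u i (tnth y i).
  by apply: eq_bigr => i _; rewrite /u (tnth_nth 0).
under eq_integral do rewrite bE.
apply: mpow_prod_le.
- exact: mulr_ge0.
- by move=> i; exact: measurable_indic.
- by move=> i z; rewrite /u indicE.
- move=> i; rewrite integral_indic//= setIT.
  apply: le_trans (leb_side_itv_le _) _; first lra.
  by rewrite lee_fin; lra.
Qed.

Lemma sqnorm_coord_le (x : rvec R d) i : tnth x i ^+ 2 <= sqnorm x.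
Proof.
rewrite /sqnorm (bigD1 i)//= lerDl; apply: sumr_ge0 => j _; exact: sqr_ge0.
Qed.

Lemma enorm_ge0 (x : rvec R d) : 0 <= enorm x. Proof. exact: sqrtr_ge0. Qed.

Lemma enorm_sq (x : rvec R d) : enorm x ^+ 2 = sqnorm x.
Proof. by rewrite sqr_sqrtr// sqnorm_ge0. Qed.

Lemma coord_le_enorm (x : rvec R d) i : `|tnth x i| <= enorm x.
Proof.
rewrite -(ler_pXn2r (n := 2))// ?nnegrE ?enorm_ge0//.
by rewrite enorm_sq real_normK ?num_real// sqnorm_coord_le.
Qed.

Lemma measurable_sqnorm : measurable_fun setT (@sqnorm R d).
Proof.
apply: measurable_sum => i; apply: measurable_funX; exact: measurable_tnth_rvec.
Qed.

Lemma measurable_enorm : measurable_fun setT (@enorm R d).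
Proof.
apply: (measurableT_comp _ measurable_sqnorm).
exact: (continuous_measurable_fun (@sqrt_continuous R)).
Qed.

Lemma measurable_vsubl (x : rvec R d) : measurable_fun setT (vsub x).
Proof. exact: (measurableT_comp (@measurable_vsub R d) (pair1_measurable x)). Qed.

Lemma measurable_vsubr (x : rvec R d) : measurable_fun setT (fun y => vsub y x).
Proof. exact: (measurableT_comp (@measurable_vsub R d) (pair2_measurable x)). Qed.

Lemma sqnorm_vsubC (x y : rvec R d) : sqnorm (vsub x y) = sqnorm (vsub y x).
Proof. by apply: eq_bigr => i _; rewrite !tnth_mktuple -sqrrN opprB. Qed.

Lemma enorm_vsubC (x y : rvec R d) : enorm (vsub x y) = enorm (vsub y x).
Proof. by rewrite /enorm; congr Num.sqrt; exact: sqnorm_vsubC. Qed.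

Lemma vsubxx (x : rvec R d) : vsub x x = rvec0.
Proof. by apply: eq_from_tnth => i; rewrite !tnth_mktuple subrr. Qed.

Lemma enorm_vsub_gt0 (x y : rvec R d) : y != x -> 0 < enorm (vsub x y).
Proof.
move=> yx; rewrite lt_neqAle enorm_ge0 andbT eq_sym; apply/negP => /eqP e0.
move/eqP: yx; apply; apply: eq_from_tnth => i.
have := coord_le_enorm (vsub x y) i; rewrite e0 normr_le0 tnth_mktuple subr_eq0.
by move/eqP.
Qed.

(** Dyadic layers: on the shell of radius about [2^-k] the power [r^-p] is at
   most [2^(kp)], and the shell lies in a box of side [2^(2-k)]. *)
Lemma power_le_layers (p : R) (x y : rvec R d) : 0 <= p ->
  ((enorm (vsub x y) `^ (- p))%:E <=
   1 + \sum_(k <oo) ((2 `^ p) ^+ k * box x (2 * 2^-1 ^+ k) y)%:E)%E.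
Proof.
move=> p0; set e := enorm (vsub x y).
have t0 (k : nat) : (0 <= ((2 `^ p) ^+ k * box x (2 * 2^-1 ^+ k) y)%:E)%E.
  by rewrite lee_fin mulr_ge0 ?exprn_ge0 ?powR_ge0 ?box_ge0.
have e0 : 0 <= e by exact: enorm_ge0.
have le1 : e `^ (- p) <= 1 -> ((e `^ (- p))%:E <=
   1 + \sum_(k <oo) ((2 `^ p) ^+ k * box x (2 * 2^-1 ^+ k) y)%:E)%E.
  move=> h; apply: (@le_trans _ _ (1%:E)); first by rewrite lee_fin.
  by rewrite leeDl// nneseries_ge0.
have [ez|en0] := eqVneq e 0.
  apply: le1; rewrite ez /powR eqxx; by case: (_ == 0).
have egt : 0 < e by rewrite lt_neqAle eq_sym en0.
have [e1|e1] := leP 1 e.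
  by apply: le1; rewrite -(powRr0 e) ler_powR// oppr_le0.
have ex : exists k, 2^-1 ^+ k <= e.
  have h : (2^-1 : R) ^+ n @[n --> \oo] --> 0.
    by apply: cvg_expr; rewrite ger0_norm ?invr_ge0// invf_lt1// ltr1n.
  move/cvgr0Pnorm_le : h => /(_ e egt) [k _ /(_ k (leqnn k))] /=.
  by rewrite ger0_norm ?exprn_ge0// => ?; exists k.
pose k := ex_minn ex.
have [kP kmin] : 2^-1 ^+ k <= e /\ forall m, 2^-1 ^+ m <= e -> (k <= m)%N.
  by rewrite /k; case: ex_minnP.
have ke : e <= 2 * 2^-1 ^+ k.
  have k0 : (0 < k)%N.
    by rewrite lt0n; apply/eqP => kz; move: kP; rewrite kz expr0 leNgt e1.
  rewrite -(prednK k0) exprS mulrA divff// mul1r leNgt; apply/negP => lt.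
  by have := kmin _ (ltW lt); rewrite -ltnS prednK// ltnn.
have bx : box x (2 * 2^-1 ^+ k) y = 1.
  rewrite /box big1// => i _; rewrite indicE mem_set//= in_itv/=.
  have := le_trans (coord_le_enorm (vsub x y) i) ke.
  by rewrite tnth_mktuple => /dist_itv.
apply: (@le_trans _ _ (((2 `^ p) ^+ k * box x (2 * 2^-1 ^+ k) y)%:E)).
  rewrite lee_fin bx mulr1.
  have -> : (2 `^ p) ^+ k = (2 ^+ k) `^ p :> R.
    by rewrite -powR_mulrn ?powR_ge0// powRAC powR_mulrn.
  have -> : e `^ (- p) = (e^-1) `^ p by rewrite -powR_inv1// -powRrM mulN1r.
  apply: ge0_ler_powR => //; rewrite ?nnegrE ?invr_ge0 ?exprn_ge0//.
  rewrite -[leRHS]invrK lef_pV2 ?posrE ?invr_gt0 ?exprn_gt0//.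
  by rewrite -exprVn.
apply: (@le_trans _ _ (\sum_(j <oo) ((2 `^ p) ^+ j * box x (2 * 2^-1 ^+ j) y)%:E)%E).
  rewrite (@nneseriesD1 _ _ k xpredT)//.
  by rewrite leeDl// nneseries_ge0// => j _ _; exact: t0.
by rewrite leeDr.
Qed.

Definition singular_bound (p : R) : R := 4 ^+ d / (1 - 2 `^ p / 2 ^+ d).

Lemma integral_layers_le (p : R) x : 0 <= p -> p < d%:R ->
  (\int[mx]_y (\sum_(k <oo) ((2 `^ p) ^+ k * box x (2 * 2^-1 ^+ k) y)%:E) <=
   (singular_bound p)%:E)%E.
Proof.
move=> p0 pd.
have t0 (k : nat) y : (0 <= ((2 `^ p) ^+ k * box x (2 * 2^-1 ^+ k) y)%:E)%E.
  by rewrite lee_fin mulr_ge0 ?exprn_ge0 ?powR_ge0 ?box_ge0.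
set r := 2 `^ p / 2 ^+ d.
have r0 : 0 <= r by rewrite divr_ge0 ?powR_ge0 ?exprn_ge0.
have r1 : r < 1.
  rewrite ltr_pdivrMr ?exprn_gt0// mul1r -powR_mulrn//.
  by rewrite /powR gt_eqF// ltr_expR ltr_pM2r// ln_gt0// ltr1n.
rewrite integral_nneseries//; last first.
  by move=> k; apply/measurable_EFinP; apply: measurable_funM => //; exact: measurable_box.
apply: lime_le.
  by apply: is_cvg_nneseries => n _ _; exact: integral_ge0.
apply: nearW => n.
apply: (@le_trans _ _ (\sum_(0 <= k < n) (4 ^+ d * r ^+ k)%:E)%E).
  apply: lee_sum => k _.
  under eq_integral do rewrite EFinM.
  rewrite ge0_integralZl; [|exact: measurableT|
    by apply/measurable_EFinP; exact: measurable_box|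
    by move=> y _; rewrite lee_fin box_ge0|
    by rewrite lee_fin exprn_ge0// powR_ge0].
  apply: (@le_trans _ _ (((2 `^ p) ^+ k)%:E * ((2 * (2 * 2^-1 ^+ k)) ^+ d)%:E)%E).
    rewrite lee_wpmul2l ?lee_fin ?exprn_ge0 ?powR_ge0//.
    by apply: integral_box_le; rewrite mulr_ge0 ?exprn_ge0.
  rewrite -EFinM lee_fin le_eqVlt; apply/orP; left; apply/eqP.
  have -> : 2 * (2 * 2^-1 ^+ k) = 4 * 2^-1 ^+ k :> R by ring.
  rewrite exprMn /r expr_div_n mulrCA; congr (_ * (_ * _)).
  by rewrite -(exprM 2^-1) -(exprM 2) exprVn mulnC.
rewrite sumEFin lee_fin -mulr_sumr /singular_bound -/r.
rewrite ler_pM2l ?exprn_gt0// big_mkord.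
have r1' : 0 < 1 - r by rewrite subr_gt0.
rewrite -[leRHS]mul1r ler_pdivlMr//.
have := subrX1 r n => h.
have -> : (\sum_(i < n) r ^+ i) * (1 - r) = 1 - r ^+ n.
  move: h; move: (\sum_(i < n) r ^+ i) (r ^+ n) => S rn h.
  rewrite -[RHS]opprB h; ring.
by rewrite lerBlDr lerDl exprn_ge0.
Qed.

Variable f : density (phase_measure R D d).
Let P : probability (phase R d) R := density_prob f.
Variable L : R.
Hypothesis rL : \forall x \ae mx, rho f x <= L.
Hypothesis L0 : 0 <= L.

Lemma integral_power_le (p : R) x : 0 <= p -> p < d%:R ->
  (\int[P]_w (enorm (vsub x w.1) `^ (- p))%:E <= (1 + L * singular_bound p)%:E)%E.
Proof.
move=> p0 pd.
pose S y := (\sum_(k <oo) ((2 `^ p) ^+ k * box x (2 * 2^-1 ^+ k) y)%:E)%E.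
have t0 (k : nat) y : (0 <= ((2 `^ p) ^+ k * box x (2 * 2^-1 ^+ k) y)%:E)%E.
  by rewrite lee_fin mulr_ge0 ?exprn_ge0 ?powR_ge0 ?box_ge0.
have S0 y : (0 <= S y)%E by apply: nneseries_ge0.
have mS : measurable_fun setT S.
  apply: ge0_emeasurable_sum => //.
  by move=> k _; apply/measurable_EFinP; apply: measurable_funM => //; exact: measurable_box.
apply: (@le_trans _ _ (\int[P]_w (1 + S w.1))%E).
  apply: ge0_le_integral => //.
  - by move=> w _; rewrite lee_fin powR_ge0.
  - apply/measurable_EFinP.
    apply: (measurableT_comp (f := fun r : R => r `^ (- p))); first exact: measurable_powR.
    apply: (measurableT_comp measurable_enorm).
    exact: (measurableT_comp (measurable_vsubl x) measurable_fst).
  - by apply: emeasurable_funD => //; exact: measurableT_comp.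
  - by move=> w _; exact: power_le_layers.
rewrite ge0_integralD//; last exact: measurableT_comp.
rewrite EFinD; apply: leeD.
  by have := Rint_EFin (integ_cst P 1) => /= <-; rewrite Rint_cst.
apply: le_trans (ge0_integral_position_le rL L0 mS S0) _.
by rewrite EFinM lee_wpmul2l ?lee_fin//; exact: integral_layers_le.
Qed.

(** A point is a box of side 0. *)
Lemma ae_neq_position (x : rvec R d) : (0 < d)%N -> \forall w \ae P, w.1 != x.
Proof.
move=> d0; pose B := [set w : phase R d | w.1 == x].
have mB1 : measurable_fun setT (fun y => (box x 0 y)%:E).
  by apply/measurable_EFinP; exact: measurable_box.
have b0 y : (0 <= (box x 0 y)%:E :> \bar R)%E by rewrite lee_fin box_ge0.
have mB : measurable B.
  have m1 : measurable_fun setT (fun w : phase R d => (w.1, x)).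
    by apply: measurable_fun_pair.
  have := measurableT_comp (@measurable_rvec_eq R d) m1.
  by move=> /(_ measurableT [set true] I); rewrite setTI.
exists B; split => //; last by move=> w /= /negP; rewrite negbK.
apply/eqP; rewrite eq_le measure_ge0 andbT.
have -> : P B = (\int[P]_w (\1_B w)%:E)%E by rewrite integral_indic// setIT.
apply: (@le_trans _ _ (\int[P]_w (box x 0 w.1)%:E)%E).
  apply: ge0_le_integral; first exact: measurableT.
  - by move=> w _; rewrite lee_fin.
  - by apply/measurable_EFinP; exact: measurable_indic.
  - by apply: (measurableT_comp mB1); exact: measurable_fst.
  move=> w _; rewrite lee_fin indicE.
  have [/set_mem /= /eqP ->|_] := boolP (w \in B); last exact: box_ge0.
  rewrite /box big1// => i _.
  by rewrite indicE mem_set//= in_itv/= subr0 addr0 lexx.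
apply: le_trans (ge0_integral_position_le rL L0 mB1 b0) _.
apply: (@le_trans _ _ (L%:E * ((2 * 0) ^+ d)%:E)%E).
  by rewrite lee_wpmul2l ?lee_fin//; exact: integral_box_le.
by rewrite mulr0 expr0n gtn_eqF// -EFinM mulr0.
Qed.

End singular_integral.

(** * Summability criterion and logarithmic bounds *)

Section summable.
Context (R : realType) (D : domain) (d : nat) (g : {mfun rvec R d >-> R}).
Variable f : density (phase_measure R D d).
Let P : probability (phase R d) R := density_prob f.

Lemma kernel_sum (u : phase R d -> R) : integ P u -> kernel P (fun x y => u x + u y).
Proof.
move=> iu; have mu := integ_measurable iu; split.
- apply: measurable_funD; first exact: (measurableT_comp mu measurable_fst).
  exact: (measurableT_comp mu measurable_snd).
- by move=> x y; rewrite addrC.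
- by move=> x; apply: integD => //; exact: integ_cst.
apply: (integ_dom _ _ (integD (integ_norm iu) (integ_cst P (\int[P]_y `|u y|)))).
  apply: (@measurable_fun_param_Rintegral _ _ _ _ _ P
    (fun p : phase R d * phase R d => `|u p.1 + u p.2|)).
  apply: measurableT_comp => //; apply: measurable_funD.
    exact: (measurableT_comp mu measurable_fst).
  exact: (measurableT_comp mu measurable_snd).
move=> x; rewrite ger0_norm; last exact: Rintegral_ge0.
rewrite -[X in X + _](Rint_cst P) -RintD; [|exact: integ_cst|exact: integ_norm].
apply: Rint_le.
- by apply: integ_norm; apply: integD => //; exact: integ_cst.
- by apply: integD; [exact: integ_cst|exact: integ_norm].
- by move=> y; exact: ler_normD.
Qed.

Variables (H : rvec R d -> R) (V : rvec R d -> rvec R d -> R) (B1 B2 : R).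
Hypothesis mH : measurable_fun setT H.
Hypothesis H0 : forall x, 0 <= H x.
Hypothesis HB : (\int[P]_w (H w.1)%:E <= B1%:E)%E.
Hypothesis mV : forall x, measurable_fun setT (V x).
Hypothesis V0 : forall x y, 0 <= V x y.
Hypothesis VC : forall x y, V x y = V y x.
Hypothesis VB : forall x, (\int[P]_w (V x w.1)%:E <= B2%:E)%E.
Hypothesis gHV : forall x y, `|paircut g x y| <= H x + H y + V x y.

Let iH : integ P (fun w => H w.1).
Proof. by apply: ge0_integ HB => //; exact: measurableT_comp. Qed.

Let iV x : integ P (fun w => V x w.1).
Proof. by apply: ge0_integ (VB x) => //; exact: measurableT_comp. Qed.

Let HB' : \int[P]_w H w.1 <= B1. Proof. by rewrite -lee_fin Rint_EFin. Qed.

Let VB' x : \int[P]_w V x w.1 <= B2. Proof. by rewrite -lee_fin Rint_EFin. Qed.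

Let bnd x : integ P (fun w => H x + H w.1 + V x w.1).
Proof. by apply: integD => //; apply: integD => //; exact: integ_cst. Qed.

Let bndE x : \int[P]_w (H x + H w.1 + V x w.1) <= H x + B1 + B2.
Proof.
rewrite RintD//; last by apply: integD => //; exact: integ_cst.
by rewrite RintD ?Rint_cst//; [rewrite !lerD|exact: integ_cst].
Qed.

Let kl x : integ P (fun z => paircut g x z.1).
Proof.
apply: (integ_dom _ _ (bnd x)) => [|w]; last exact: gHV.
apply: (measurableT_comp (f := paircut g x)); last exact: measurable_fst.
exact: (measurableT_comp (measurable_paircut g) (pair1_measurable x)).
Qed.

Let gHV' x y : `|paircut g y x| <= H x + H y + V x y.
Proof. by rewrite VC (addrC (H x)). Qed.

Let kr x : integ P (fun z => paircut g z.1 x).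
Proof.
apply: (integ_dom _ _ (bnd x)) => [|w]; last exact: gHV'.
apply: (measurableT_comp (f := fun y => paircut g y x)); last exact: measurable_fst.
exact: (measurableT_comp (measurable_paircut g) (pair2_measurable x)).
Qed.

Let iHB : integ P (fun z => H z.1 + B1 + B2).
Proof. by apply: integD; [apply: integD|]; rewrite //; exact: integ_cst. Qed.

Let mk12 : measurable_fun setT (fun p : phase R d * phase R d => paircut g p.1.1 p.2.1).
Proof.
apply: (measurableT_comp (measurable_paircut g)
  (g := fun p : phase R d * phase R d => (p.1.1, p.2.1))).
by apply: measurable_fun_pair; apply: measurableT_comp.
Qed.

Let mk21 : measurable_fun setT (fun p : phase R d * phase R d => paircut g p.2.1 p.1.1).
Proof.
apply: (measurableT_comp (measurable_paircut g)
  (g := fun p : phase R d * phase R d => (p.2.1, p.1.1))).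
by apply: measurable_fun_pair; apply: measurableT_comp.
Qed.

Let le_l (z : phase R d) : \int[P]_w `|paircut g z.1 w.1| <= H z.1 + B1 + B2.
Proof.
by apply: le_trans (bndE z.1); apply: Rint_le => //; exact: integ_norm.
Qed.

Let le_r (z : phase R d) : \int[P]_w `|paircut g w.1 z.1| <= H z.1 + B1 + B2.
Proof.
by apply: le_trans (bndE z.1); apply: Rint_le => //; exact: integ_norm.
Qed.

Let kla : integ P (fun z => \int[P]_w `|paircut g z.1 w.1|).
Proof.
apply: (integ_dom _ _ iHB).
  apply: (@measurable_fun_param_Rintegral _ _ _ _ _ P (fun p => `|paircut g p.1.1 p.2.1|)).
  exact: measurableT_comp.
by move=> z; rewrite ger0_norm//; exact: Rintegral_ge0.
Qed.

Let kra : integ P (fun z => \int[P]_w `|paircut g w.1 z.1|).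
Proof.
apply: (integ_dom _ _ iHB).
  apply: (@measurable_fun_param_Rintegral _ _ _ _ _ P (fun p => `|paircut g p.2.1 p.1.1|)).
  exact: measurableT_comp.
by move=> z; rewrite ger0_norm//; exact: Rintegral_ge0.
Qed.

(** One-body terms with finite mean cover the growth of the logarithm at infinity;
   the pair term, integrable uniformly in its first argument, covers the singularity
   on the diagonal. *)
Lemma summable_of_bound : summable_interaction g f (2 * B1 + B2).
Proof.
split => //.
have kp := kernel_pairker kl kr kla kra.
have [_ _ ki _] := kp.
apply: le_trans (le_Rint_norm (integ_potential kp)) _.
apply: (@le_trans _ _ (\int[P]_z (H z.1 + B1 + B2))).
  apply: Rint_le => //; first exact/integ_norm/integ_potential.
  move=> z; apply: le_trans (bndE z.1).
  apply: le_trans (le_Rint_norm (ki z)) _.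
  apply: Rint_le => //; [exact: integ_norm|exact: bnd|].
  move=> w; rewrite normrM ger0_norm//.
  have := gHV z.1 w.1; have := gHV' z.1 w.1.
  by have := ler_normD (paircut g z.1 w.1) (paircut g w.1 z.1); lra.
rewrite RintD ?Rint_cst//; [|by apply: integD => //; exact: integ_cst|exact: integ_cst].
rewrite RintD ?Rint_cst//; last exact: integ_cst.
by have := HB'; lra.
Qed.

End summable.

Section log_bounds.
Context {R : realType}.
Implicit Types (t u b tau : R).

Lemma ln_one_sqr_le b t : 0 < b -> 0 <= t -> ln (1 + t ^+ 2) <= 1 + 2 / b * t `^ b.
Proof.
move=> b0 t0; have pw : 0 <= 2 / b * t `^ b by rewrite mulr_ge0 ?divr_ge0 ?powR_ge0// ltW.
have t2 : 0 <= t ^+ 2 by exact: sqr_ge0.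
have [t1|t1] := leP t 1.
  apply: le_trans (le_ln1Dx _) _; first lra.
  have : t ^+ 2 <= 1 by rewrite expr_le1.
  lra.
have tg : 0 < t by lra.
apply: (@le_trans _ _ (ln (2 * t ^+ 2))).
  by rewrite ler_ln ?posrE; [nra|lra|rewrite mulr_gt0// exprn_gt0].
rewrite lnM ?posrE ?exprn_gt0// lnXn// lerD//.
  have -> : (2 : R) = 1 + 1 by [].
  exact: le_ln1Dx.
have : b * ln t <= t `^ b.
  by rewrite -ln_powR ltW// ln_sublinear// powR_gt0.
rewrite mulrC -ler_pdivlMr// => h.
have -> : ln t *+ 2 = 2 * ln t by rewrite mulr_natl.
have -> : 2 / b * t `^ b = 2 * (t `^ b / b) by rewrite -mulrA (mulrC b^-1).
by rewrite ler_wpM2l.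
Qed.

Lemma ln_one_sqr_small tau u : 0 < tau -> tau <= 2 -> 0 < u ->
  ln (1 + u ^+ 2) <= (1 + 2 / tau) * u `^ tau.
Proof.
move=> t0 t2 u0; have [u1|u1] := leP u 1.
  apply: le_trans (le_ln1Dx _) _; first by rewrite (lt_le_trans _ (sqr_ge0 _))// ltrN10.
  apply: (@le_trans _ _ (u `^ tau)).
    by rewrite -powR_mulrn ?(ltW u0)// ger_powR// u0.
  by rewrite ler_peMl ?powR_ge0// lerDl divr_ge0// ltW.
apply: le_trans (ln_one_sqr_le t0 (ltW u0)) _.
rewrite [leRHS]mulrDl mul1r lerD2r.
by rewrite -(powRr0 u) ler_powR// ltW.
Qed.

Lemma ln_one_sqr_exp a b t : 0 < a -> 0 < b -> 0 <= t ->
  ln (1 + t ^+ 2) <= (1 + 2 / b / a) * expR (a * t `^ b).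
Proof.
move=> a0 b0 t0; apply: le_trans (ln_one_sqr_le b0 t0) _.
set y := t `^ b; have y0 : 0 <= y by exact: powR_ge0.
have e1 : 1 <= expR (a * y) by rewrite -expR0 ler_expR mulr_ge0// ltW.
have e2 : a * y <= expR (a * y) by apply: le_trans (expR_ge1Dx _); rewrite lerDr.
rewrite [leRHS]mulrDl mul1r lerD// -!mulrA ler_wpM2l// ler_wpM2l ?invr_ge0 ?(ltW b0)//.
by rewrite mulrC ler_pdivlMr// mulrC.
Qed.

Lemma ln_one_add_le (x y z : R) : 0 <= x -> 0 <= y -> 0 <= z -> z <= 2 * x + 2 * y ->
  ln (1 + z) <= 1 + ln (1 + x) + ln (1 + y).
Proof.
move=> x0 y0 z0 le2; have xy0 : 0 <= x * y by exact: mulr_ge0.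
have [X0 Y0] : 0 < 1 + x /\ 0 < 1 + y by split; lra.
have ln2 : ln 2 <= 1 :> R.
  have -> : (2 : R) = 1 + 1 by [].
  exact: le_ln1Dx.
apply: (@le_trans _ _ (ln (2 * ((1 + x) * (1 + y))))).
  rewrite ler_ln ?posrE; [|lra|by rewrite !mulr_gt0].
  have -> : (1 + x) * (1 + y) = 1 + x + y + x * y by ring.
  lra.
rewrite lnM ?posrE ?mulr_gt0// lnM ?posrE//; lra.
Qed.

Lemma log_norm_le (c p e C x y : R) : 0 < c -> 0 < p -> 0 < e -> 0 <= C ->
  0 <= x -> 0 <= y -> ln (1 + e ^+ 2) <= 1 + C * x + C * y ->
  `|- c * ln e| <= c * C * x + c * C * y + c * (1 + p^-1) * (1 + e `^ (- p)).
Proof.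
move=> c0 p0 e0 C0 x0 y0 lle.
have P0 : 0 <= e `^ (- p) by exact: powR_ge0.
have lo : - ln e <= p^-1 * e `^ (- p).
  rewrite mulrC ler_pdivlMr// mulrC mulrN -mulNr -ln_powR.
  by rewrite ltW// ln_sublinear// powR_gt0.
have le0 : 2 * ln e <= ln (1 + e ^+ 2).
  rewrite mulr_natl -lnXn// ler_ln ?posrE ?exprn_gt0// ?lerDr//.
  by rewrite ltr_pwDl// sqr_ge0.
have l0 : 0 <= ln (1 + e ^+ 2) by apply: ln_ge0; rewrite lerDl sqr_ge0.
have pi0 : 0 <= p^-1 by rewrite invr_ge0 ltW.
have pe : 0 <= p^-1 * e `^ (- p) by exact: mulr_ge0.
have hx : 0 <= C * x by exact: mulr_ge0.
have hy : 0 <= C * y by exact: mulr_ge0.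
have -> : c * C * x + c * C * y + c * (1 + p^-1) * (1 + e `^ (- p)) =
    c * (C * x + C * y + 1 + e `^ (- p) + p^-1 + p^-1 * e `^ (- p)) by ring.
rewrite normrM normrN (gtr0_norm c0) ler_pM2l// ler_norml.
by apply/andP; split; lra.
Qed.

Lemma ln_shift_le (r x y : R) : 0 < r -> 0 <= x -> x <= y ->
  `|ln (r + x)| <= `|ln r| + ln (1 + r) + ln (1 + y).
Proof.
move=> r0 x0 xy; have p1 : 0 < r + x by lra.
have lo : ln r <= ln (r + x) by rewrite ler_ln ?posrE//; lra.
have up : ln (r + x) <= ln (1 + r) + ln (1 + y).
  rewrite -lnM ?posrE; [|lra|lra].
  rewrite ler_ln ?posrE//; [nra|].
  by rewrite mulr_gt0//; lra.
have := ler_norm (- ln r); rewrite normrN => n1.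
have n2 := ler_norm (ln r).
have l1 : 0 <= ln (1 + r) by apply: ln_ge0; rewrite lerDl ltW.
have l2 : 0 <= ln (1 + y) by apply: ln_ge0; lra.
by rewrite ler_norml; apply/andP; split; lra.
Qed.

End log_bounds.

(** * The whole space *)

Section whole_space.
Context (R : realType) (d : nat) (s cd a b : R) (g : {mfun rvec R d >-> R}).
Hypotheses (hs0 : 0 <= s) (hsd : s < d%:R / 2) (hcd : 0 < cd).
Hypothesis hg : g =1 riesz s cd.
Hypotheses (ha : 0 < a) (hb : 0 < b).

Let d0 : (0 < d)%N.
Proof.
rewrite lt0n; apply/eqP => dz; move: hsd; rewrite dz mul0r => /(le_lt_trans hs0).
by rewrite ltxx.
Qed.

(* The room left by [s < d / 2], so that [|x|^-p] remains integrable. *)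
Let tau := Num.min 1 ((d%:R / 2 - s) / 2).
Let p := 2 * (s + tau).

Let tau0 : 0 < tau.
Proof. by rewrite lt_min ltr01/= divr_gt0// subr_gt0. Qed.

Let tau2 : tau <= 2.
Proof. by rewrite ge_min; apply/orP; left; rewrite ler1n. Qed.

Let p0 : 0 < p. Proof. by rewrite mulr_gt0// ltr_wpDl. Qed.

Let pd : p < d%:R.
Proof.
have h : tau <= (d%:R / 2 - s) / 2 by rewrite ge_min lexx orbT.
by move: hsd; rewrite /p; lra.
Qed.

Let c := riesz_const d s.

Let c_ge0 : 0 <= c.
Proof.
have gam z : 0 <= @gamma_fun R z.
  by apply: Rintegral_ge0 => t _; rewrite mulr_ge0 ?powR_ge0 ?expR_ge0.
by rewrite divr_ge0// !mulr_ge0 ?powR_ge0.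
Qed.

(** The potential of [sqrt (delta^2 + |x|^2)] in place of [|x|]. *)
Definition riesz_reg (delta : R) (x : rvec R d) : R :=
  if s == 0 then - (cd / 2) * ln (delta ^+ 2 + sqnorm x)
  else c * (delta ^+ 2 + sqnorm x) `^ (- (s / 2)).

Let C1 : R := (if s == 0 then cd / 2 else c * (s / 2)) * (1 + 2 / tau).

Let C1_ge0 : 0 <= C1.
Proof.
have t1 : 0 <= 1 + 2 / tau by rewrite addr_ge0// divr_ge0// ltW.
rewrite mulr_ge0//; case: ifP => _; first by rewrite divr_ge0// ltW.
by rewrite mulr_ge0// divr_ge0.
Qed.

(** The remainder is at most a multiple of [ln (1 + (delta / |x|)^2)] times [|x|^-s]. *)
Lemma riesz_rem_bound (delta : R) (x : rvec R d) : 0 < delta -> 0 < enorm x ->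
  0 <= riesz s cd x - riesz_reg delta x <=
  C1 * (delta `^ tau * enorm x `^ (- (s + tau))).
Proof.
move=> dl0 e0; set e := enorm x in e0 *; set u := delta / e.
have u0 : 0 < u by exact: divr_gt0.
set l := ln (1 + u ^+ 2).
have l0 : 0 <= l by apply: ln_ge0; rewrite lerDl sqr_ge0.
have lu : l <= (1 + 2 / tau) * u `^ tau by exact: ln_one_sqr_small.
have t1 : 0 <= 1 + 2 / tau by rewrite addr_ge0// divr_ge0// ltW.
have sq : 0 < delta ^+ 2 + sqnorm x by rewrite ltr_pwDl ?exprn_gt0// sqnorm_ge0.
have lnE : ln (delta ^+ 2 + sqnorm x) = 2 * ln e + l.
  have -> : delta ^+ 2 + sqnorm x = e ^+ 2 * (1 + u ^+ 2).
    by rewrite -enorm_sq -/e /u; field; rewrite gt_eqF.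
  rewrite lnM ?posrE ?exprn_gt0//; last by rewrite ltr_pwDl// sqr_ge0.
  by rewrite lnXn// mulr_natl.
have uE : u `^ tau = delta `^ tau * e `^ (- tau).
  by rewrite /u powRM ?invr_ge0 ?(ltW dl0) ?(ltW e0)// -powR_inv1 ?(ltW e0)// -powRrM mulN1r.
rewrite /riesz /riesz_reg /C1 -/c -/e; case: eqP => [s0|_].
  rewrite s0 add0r lnE.
  have -> : - cd * ln e - - (cd / 2) * (2 * ln e + l) = cd / 2 * l by field.
  have cd2 : 0 <= cd / 2 by rewrite divr_ge0// ltW.
  rewrite mulr_ge0//= -uE.
  have -> : cd / 2 * (1 + 2 / tau) * u `^ tau = cd / 2 * ((1 + 2 / tau) * u `^ tau).
    by rewrite mulrA.
  by rewrite ler_wpM2l.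
have -> : e `^ (- s) = expR (- s * ln e) by rewrite /powR gt_eqF.
have -> : (delta ^+ 2 + sqnorm x) `^ (- (s / 2)) =
    expR (- s * ln e) * expR (- (s / 2 * l)).
  by rewrite /powR (gt_eqF sq) lnE -expRD; congr expR; field.
have -> : c * expR (- s * ln e) - c * (expR (- s * ln e) * expR (- (s / 2 * l))) =
    c * expR (- s * ln e) * (1 - expR (- (s / 2 * l))) by ring.
have sl0 : 0 <= s / 2 * l by rewrite mulr_ge0// divr_ge0.
have c0 : 0 <= c * expR (- s * ln e) by rewrite mulr_ge0// expR_ge0.
apply/andP; split.
  by rewrite mulr_ge0// subr_ge0 expR_le1 oppr_le0.
apply: (@le_trans _ _ (c * expR (- s * ln e) * (s / 2 * l))).
  rewrite ler_wpM2l//; have := expR_ge1Dx (- (s / 2 * l)); lra.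
apply: (@le_trans _ _ (c * expR (- s * ln e) * (s / 2 * ((1 + 2 / tau) * u `^ tau)))).
  by rewrite ler_wpM2l// ler_wpM2l// divr_ge0.
rewrite uE opprD powRD; last by rewrite (gt_eqF e0) implybT.
have -> : e `^ (- s) = expR (- s * ln e) by rewrite /powR gt_eqF.
by rewrite le_eqVlt; apply/orP; left; apply/eqP; ring.
Qed.

Let Cab : R := 1 + 2 / b / a.

Let Cab_ge0 : 0 <= Cab.
Proof. by rewrite addr_ge0// !divr_ge0// ltW. Qed.

Let hmom (x : rvec R d) : R := expR (a * enorm x `^ b).

Let ln_enorm_le (x : rvec R d) : ln (1 + sqnorm x) <= Cab * hmom x.
Proof. by rewrite -enorm_sq; apply: ln_one_sqr_exp => //; exact: enorm_ge0. Qed.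

Let ln_sqnorm_vsub (x y : rvec R d) :
  ln (1 + sqnorm (vsub x y)) <= 1 + Cab * hmom x + Cab * hmom y.
Proof.
have le2 : sqnorm (vsub x y) <= 2 * sqnorm x + 2 * sqnorm y.
  rewrite /sqnorm !mulr_sumr -big_split/=; apply: ler_sum => i _.
  rewrite tnth_mktuple; have := sqr_ge0 ((tnth x i : R) + tnth y i).
  by rewrite sqrrD sqrrB; lra.
apply: le_trans (ln_one_add_le (sqnorm_ge0 x) (sqnorm_ge0 y) (sqnorm_ge0 _) le2) _.
by rewrite !lerD.
Qed.

Let HH (x : rvec R d) : R := if s == 0 then cd * Cab * hmom x else 0.
Let c2 : R := if s == 0 then cd * (1 + p^-1) else c.
Let VV (x y : rvec R d) : R := c2 * (1 + enorm (vsub x y) `^ (- p)).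

Let c2_ge0 : 0 <= c2.
Proof.
by rewrite /c2; case: ifP => // _; rewrite mulr_ge0 ?(ltW hcd)// addr_ge0// invr_ge0 ltW.
Qed.

Let HH_ge0 x : 0 <= HH x.
Proof. by rewrite /HH; case: ifP => // _; rewrite !mulr_ge0 ?expR_ge0 ?(ltW hcd). Qed.

Let VV_ge0 x y : 0 <= VV x y.
Proof. by rewrite mulr_ge0// addr_ge0// powR_ge0. Qed.

Let paircut_le x y : `|paircut g x y| <= HH x + HH y + VV x y.
Proof.
rewrite /paircut; have [_|xy] := eqVneq x y; first by rewrite normr0 !addr_ge0.
rewrite hg; have e0 : 0 < enorm (vsub x y) by apply: enorm_vsub_gt0; rewrite eq_sym.
rewrite /riesz /HH /VV /c2 -/c; set e := enorm (vsub x y) in e0 *.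
have P0 : 0 <= e `^ (- p) by exact: powR_ge0.
case: eqP => [s0|_].
  apply: (log_norm_le hcd p0 e0 Cab_ge0); rewrite ?expR_ge0//.
  by have := ln_sqnorm_vsub x y; rewrite -enorm_sq.
rewrite !add0r normrM (ger0_norm c_ge0) ler_wpM2l// ger0_norm ?powR_ge0//.
have [e1|e1] := leP 1 e.
  apply: (@le_trans _ _ 1); last by rewrite lerDl.
  by rewrite -(powRr0 e) ler_powR// oppr_le0.
apply: (@le_trans _ _ (e `^ (- p))); last by rewrite lerDr.
apply: ger_powR; first by rewrite e0 ltW.
by rewrite lerN2 /p; move: tau0 hs0; lra.
Qed.

Section fixed_class.
Variables (L M : R).
Hypothesis L0 : 0 <= L.
Variable f : density (phase_measure R Whole d).
Hypothesis hf : dens_class s a b L M f.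
Let P : probability (phase R d) R := density_prob f.

Let B := 1 + L * singular_bound d p.

Let mhmom : measurable_fun setT hmom.
Proof.
apply: measurableT_comp => //; apply: measurable_funM => //.
apply: (measurableT_comp (f := fun r : R => r `^ b)); first exact: measurable_powR.
exact: measurable_enorm.
Qed.

Let hmom_int : s = 0 -> (\int[P]_w (hmom w.1)%:E <= M%:E)%E.
Proof.
move=> s0; have [_ /(_ s0)] := hf; apply: le_trans.
rewrite ge0_integral_mweight//.
- by apply/measurable_EFinP; exact: measurableT_comp.
- by move=> x; rewrite lee_fin expR_ge0.
Qed.

Let hmom_integ : s = 0 -> integ P (fun w => hmom w.1).
Proof.
move=> s0; apply: ge0_integ (hmom_int s0) => [|w]; last exact: expR_ge0.
exact: measurableT_comp.
Qed.

Let power_int x : (\int[P]_w (enorm (vsub x w.1) `^ (- p))%:E <= B%:E)%E.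
Proof. by apply: integral_power_le => //; [case: hf|exact: ltW]. Qed.

Let mpw (x : rvec R d) :
  measurable_fun setT (fun y => enorm (vsub x y) `^ (- p)).
Proof.
apply: (measurableT_comp (f := fun r : R => r `^ (- p))); first exact: measurable_powR.
by apply: measurableT_comp; [exact: measurable_enorm|exact: measurable_vsubl].
Qed.

Lemma whole_summable :
  summable_interaction g f (2 * `|cd * Cab * M| + c2 * (1 + B)).
Proof.
apply: (@summable_of_bound _ _ _ _ _ HH VV).
- by rewrite /HH; case: (s == 0) => //; exact: measurable_funM.
- exact: HH_ge0.
- rewrite /HH; case: eqP => [s0|_].
    under eq_integral do rewrite EFinM.
    have k0 : 0 <= cd * Cab by rewrite mulr_ge0// ltW.
    rewrite ge0_integralZl; [|exact: measurableT|
      by apply/measurable_EFinP; exact: measurableT_comp|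
      by move=> z _; rewrite lee_fin expR_ge0|by rewrite lee_fin].
    apply: (@le_trans _ _ ((cd * Cab)%:E * M%:E)%E).
      by rewrite lee_wpmul2l ?lee_fin//; exact: hmom_int.
    by rewrite -EFinM lee_fin ler_norm.
  by rewrite integral0 lee_fin.
- by move=> x; apply: measurable_funM => //; exact: measurable_funD.
- exact: VV_ge0.
- by move=> x y; rewrite /VV enorm_vsubC.
- move=> x; rewrite /VV; under eq_integral do rewrite EFinM.
  have mE : measurable_fun setT (fun w : phase R d => enorm (vsub x w.1) `^ (- p)).
    by apply: (measurableT_comp (mpw x)); exact: measurable_fst.
  rewrite ge0_integralZl; [|exact: measurableT|
    by apply/measurable_EFinP; exact: measurable_funD|
    by move=> z _; rewrite lee_fin addr_ge0// powR_ge0|by rewrite lee_fin].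
  rewrite EFinM lee_wpmul2l ?lee_fin//.
  under eq_integral do rewrite EFinD.
  rewrite ge0_integralD//; [|by move=> w _; rewrite lee_fin powR_ge0|exact/measurable_EFinP].
  rewrite EFinD leeD//; last exact: power_int.
  by have := Rint_EFin (integ_cst P 1) => /= <-; rewrite Rint_cst.
exact: paircut_le.
Qed.

Let mreg delta : measurable_fun setT (riesz_reg delta).
Proof.
have ms : measurable_fun setT (fun x => delta ^+ 2 + @sqnorm R d x).
  by apply: measurable_funD => //; exact: measurable_sqnorm.
rewrite /riesz_reg; case: (s == 0); apply: measurable_funM => //.
  by apply: measurableT_comp => //; exact: measurable_ln.
by apply: (measurableT_comp (f := fun r : R => r `^ (- (s / 2)))).
Qed.

Let A delta (z w : phase R d) := riesz_reg delta (vsub z.1 w.1).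

(** The regularised logarithm is unbounded, but it is the limit of positive definite
   functions of the walk from which diverging constants are subtracted, and the
   energy does not see constants. *)
Let A_energy delta N t : 0 < delta -> (0 < N)%N -> size t = N ->
  0 <= energy P (A delta) N t.
Proof.
move=> dl0 N0 tN; have dl2 : 0 < delta ^+ 2 by exact: exprn_gt0.
have mX : measurable_fun setT (fst : phase R d -> rvec R d) by exact: measurable_fst.
rewrite /A /riesz_reg; have [s0|sn0] := eqVneq s 0; last first.
  have pF : posdef (fun x : rvec R d => c * (delta ^+ 2 + sqnorm x) `^ (- (s / 2))).
    by apply: posdefZ => //; apply: posdef_pow => //; rewrite divr_ge0.
  exact: (energy_posdef_ge0 P mX pF N0 tN).
have cd2 : 0 <= cd / 2 by rewrite divr_ge0// ltW.
pose F n (x : rvec R d) := cd / 2 * (ln (@walk_max R d (delta ^+ 2) n) - ln (delta ^+ 2 + walk n x)).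
have pF n : posdef (F n) by apply: posdefZ => //; exact: posdef_log_walk.
pose K n (z w : phase R d) := F n (vsub z.1 w.1) + - (cd / 2 * ln (@walk_max R d (delta ^+ 2) n)).
have kc (r : R) : kernel P (fun _ _ : phase R d => r) by apply: (@kernel_bdd _ _ _ _ _ `|r|).
have kF n := kernel_posdef P mX (pF n).
have KE n z w : K n z w = - (cd / 2) * ln (delta ^+ 2 + walk n (vsub z.1 w.1)).
  by rewrite /K /F; ring.
have kK n : kernel P (K n) by exact: kernelD.
have eK n : 0 <= energy P (K n) N t.
  rewrite /K (energyD N t (kF n) (kc _)).
  by rewrite energy_cst// addr0; exact: energy_posdef_ge0.
pose c3 := `|ln (delta ^+ 2)| + ln (1 + delta ^+ 2) + 1.
pose u (z : phase R d) := cd / 2 * (c3 / 2 + Cab * hmom z.1).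
have iu : integ P u.
  apply: integZ; apply: integD; first exact: integ_cst.
  by apply: integZ; exact: hmom_integ.
apply: (cvg_ge0 eK); apply: (energy_lim kK (kernel_sum iu)).
  move=> n z w; rewrite KE normrM normrN (ger0_norm cd2) /u -mulrDr ler_wpM2l//.
  apply: le_trans (ln_shift_le dl2 (walk_ge0 n _) (walk_le n _)) _.
  have := ln_sqnorm_vsub z.1 w.1; rewrite /c3.
  move: (ln (1 + sqnorm _)) (hmom _) (hmom _) => l h1 h2; lra.
move=> z w; rewrite (_ : (fun n => K n z w) =
    fun n => - (cd / 2) * ln (delta ^+ 2 + walk n (vsub z.1 w.1))); last exact/funext.
apply: cvgM; first exact: cvg_cst.
apply: cvg_contlim.
  by apply: continuous_ln; rewrite ltr_pwDl// sqnorm_ge0.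
by apply: cvgD; [exact: cvg_cst|exact: cvg_walk].
Qed.

Let pairkerE (z w : phase R d) : w.1 != z.1 -> pairker g z w = riesz s cd (vsub z.1 w.1).
Proof.
move=> zw; rewrite /pairker /paircut (negbTE zw) eq_sym (negbTE zw) !hg.
rewrite /riesz (enorm_vsubC w.1 z.1).
by move: (enorm _) => e; case: (s == 0); field.
Qed.

(** The square of the remainder is at most [delta^(2 tau)] times [|x|^-p] with
   [p = 2 (s + tau) < d]: its integral is finite uniformly in the first argument,
   and small with [delta]. *)
Lemma whole_regularisation (eps delta : R) : 0 < eps -> 0 < delta ->
  C1 * Num.sqrt B * delta `^ tau <= eps ->
  exists A, regularisation g f eps (riesz_reg delta rvec0) A.
Proof.
move=> eps0 dl0 small; exists (A delta).
have B0 : 0 <= B.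
  rewrite addr_ge0// mulr_ge0// /singular_bound divr_ge0 ?exprn_ge0//.
  rewrite subr_ge0 ler_pdivrMr ?exprn_gt0// mul1r -powR_mulrn//.
  by rewrite ler_powR ?ler1n// ltW.
have rb z : \forall w \ae P, 0 <= pairker g z w - A delta z w <=
    C1 * (delta `^ tau * enorm (vsub z.1 w.1) `^ (- (s + tau))).
  have [rL _] := hf; apply: filterS (ae_neq_position rL L0 z.1 d0) => w zw.
  by rewrite pairkerE//; apply: riesz_rem_bound => //; exact: enorm_vsub_gt0.
have mA : measurable_fun setT (fun q : phase R d * phase R d => A delta q.1 q.2).
  exact: (measurable_diffker (measurable_fst : measurable_fun setT (fst : phase R d -> rvec R d)) (mreg delta)).
split.
- by split => // z; rewrite /A vsubxx.
- by move=> z w; rewrite /A /riesz_reg sqnorm_vsubC.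
- by move=> N t N0 tN; exact: A_energy.
- move=> z; apply: filterS (rb z) => w /andP[h _]; apply: le_trans h.
  by rewrite oppr_le0 ltW.
move=> z.
have [kl kr kla kra _] := whole_summable.
have [mp _ _ _] := kernel_pairker kl kr kla kra.
pose k2 := (C1 * delta `^ tau) ^+ 2.
have k20 : 0 <= k2 by exact: sqr_ge0.
apply: (@le_trans _ _ (\int[P]_w (k2%:E * (enorm (vsub z.1 w.1) `^ (- p))%:E))%E).
  apply: ae_ge0_le_integral => //.
  - by move=> w _; rewrite lee_fin sqr_ge0.
  - apply/measurable_EFinP; apply: measurable_funX; apply: measurable_funB.
      exact: (measurableT_comp mp (pair1_measurable z)).
    exact: (measurableT_comp mA (pair1_measurable z)).
  - by move=> w _; rewrite mule_ge0// lee_fin ?powR_ge0.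
  - apply: measurable_funeM; apply/measurable_EFinP.
    by apply: (measurableT_comp (mpw z.1)); exact: measurable_fst.
  apply: filterS (rb z) => w /andP[h0 h1] _; rewrite -EFinM lee_fin.
  have -> : k2 * enorm (vsub z.1 w.1) `^ (- p) =
      (C1 * (delta `^ tau * enorm (vsub z.1 w.1) `^ (- (s + tau)))) ^+ 2.
    have -> : enorm (vsub z.1 w.1) `^ (- p) = (enorm (vsub z.1 w.1) `^ (- (s + tau))) ^+ 2.
      rewrite -[RHS]powR_mulrn ?powR_ge0// -powRrM /p; congr (_ `^ _).
      by rewrite mulNr mulrC.
    by rewrite /k2 -exprMn mulrA.
  by rewrite lerXn2r// nnegrE// (le_trans h0).
rewrite ge0_integralZl; [|exact: measurableT|
  by apply/measurable_EFinP; apply: (measurableT_comp (mpw z.1)); exact: measurable_fst|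
  by move=> w _; rewrite lee_fin powR_ge0|by rewrite lee_fin].
apply: (@le_trans _ _ (k2%:E * B%:E)%E).
  by rewrite lee_wpmul2l ?lee_fin//; exact: power_int.
rewrite -EFinM lee_fin -[B](sqr_sqrtr B0) /k2 -exprMn mulrAC.
have n0 : 0 <= C1 * Num.sqrt B * delta `^ tau.
  apply: mulr_ge0; last exact: powR_ge0.
  by apply: mulr_ge0; [exact: C1_ge0|exact: sqrtr_ge0].
by rewrite lerXn2r ?nnegrE ?(ltW eps0).
Qed.

End fixed_class.

Lemma controlled_whole L M : 0 <= L ->
  controlled g (dens_class (D := Whole) (d := d) s a b L M).
Proof.
move=> L0; split.
  by eexists => f hf; exact: (whole_summable L0 hf).
move=> eps eps0.
pose Y := C1 * Num.sqrt (1 + L * singular_bound d p) + 1.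
have Y0 : 0 < Y by rewrite ltr_wpDl// mulr_ge0// sqrtr_ge0.
pose delta := (eps / Y) `^ tau^-1.
have ey : 0 < eps / Y by exact: divr_gt0.
have dl0 : 0 < delta by exact: powR_gt0.
have dE : delta `^ tau = eps / Y.
  by rewrite /delta -powRrM mulVf ?gt_eqF// powRr1// ltW.
exists (riesz_reg delta rvec0) => f hf.
apply: (whole_regularisation L0 hf eps0 dl0).
rewrite dE mulrA ler_pdivrMr// mulrC ler_wpM2l ?(ltW eps0)//.
by rewrite /Y lerDl.
Qed.

End whole_space.

(** * Invariance of integrals over the periodic cell *)

Section lebesgue_reflection.
Context {R : realType}.
Notation leb := (@lebesgue_measure R).
Variable a : R.

Let refl (y : measurableTypeR R) : measurableTypeR R := (a - y : R).

Let mrefl : measurable_fun setT refl.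
Proof. by apply: (@measurable_funB _ (measurableTypeR R) R). Qed.

Lemma lebesgue_measure_reflect (A : set (measurableTypeR R)) : measurable A ->
  leb [set y | A (a - y)] = leb A.
Proof.
move=> mA; rewrite -[LHS]/(pushforward leb refl A).
apply/esym.
pose m := measure_function_pushforward__canonical__measure_function_Measure leb mrefl.
apply: (@lebesgue_measure_unique R m _ A mA) => _ [[x y]] _ <-; rewrite /m /=.
rewrite /pushforward.
have -> : refl @^-1` `]x, y]%classic = `[(a - y), (a - x)[%classic.
  by apply/seteqP; split => z /=; rewrite /refl !in_itv/= => /andP[h1 h2]; apply/andP; split; lra.
rewrite !lebesgue_measure_itv/= !lte_fin.
have -> : (a - y < a - x) = (x < y) by apply/idP/idP; lra.
by case: ifP => // _; rewrite -!EFinD; congr (_%:E); ring.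
Qed.

End lebesgue_reflection.

Section cell_measure.
Context {R : realType}.
Notation leb := (@lebesgue_measure R).
Notation cell1 := (@leb_side R Torus).

Let cell1_setT : cell1 setT = 1%E.
Proof.
rewrite /leb_side /mrestr setTI /= lebesgue_measure_itv/= lte_fin.
have -> : (- 2^-1 < 2^-1 :> R) by lra.
by rewrite -EFinD; congr (_%:E); lra.
Qed.

HB.instance Definition _ := Measure_isProbability.Build _ _ _ cell1 cell1_setT.

Section wrap.
Variable a : R.
Hypothesis a01 : 0 <= a < 1.

(** [a - y] brought back to the cell: both pieces of the cell, cut at [a - 1/2],
   are reflected onto themselves. *)
Let wrap (y : measurableTypeR R) : measurableTypeR R :=
  if y <= a - 2^-1 then (a - 1 - y : R) else (a - y : R).

Let mwrap : measurable_fun setT wrap.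
Proof.
apply: measurable_fun_ifT.
- apply: (@measurable_fun_ler _ (measurableTypeR R) R) => //.
- by apply: (@measurable_funB _ (measurableTypeR R) R).
- by apply: (@measurable_funB _ (measurableTypeR R) R).
Qed.

Let cell1_wrap (B : set (measurableTypeR R)) : measurable B ->
  pushforward cell1 wrap B = cell1 B.
Proof.
move=> mB; rewrite /pushforward /leb_side /mrestr.
pose A1 : set (measurableTypeR R) := `[(- 2^-1), (a - 2^-1)]%classic.
pose A2 : set (measurableTypeR R) := `](a - 2^-1), (2^-1)[%classic.
have mA1 : measurable A1 by exact: measurable_itv.
have mA2 : measurable A2 by exact: measurable_itv.
have cE : @side R Torus = A1 `|` A2.
  apply/seteqP; split => y; rewrite /A1 /A2 /= !in_itv/=.
    move=> /andP[h1 h2]; have [h|h] := leP y (a - 2^-1); [left|right];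
      by apply/andP; split; lra.
  by have /andP[a0 a1] := a01; move=> [|] /andP[h1 h2]; apply/andP; split; lra.
have dis : A1 `&` A2 = set0.
  by apply/seteqP; split => y //; rewrite /A1 /A2 /= !in_itv/= => -[/andP[_ h1] /andP[h2 _]];
    rewrite ltNge h1 in h2.
have split2 (C : set (measurableTypeR R)) : measurable C ->
    leb (C `&` side Torus) = (leb (C `&` A1) + leb (C `&` A2))%E.
  move=> mC; rewrite cE setIUr measureU//.
  - exact: measurableI.
  - exact: measurableI.
  by rewrite setIACA dis setI0.
have mwB : measurable (wrap @^-1` B) by rewrite -[X in measurable X]setTI; exact: mwrap.
rewrite !split2//; congr (_ + _)%E.
- rewrite -(lebesgue_measure_reflect (a - 1) (measurableI _ _ mB mA1)); congr (leb _).
  apply/seteqP; split => y; rewrite /A1 /wrap /= !in_itv/= => -[h /andP[h1 h2]].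
    by move: h; rewrite h2; split => //; apply/andP; split; lra.
  have h3 : (y : R) <= a - 2^-1 by lra.
  by rewrite h3; split => //; apply/andP; split => //; lra.
- rewrite -(lebesgue_measure_reflect a (measurableI _ _ mB mA2)); congr (leb _).
  apply/seteqP; split => y; rewrite /A2 /wrap /= !in_itv/= => -[h /andP[h1 h2]].
    by move: h; rewrite leNgt h1; split => //; apply/andP; split; lra.
  have h3 : a - 2^-1 < (y : R) by lra.
  by rewrite leNgt h3; split => //; apply/andP; split => //; lra.
Qed.

Lemma ge0_integral_cell1_wrap (f : measurableTypeR R -> \bar R) :
  measurable_fun setT f -> (forall x, 0 <= f x)%E ->
  (forall (x : R) (k : int), f (x + k%:~R)%R = f x) ->
  (\int[cell1]_x f (a - x)%R = \int[cell1]_x f x)%E.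
Proof.
move=> mf f0 per.
transitivity (\int[pushforward cell1 wrap]_x f x)%E.
  rewrite (ge0_integral_pushforward mwrap)//.
  rewrite preimage_setT; apply: eq_integral => x _ /=.
  rewrite /wrap; case: ifP => // _.
  rewrite -(per (a - 1 - x) 1) mulr1z; congr f.
  by move: (x : R) => r; ring.
pose m := measure_function_pushforward__canonical__measure_function_Measure cell1 mwrap.
apply: (@eq_measure_integral _ _ R setT cell1 m f) => B mB _.
exact: cell1_wrap.
Qed.

End wrap.

Lemma ge0_integral_cell1_reflect (a : R) (f : measurableTypeR R -> \bar R) :
  measurable_fun setT f -> (forall x, 0 <= f x)%E ->
  (forall (x : R) (k : int), f (x + k%:~R)%R = f x) ->
  (\int[cell1]_x f (a - x)%R = \int[cell1]_x f x)%E.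
Proof.
move=> mf f0 per.
have h : 0 <= a - (Num.floor a)%:~R < 1.
  have := floor_le a; have := floorD1_gt a; rewrite intrD mulr1z => h1 h2.
  by apply/andP; split; lra.
rewrite -(ge0_integral_cell1_wrap h mf f0 per).
apply: eq_integral => x _; rewrite -(per (a - _ - x) (Num.floor a)); congr f.
by move: (x : R) => r; ring.
Qed.

Definition cell d : probability (rvec R d) R := mpow cell1 d.

Definition vcons d (x : rvec R d) (z : measurableTypeR R) : rvec R d.+1 := tuple_cons (x, z).

Lemma tnth_vcons0 d (x : rvec R d) z : tnth (vcons x z) ord0 = z.
Proof. by rewrite tnth0. Qed.

Lemma tnth_vconsS d (x : rvec R d) z i : tnth (vcons x z) (lift ord0 i) = tnth x i.
Proof. by rewrite tnthS. Qed.

Lemma vsub_vcons d (x y : rvec R d) (a z : R) :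
  vsub (vcons x a) (vcons y z) = vcons (vsub x y) (a - z).
Proof.
apply: eq_from_tnth => i; rewrite tnth_mktuple.
have [j ->|->] := unliftP ord0 i; last by rewrite !tnth_vcons0.
by rewrite !tnth_vconsS tnth_mktuple.
Qed.

Lemma vaddz_vcons d (x : rvec R d) (a : R) (k : d.-tuple int) (m : int) :
  vaddz (vcons x a) [tuple of m :: k] = vcons (vaddz x k) (a + m%:~R).
Proof.
apply: eq_from_tnth => i; rewrite tnth_mktuple.
have [j ->|->] := unliftP ord0 i; last by rewrite !tnth_vcons0 tnth0.
by rewrite !tnth_vconsS tnth_mktuple tnthS.
Qed.

Lemma vaddz0 d (x : rvec R d) : vaddz x [tuple (0 : int) | i < d] = x.
Proof. by apply: eq_from_tnth => i; rewrite !tnth_mktuple addr0. Qed.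

(** One coordinate at a time, by periodicity. *)
Lemma ge0_integral_cell_reflect d (x : rvec R d) (phi : rvec R d -> \bar R) :
  measurable_fun setT phi -> (forall y, 0 <= phi y)%E ->
  (forall y k, phi (vaddz y k) = phi y) ->
  (\int[cell d]_y phi (vsub x y) = \int[cell d]_y phi y)%E.
Proof.
elim: d x phi => [|d IH] x phi mphi phi0 per.
  by apply: eq_integral => y _; congr phi; apply: eq_from_tnth => -[].
have mphi' : measurable_fun setT (fun y => phi (vsub x y)).
  exact: (measurableT_comp mphi (measurable_vsubl x)).
rewrite (ge0_integral_mpowS cell1 mphi' (fun y => phi0 _)) (ge0_integral_mpowS cell1 mphi phi0).
pose a := thead x; pose xt : rvec R d := [tuple of behead x].
have xE : x = vcons xt a by rewrite {1}(tuple_eta x); apply: val_inj.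
pose Phi t := (\int[cell1]_z phi (vcons t z))%E.
transitivity (\int[cell d]_t Phi (vsub xt t))%E.
  apply: eq_integral => t _; rewrite /Phi.
  rewrite -(@ge0_integral_cell1_reflect a (fun z => phi (vcons (vsub xt t) z)))//.
  - by apply: eq_integral => z _; rewrite -/(vcons t z) -vsub_vcons -xE.
  - have mc := measurableT_comp mphi (@measurable_tuple_cons _ (measurableTypeR R) d).
    exact: (measurableT_comp mc (pair1_measurable (vsub xt t))).
  - move=> z k; rewrite -[in RHS](per _ [tuple of k :: [tuple (0 : int) | i < d]]).
    by rewrite vaddz_vcons vaddz0.
apply: IH.
- exact: measurable_integral_tuple_cons.
- by move=> t; apply: integral_ge0.
- move=> t k; apply: eq_integral => z _.
  rewrite -[in RHS](per _ [tuple of (0 : int) :: k]) vaddz_vcons.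
  by rewrite mulr0z addr0.
Qed.

Lemma ge0_integral_cell_shift d (x : rvec R d) (phi : rvec R d -> \bar R) :
  measurable_fun setT phi -> (forall y, 0 <= phi y)%E ->
  (forall y k, phi (vaddz y k) = phi y) ->
  (\int[cell d]_y phi (vsub y x) = \int[cell d]_y phi y)%E.
Proof.
move=> mphi phi0 per.
pose psi y := phi (vsub rvec0 y).
have mpsi : measurable_fun setT psi by exact: (measurableT_comp mphi (measurable_vsubl _)).
have -> : (\int[cell d]_y phi (vsub y x) = \int[cell d]_y psi (vsub x y))%E.
  apply: eq_integral => y _; congr phi; apply: eq_from_tnth => i.
  by rewrite !tnth_mktuple; ring.
have psi0 y : (0 <= psi y)%E by exact: phi0.
rewrite ge0_integral_cell_reflect//; first exact: ge0_integral_cell_reflect.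
move=> y k; rewrite /psi -(per (vsub rvec0 y) [tuple - tnth k i | i < d]).
congr phi; apply: eq_from_tnth => i; rewrite !tnth_mktuple mulrNz; ring.
Qed.

End cell_measure.

(** * Trigonometric polynomials *)

Section trigonometric.
Context {R : realType} {d : nat}.
Notation freq := (d.-tuple int).
Implicit Types (k m : freq) (x y : rvec R d).

Definition freq0 : freq := [tuple (0 : int) | i < d].
Definition freqN k : freq := [tuple - tnth k i | i < d].
Definition freqD k m : freq := [tuple tnth k i + tnth m i | i < d].

Lemma freqNK : involutive freqN.
Proof. by move=> k; apply: eq_from_tnth => i; rewrite !tnth_mktuple opprK. Qed.

Lemma freqN0 : freqN freq0 = freq0.
Proof. by apply: eq_from_tnth => i; rewrite !tnth_mktuple oppr0. Qed.

Lemma freqD_eq0 k m : (freqD k m == freq0) = (k == freqN m).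
Proof.
apply/eqP/eqP => [h|->]; apply: eq_from_tnth => i; rewrite !tnth_mktuple ?addNr//.
by have := congr1 (fun t => tnth t i) h; rewrite /= !tnth_mktuple => /eqP; rewrite addr_eq0 => /eqP.
Qed.

Lemma phase_angle0 x : phase_angle freq0 x = 0.
Proof. by rewrite /phase_angle big1 ?mulr0// => i _; rewrite tnth_mktuple mul0r. Qed.

Lemma phase_angleN k x : phase_angle (freqN k) x = - phase_angle k x.
Proof.
rewrite /phase_angle -mulrN -sumrN; congr (_ * _); apply: eq_bigr => i _.
by rewrite tnth_mktuple mulrNz mulNr.
Qed.

Lemma phase_angleD k m x : phase_angle (freqD k m) x = phase_angle k x + phase_angle m x.
Proof.
rewrite /phase_angle -mulrDr -big_split/=; congr (_ * _); apply: eq_bigr => i _.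
by rewrite tnth_mktuple intrD mulrDl.
Qed.

Lemma phase_angle_vsub k x y : phase_angle k (vsub x y) = phase_angle k x - phase_angle k y.
Proof.
rewrite /phase_angle -mulrBr -sumrB; congr (_ * _); apply: eq_bigr => i _.
by rewrite tnth_mktuple mulrBr.
Qed.

Lemma phase_angle_vaddz k m x : phase_angle k (vaddz x m) =
  phase_angle k x + (2 * pi) *~ (\sum_(i < d) tnth k i * tnth m i).
Proof.
rewrite /phase_angle -[X in _ + X]mulrzr -mulrDr; congr (_ * _).
rewrite rmorph_sum/= -big_split/=; apply: eq_bigr => i _.
by rewrite tnth_mktuple mulrDr intrM.
Qed.

Lemma measurable_phase_angle k : measurable_fun setT (@phase_angle R d k).
Proof.
apply: measurable_funM => //; apply: measurable_sum => i.
by apply: measurable_funM => //; exact: measurable_tnth_rvec.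
Qed.

Lemma periodic_int (f : R -> R) (T : R) : periodic f T -> forall (n : int) t, f (t + T *~ n) = f t.
Proof.
move=> fT [n|n] t; first exact: periodicn.
by rewrite NegzE mulrNz -(periodicn fT n.+1) addrNK.
Qed.

Lemma cos_angle_vaddz k m x : cos (phase_angle k (vaddz x m)) = cos (phase_angle k x).
Proof. by rewrite phase_angle_vaddz mulr_natl (periodic_int (@cosD2pi R)). Qed.

Lemma sin_angle_vaddz k m x : sin (phase_angle k (vaddz x m)) = sin (phase_angle k x).
Proof. by rewrite phase_angle_vaddz mulr_natl (periodic_int (@sinD2pi R)). Qed.

Lemma Rint_cell_reflect x (phi : rvec R d -> R) (M : R) :
  measurable_fun setT phi -> (forall y, `|phi y| <= M) ->
  (forall y k, phi (vaddz y k) = phi y) ->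
  \int[cell d]_y phi (vsub x y) = \int[cell d]_y phi y.
Proof.
move=> mphi phiM per.
have mr : measurable_fun setT (fun y => phi (vsub x y)).
  exact: (measurableT_comp mphi (measurable_vsubl x)).
have i1 : integ (cell d) phi := integ_bdd (cell d) mphi phiM.
have i2 : integ (cell d) (fun y => phi (vsub x y)) by apply: (integ_bdd (cell d) (M := M) mr).
have iM := integ_cst (cell d) M.
apply: (addIr (\int[cell d]_y M)); rewrite -!RintD//.
have p0 y : (0 <= (phi y + M)%:E)%E.
  by rewrite lee_fin; have := phiM y; rewrite ler_norml => /andP[h _]; lra.
have h := @ge0_integral_cell_reflect R d x (fun y => (phi y + M)%:E).
by rewrite /Rintegral h// => [|y k]; [apply/measurable_EFinP; exact: measurable_funD|rewrite per].
Qed.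

Lemma measurable_cos_angle k : measurable_fun setT (fun x => cos (phase_angle k x)).
Proof.
apply: (measurableT_comp _ (measurable_phase_angle k)).
exact: (continuous_measurable_fun (@continuous_cos R)).
Qed.

Lemma measurable_sin_angle k : measurable_fun setT (fun x => sin (phase_angle k x)).
Proof.
apply: (measurableT_comp _ (measurable_phase_angle k)).
exact: (continuous_measurable_fun (@continuous_sin R)).
Qed.

Lemma cos_norm_le1 (t : R) : `|cos t| <= 1.
Proof. by rewrite ler_norml cos_geN1 cos_le1. Qed.

Lemma sin_norm_le1 (t : R) : `|sin t| <= 1.
Proof. by rewrite ler_norml sin_geN1 sin_le1. Qed.

Lemma integ_cos k : integ (cell d) (fun x => cos (phase_angle k x)).
Proof. exact: (integ_bdd (cell d) (measurable_cos_angle k) (fun x => cos_norm_le1 _)). Qed.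

Lemma integ_sin k : integ (cell d) (fun x => sin (phase_angle k x)).
Proof. exact: (integ_bdd (cell d) (measurable_sin_angle k) (fun x => sin_norm_le1 _)). Qed.

Lemma Rint_sin k : \int[cell d]_x sin (phase_angle k (x : rvec R d)) = 0.
Proof.
have h := Rint_cell_reflect rvec0 (measurable_sin_angle k) (fun x => sin_norm_le1 _)
  (fun x m => sin_angle_vaddz k m x).
have e x : sin (phase_angle k (vsub rvec0 x)) = - sin (phase_angle k x).
  rewrite phase_angle_vsub (_ : phase_angle k rvec0 = 0) ?sub0r ?sinN//.
  by rewrite /phase_angle big1 ?mulr0// => i _; rewrite tnth_mktuple mulr0.
move: h; under eq_Rintegral do rewrite e.
by rewrite RintN => h; lra.
Qed.

(** A reflection that shifts the phase by half a period turns [cos] into its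
   opposite. *)
Lemma Rint_cos k : \int[cell d]_x cos (phase_angle k (x : rvec R d)) = (k == freq0)%:R.
Proof.
have [->|k0] := eqVneq k freq0.
  under eq_Rintegral do rewrite phase_angle0 cos0.
  exact: Rint_cst.
have [i ki] : exists i, tnth k i != 0.
  apply/existsP; rewrite -negb_forall; apply: contra k0 => /forallP h.
  by apply/eqP/eq_from_tnth => i; rewrite tnth_mktuple; exact/eqP.
have ki' : (tnth k i)%:~R != 0 :> R by rewrite intr_eq0.
(* A displacement whose phase is [pi]. *)
pose x0 : rvec R d := [tuple (if j == i then (2 * (tnth k i)%:~R)^-1 else 0 : R) | j < d].
have p0 : phase_angle k x0 = pi.
  rewrite /phase_angle (bigD1 i)//= big1 => [|j ji].
    by rewrite tnth_mktuple eqxx addr0; field.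
  by rewrite tnth_mktuple (negbTE ji) mulr0.
have h := Rint_cell_reflect x0 (measurable_cos_angle k) (fun x => cos_norm_le1 _)
  (fun x m => cos_angle_vaddz k m x).
have e x : cos (phase_angle k (vsub x0 x)) = - cos (phase_angle k x).
  by rewrite phase_angle_vsub p0 cosB cospi sinpi; ring.
move: h; under eq_Rintegral do rewrite e.
by rewrite RintN mulr0n => h; lra.
Qed.

(** Trigonometric polynomials, as lists of a frequency with the coefficients of
   its cosine and of its sine. *)
Definition teval (l : seq (freq * (R * R))) x : R :=
  \sum_(t <- l) (t.2.1 * cos (phase_angle t.1 x) + t.2.2 * sin (phase_angle t.1 x)).

Definition trig (p : rvec R d -> R) := exists l, p =1 teval l.

Lemma trigD p q : trig p -> trig q -> trig (fun x => p x + q x).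
Proof. by move=> [l pl] [m qm]; exists (l ++ m) => x; rewrite /teval big_cat/= pl qm. Qed.

Lemma trigZ (c : R) p : trig p -> trig (fun x => c * p x).
Proof.
move=> [l pl]; exists [seq (t.1, (c * t.2.1, c * t.2.2)) | t <- l] => x.
rewrite pl /teval big_map mulr_sumr; apply: eq_bigr => t _ /=.
by rewrite mulrDr !mulrA.
Qed.

Lemma trig_ext p q : trig p -> p =1 q -> trig q.
Proof. by move=> [l pl] pq; exists l => x; rewrite -pq. Qed.

Lemma trig_cos k : trig (fun x => cos (phase_angle k x)).
Proof. by exists [:: (k, (1, 0))] => x; rewrite /teval big_seq1/= mul1r mul0r addr0. Qed.

Lemma trig_sin k : trig (fun x => sin (phase_angle k x)).
Proof. by exists [:: (k, (0, 1))] => x; rewrite /teval big_seq1/= mul1r mul0r add0r. Qed.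

Lemma trig_cst (c : R) : trig (fun=> c).
Proof.
apply: (trig_ext (trigZ c (trig_cos freq0))) => x.
by rewrite phase_angle0 cos0 mulr1.
Qed.

Lemma trig_sum (I : Type) (s : seq I) (F : I -> rvec R d -> R) :
  (forall i, trig (F i)) -> trig (fun x => \sum_(i <- s) F i x).
Proof.
move=> tF; elim: s => [|i s IH].
  by apply: (trig_ext (trig_cst 0)) => x; rewrite big_nil.
by apply: (trig_ext (trigD (tF i) IH)) => x; rewrite big_cons.
Qed.

Lemma trigM p q : trig p -> trig q -> trig (fun x => p x * q x).
Proof.
move=> [l pl] [m qm].
apply: (@trig_ext (fun x => \sum_(t <- l) \sum_(u <- m)
   (t.2.1 * cos (phase_angle t.1 x) + t.2.2 * sin (phase_angle t.1 x)) *
   (u.2.1 * cos (phase_angle u.1 x) + u.2.2 * sin (phase_angle u.1 x)))); last first.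
  move=> x; rewrite pl qm /teval mulr_suml; apply: eq_bigr => t _.
  by rewrite mulr_sumr.
apply: trig_sum => -[k [a b]]; apply: trig_sum => -[h [c e]] /=.
apply: (trig_ext (trigD
  (trigD (trigZ ((a * c - b * e) / 2) (trig_cos (freqD k h)))
         (trigZ ((a * c + b * e) / 2) (trig_cos (freqD k (freqN h)))))
  (trigD (trigZ ((a * e + b * c) / 2) (trig_sin (freqD k h)))
         (trigZ ((b * c - a * e) / 2) (trig_sin (freqD k (freqN h))))))) => x /=.
rewrite !phase_angleD phase_angleN.
move: (phase_angle k x) (phase_angle h x) => u v.
by rewrite !cosD !sinD cosN sinN; field.
Qed.

Lemma trigX p n : trig p -> trig (fun x => p x ^+ n).
Proof.
move=> tp; elim: n => [|n IH].
  by apply: (trig_ext (trig_cst 1)) => x; rewrite expr0.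
by apply: (trig_ext (trigM tp IH)) => x; rewrite exprS.
Qed.

Lemma measurable_teval l : measurable_fun setT (teval l).
Proof.
apply: measurable_sum => t; apply: measurable_funD; apply: measurable_funM => //.
  exact: measurable_cos_angle.
exact: measurable_sin_angle.
Qed.

Lemma teval_bounded l : exists M, forall x, `|teval l x| <= M.
Proof.
exists (\sum_(t <- l) (`|t.2.1| + `|t.2.2|)) => x.
apply: le_trans (ler_norm_sum _ _ _) _; apply: ler_sum => t _.
apply: le_trans (ler_normD _ _) _; rewrite !normrM.
by apply: lerD; rewrite ler_piMr// ?cos_norm_le1 ?sin_norm_le1.
Qed.

Lemma trig_measurable p : trig p -> measurable_fun setT p.
Proof. by move=> [l pl]; rewrite (funext pl); exact: measurable_teval. Qed.

Lemma trig_bounded p : trig p -> exists M, forall x, `|p x| <= M.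
Proof. by move=> [l pl]; rewrite (funext pl); exact: teval_bounded. Qed.

Definition fourier (phi : rvec R d -> R) (m : freq -> R) :=
  integ (cell d) phi /\ forall k,
    \int[cell d]_x (phi x * cos (phase_angle k x)) = m k /\
    \int[cell d]_x (phi x * sin (phase_angle k x)) = 0.

Lemma integM_bdd (phi p : rvec R d -> R) (M : R) : integ (cell d) phi ->
  measurable_fun setT p -> (forall x, `|p x| <= M) ->
  integ (cell d) (fun x => phi x * p x).
Proof.
move=> ip mp pM; apply: (integ_dom _ _ (integZ M (integ_norm ip))).
  by apply: measurable_funM => //; exact: (integ_measurable ip).
by move=> x; rewrite normrM mulrC ler_wpM2r.
Qed.

Lemma integM_trig phi p : integ (cell d) phi -> trig p ->
  integ (cell d) (fun x => phi x * p x).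
Proof.
move=> ip tp; have [M pM] := trig_bounded tp.
exact: (integM_bdd ip (trig_measurable tp) pM).
Qed.

(** Against a trigonometric polynomial a function is only seen through its
   Fourier coefficients. *)
Lemma fourier_teval phi (m : freq -> R) l : fourier phi m ->
  \int[cell d]_x (phi x * teval l x) = \sum_(t <- l) t.2.1 * m t.1.
Proof.
move=> [ip hm].
have ic k : integ (cell d) (fun x => phi x * cos (phase_angle k x)).
  exact: integM_trig (trig_cos k).
have is' k : integ (cell d) (fun x => phi x * sin (phase_angle k x)).
  exact: integM_trig (trig_sin k).
have E x : phi x * teval l x = \sum_(t <- l)
    (t.2.1 * (phi x * cos (phase_angle t.1 x)) + t.2.2 * (phi x * sin (phase_angle t.1 x))).
  by rewrite mulr_sumr; apply: eq_bigr => t _; ring.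
under eq_Rintegral do rewrite E.
rewrite Rint_sum => [|t]; last by apply: integD; exact: integZ.
apply: eq_bigr => t _; rewrite RintD; [|exact: integZ|exact: integZ].
by rewrite !RintZ// (hm t.1).1 (hm t.1).2 mulr0 addr0.
Qed.

Lemma fourierB phi psi (m n : freq -> R) : fourier phi m -> fourier psi n ->
  fourier (fun x => phi x - psi x) (fun k => m k - n k).
Proof.
move=> [ip hm] [iq hn]; split; first exact: integB.
move=> k; have [mc ms] := hm k; have [nc ns] := hn k.
split; under eq_Rintegral do rewrite mulrBl.
  by rewrite RintB ?mc ?nc//; exact: integM_trig (trig_cos k).
by rewrite RintB ?ms ?ns ?subr0//; exact: integM_trig (trig_sin k).
Qed.

Definition cosum (K : seq freq) (c : freq -> R) x : R :=
  \sum_(k <- K) c k * cos (phase_angle k x).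

Lemma cosum_teval K c x : cosum K c x = teval [seq (k, (c k, 0)) | k <- K] x.
Proof. by rewrite /teval big_map; apply: eq_bigr => k _ /=; rewrite mul0r addr0. Qed.

Lemma trig_cosum K c : trig (cosum K c).
Proof. by eexists => x; exact: cosum_teval. Qed.

Lemma integ_trig p : trig p -> integ (cell d) p.
Proof.
by move=> tp; have [M pM] := trig_bounded tp; exact: (integ_bdd (cell d) (trig_measurable tp) pM).
Qed.

Lemma sum_pick K (c : freq -> R) m : uniq K ->
  \sum_(k <- K) c k * (k == m)%:R = if m \in K then c m else 0.
Proof.
move=> uK; case: ifPn => mK.
  rewrite (bigD1_seq m)//= eqxx mulr1 big1 ?addr0// => k /negbTE ->.
  by rewrite mulr0.
rewrite big1_seq// => k /andP[_ kK]; case: eqP => [km|]; rewrite ?mulr0//.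
by rewrite -km kK in mK.
Qed.

(** Orthogonality of the cosines. The frequencies [k] and [- k] carry the same
   cosine, so that each mode collects half of its coefficient from either. *)
Lemma fourier_cosum K c : uniq K -> (forall k, (freqN k \in K) = (k \in K)) ->
  (forall k, c (freqN k) = c k) ->
  fourier (cosum K c) (fun k => if k \in K then c k else 0).
Proof.
move=> uK sK cN; split; first exact: integ_trig (trig_cosum _ _).
move=> m; split.
  have E x : cosum K c x * cos (phase_angle m x) = \sum_(k <- K)
      (c k / 2 * (cos (phase_angle (freqD k m) x) + cos (phase_angle (freqD k (freqN m)) x))).
    rewrite mulr_suml; apply: eq_bigr => k _.
    rewrite !phase_angleD phase_angleN; move: (phase_angle k x) (phase_angle m x) => u v.
    by rewrite !cosD cosN sinN; field.
  under eq_Rintegral do rewrite E.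
  rewrite Rint_sum => [|k]; last by apply: integZ; apply: integD; exact: integ_cos.
  under eq_bigr => k _.
    rewrite RintZ; last by apply: integD; exact: integ_cos.
    rewrite RintD; [|exact: integ_cos|exact: integ_cos].
    rewrite !Rint_cos !freqD_eq0 freqNK mulrDr.
    over.
  rewrite big_split/= !(@sum_pick _ (fun k => c k / 2))// sK.
  by case: ifP => _; rewrite ?cN ?addr0//; field.
have E x : cosum K c x * sin (phase_angle m x) = \sum_(k <- K)
    (c k / 2 * (sin (phase_angle (freqD k m) x) - sin (phase_angle (freqD k (freqN m)) x))).
  rewrite mulr_suml; apply: eq_bigr => k _.
  rewrite !phase_angleD phase_angleN; move: (phase_angle k x) (phase_angle m x) => u v.
  by rewrite !sinD cosN sinN; field.
under eq_Rintegral do rewrite E.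
rewrite Rint_sum => [|k]; last by apply: integZ; apply: integB; exact: integ_sin.
rewrite big1// => k _; rewrite RintZ; last by apply: integB; exact: integ_sin.
by rewrite RintB ?Rint_sin ?subrr ?mulr0//; exact: integ_sin.
Qed.

Definition freq_vec k : rvec R d := [tuple (2 * pi * (tnth k i)%:~R : R) | i < d].

Lemma dot_freq_vec y k : dot y (freq_vec k) = phase_angle k y.
Proof.
rewrite /dot /phase_angle mulr_sumr; apply: eq_bigr => i _.
by rewrite tnth_mktuple; ring.
Qed.

(** For a cosine of phase [y] the sum is the mean of the values of the polynomial at
   [y] and at [- y]. *)
Lemma posdef_teval_ge0 F l : posdef F -> (forall x, 0 <= teval l x) ->
  0 <= \sum_(t <- l) t.2.1 * F (freq_vec t.1).
Proof.
move=> pF l0; elim: pF => [w y w0|F1 F2 _ h1 _ h2|F_ F1 _ h FF].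
- have -> : \sum_(t <- l) t.2.1 * (w * cos (dot y (freq_vec t.1))) =
      w / 2 * (teval l y + teval l (vsub rvec0 y)).
    rewrite /teval -big_split mulr_sumr/=; apply: eq_bigr => t _.
    have -> : phase_angle t.1 (vsub rvec0 y) = - phase_angle t.1 y.
      rewrite phase_angle_vsub (_ : phase_angle t.1 rvec0 = 0) ?sub0r//.
      by rewrite /phase_angle big1 ?mulr0// => i _; rewrite tnth_mktuple mulr0.
    by rewrite dot_freq_vec cosN sinN; field.
  by rewrite mulr_ge0 ?divr_ge0// addr_ge0.
- by under eq_bigr do rewrite mulrDr; rewrite big_split/= addr_ge0.
apply: (cvg_ge0 h); apply: cvg_seq_sum => t.
by apply: cvgM; [exact: cvg_cst|exact: FF].
Qed.

End trigonometric.

(** * Approximation by trigonometric polynomials in the unit interval *)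

Section threshold.
Context {R : realType}.

Lemma bernoulli_le (x : R) m : 0 <= x <= 1 -> 1 - m%:R * x <= (1 - x) ^+ m.
Proof.
move=> /andP[x0 x1]; elim: m => [|m IH]; first by rewrite mul0r subr0 expr0.
rewrite exprSr; have h : (1 - m%:R * x) * (1 - x) <= (1 - x) ^+ m * (1 - x).
  by rewrite ler_wpM2r// subr_ge0.
apply: le_trans h.
have : 0 <= m%:R * (x * x) by rewrite !mulr_ge0.
by rewrite -natr1; lra.
Qed.

Lemma cvg_expr_nat (r : R) : 0 <= r < 1 -> (n%:R * r ^+ n) @[n --> \oo] --> 0.
Proof.
move=> /andP[r0 r1]; pose q := Num.sqrt r.
have q0 : 0 <= q by exact: sqrtr_ge0.
have q1 : q < 1 by rewrite -sqrtr1 ltr_sqrt.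
have bq n : n%:R * q ^+ n <= (1 - q)^-1.
  have h : n%:R * q ^+ n <= \sum_(i < n) q ^+ i.
    rewrite mulr_natl -[X in _ *+ X]card_ord -sumr_const; apply: ler_sum => i _.
    by rewrite ler_wiXn2l// ?ltW// ltnW.
  apply: le_trans h _; rewrite -[leRHS]mul1r ler_pdivlMr ?subr_gt0//.
  have := subrX1 q n; have := exprn_ge0 n q0.
  by move: (\sum_(i < n) q ^+ i) (q ^+ n) => S t; lra.
apply: (@cvg_err _ _ (fun n => (1 - q)^-1 * q ^+ n)).
  move=> n; rewrite subr0 ger0_norm ?mulr_ge0// ?exprn_ge0//.
  have -> : r ^+ n = q ^+ n * q ^+ n by rewrite -exprMn -expr2 sqr_sqrtr.
  by rewrite mulrA ler_wpM2r// exprn_ge0.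
rewrite -(mulr0 (1 - q)^-1); apply: cvgM; first exact: cvg_cst.
by apply: cvg_expr; rewrite ger0_norm.
Qed.

(** The exponents are those of the elementary proof of the Stone-Weierstrass theorem:
   [(1 - w^n)^(n 2^n)] is at least [1 - n (2 w)^n] and at most [exp (- n (2 w)^n)]. *)
Lemma cvg_threshold (w : R) : 0 <= w <= 1 ->
  ((1 - w ^+ n) ^+ (n * 2 ^ n)) @[n --> \oo] --> ((w < 2^-1)%R%:R : R).
Proof.
move=> /andP[w0 w1].
have wn n : 0 <= w ^+ n <= 1 by rewrite exprn_ge0//= exprn_ile1.
have mE n : (n * 2 ^ n)%:R * w ^+ n = n%:R * (2 * w) ^+ n :> R.
  by rewrite natrM natrX exprMn mulrA.
have [wh|wh] := ltP w 2^-1.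
  apply: (@cvg_err _ _ (fun n => n%:R * (2 * w) ^+ n)); last first.
    by apply: cvg_expr_nat; apply/andP; split; lra.
  move=> n; have /andP[a0 a1] := wn n.
  have := bernoulli_le (n * 2 ^ n) (wn n); rewrite mE => h.
  have h1 : (1 - w ^+ n) ^+ (n * 2 ^ n) <= 1 by rewrite exprn_ile1//; lra.
  by rewrite /= distrC ger0_norm ?subr_ge0//; lra.
apply: (@cvg_err _ _ (fun n => expR (-1) ^+ n)); last first.
  by apply: cvg_expr; rewrite ger0_norm ?expR_ge0// expR_lt1; lra.
move=> n; have /andP[a0 a1] := wn n.
rewrite subr0 ger0_norm ?exprn_ge0 ?subr_ge0//.
apply: (@le_trans _ _ (expR (- w ^+ n) ^+ (n * 2 ^ n))).
  rewrite lerXn2r ?nnegrE ?expR_ge0 ?subr_ge0//.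
  exact: expR_ge1Dx.
rewrite -!expRM_natl ler_expR mulrN mE mulrN1 lerN2.
rewrite -[leLHS]mulr1 ler_wpM2l// exprn_ege1//; lra.
Qed.

End threshold.

Section density.
Context {R : realType} {d : nat}.
Implicit Types (x y : rvec R d) (f p q : rvec R d -> R) (A : set (rvec R d)).
Variable h : rvec R d -> R.
Hypotheses (hi : integ (cell d) h) (h0 : forall x, 0 <= h x).

Let mh : measurable_fun setT h. Proof. exact: (integ_measurable hi). Qed.

Definition unit_valued f := forall x, 0 <= f x <= 1.

(** Weighted L1 limits of trigonometric polynomials with values in [[0, 1]]. *)
Definition approximable f := [/\ measurable_fun setT f, unit_valued f &
  forall e : R, 0 < e -> exists q, [/\ trig q, unit_valued q &
    \int[cell d]_x (`|f x - q x| * h x) <= e]].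

Let dist_le1 f g x : unit_valued f -> unit_valued g -> `|f x - g x| <= 1.
Proof.
move=> /(_ x)/andP[f0 f1] /(_ x)/andP[g0 g1]; rewrite ler_norml; apply/andP; split; lra.
Qed.

Let integ_dist f g : measurable_fun setT f -> measurable_fun setT g ->
  unit_valued f -> unit_valued g -> integ (cell d) (fun x => `|f x - g x| * h x).
Proof.
move=> mf mg uf ug; apply: (integ_dom _ _ hi).
  by apply: measurable_funM => //; apply: measurableT_comp => //; exact: measurable_funB.
by move=> x; rewrite normrM normr_id (ger0_norm (h0 x)) ler_piMl// dist_le1.
Qed.

Lemma approximable_trig q : trig q -> unit_valued q -> approximable q.
Proof.
move=> tq uq; split => //; first exact: trig_measurable.
move=> e e0; exists q; split => //.
under eq_Rintegral do rewrite subrr normr0 mul0r.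
by rewrite Rint_cst ltW.
Qed.

Lemma approximableC f : approximable f -> approximable (fun x => 1 - f x).
Proof.
move=> [mf uf fe]; split; first exact: measurable_funB.
  by move=> x; have /andP[? ?] := uf x; apply/andP; split; lra.
move=> e e0; have [q [tq uq qe]] := fe e e0; exists (fun x => 1 - q x); split.
- apply: (trig_ext (trigD (trig_cst 1) (trigZ (-1) tq))) => x; ring.
- by move=> x; have /andP[? ?] := uq x; apply/andP; split; lra.
apply: le_trans qe; rewrite le_eqVlt; apply/orP; left; apply/eqP.
by apply: eq_Rintegral => x _; rewrite distrC; congr (`|_| * _); ring.
Qed.

Lemma approximableM f g : approximable f -> approximable g ->
  approximable (fun x => f x * g x).
Proof.
move=> [mf uf fe] [mg ug ge].
have uM (a b : rvec R d -> R) : unit_valued a -> unit_valued b -> unit_valued (fun x => a x * b x).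
  move=> ua ub x; have /andP[? ?] := ua x; have /andP[? ?] := ub x.
  by rewrite mulr_ge0//= mulr_ile1.
split; [exact: measurable_funM|exact: uM|].
move=> e e0; have e2 : 0 < e / 2 by rewrite divr_gt0.
have [p [tp up pe]] := fe _ e2; have [q [tq uq qe]] := ge _ e2.
exists (fun x => p x * q x); split; [exact: trigM|exact: uM|].
have mp := trig_measurable tp; have mq := trig_measurable tq.
apply: (@le_trans _ _ (\int[cell d]_x (`|f x - p x| * h x + `|g x - q x| * h x))).
  apply: Rint_le.
  - by apply: integ_dist; [exact: measurable_funM|exact: measurable_funM|exact: uM|exact: uM].
  - by apply: integD; exact: integ_dist.
  move=> x; rewrite -mulrDl ler_wpM2r//.
  have -> : f x * g x - p x * q x = (f x - p x) * g x + p x * (g x - q x) by ring.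
  apply: le_trans (ler_normD _ _) _; rewrite !normrM.
  have /andP[p0 p1] := up x; have /andP[g0 g1] := ug x.
  rewrite (ger0_norm p0) (ger0_norm g0).
  by apply: lerD; [rewrite ler_piMr|rewrite ler_piMl].
rewrite RintD; [|exact: integ_dist|exact: integ_dist].
by rewrite [leRHS](splitr e) lerD.
Qed.

Lemma approximable_lim (f_ : nat -> rvec R d -> R) f :
  (forall n, approximable (f_ n)) ->
  (forall x, f_ n x @[n --> \oo] --> f x) -> approximable f.
Proof.
move=> af ff.
have mf_ n : measurable_fun setT (f_ n) by have [] := af n.
have uf_ n : unit_valued (f_ n) by have [] := af n.
have mf : measurable_fun setT f by apply: (measurable_fun_cvg mf_) => x _; exact: ff.
have uf : unit_valued f.
  move=> x; apply/andP; split.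
    by apply: cvg_ge0 (ff x) => n; have /andP[] := uf_ n x.
  by apply: cvg_lerr (ff x) => n; have /andP[] := uf_ n x.
split => // e e0.
pose D n x := `|f x - f_ n x| * h x.
have mD n : measurable_fun setT (D n).
  by apply: measurable_funM => //; apply: measurableT_comp => //; exact: measurable_funB.
have cD x : D n x @[n --> \oo] --> 0.
  rewrite -(mul0r (h x)); apply: cvgM; last exact: cvg_cst.
  rewrite -(normr0 R); apply: cvg_norm; rewrite -(subrr (f x)).
  by apply: cvgB; [exact: cvg_cst|exact: ff].
have Dh n x : `|D n x| <= h x.
  by rewrite normrM normr_id (ger0_norm (h0 x)) ler_piMl// dist_le1.
have [_] := Rint_dominated mD cD Dh hi.
rewrite Rint_cst => /cvgr0Pnorm_le /(_ (e / 2)) []; first by rewrite divr_gt0.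
move=> n _ /(_ n (leqnn n)) /= hn.
have [_ _ fe] := af n; have [q [tq uq qe]] := fe (e / 2) (divr_gt0 e0 (ltr0n _ 2)).
exists q; split => //; have mq := trig_measurable tq.
apply: (@le_trans _ _ (\int[cell d]_x (`|f x - f_ n x| * h x + `|f_ n x - q x| * h x))).
  apply: Rint_le; [exact: integ_dist|by apply: integD; exact: integ_dist|].
  by move=> x; rewrite -mulrDl ler_wpM2r// ler_distD.
rewrite RintD; [|exact: integ_dist|exact: integ_dist].
rewrite [leRHS](splitr e) lerD//.
exact: le_trans (ler_norm _) hn.
Qed.

Lemma approximable_ae f g : approximable f -> measurable_fun setT g -> unit_valued g ->
  (\forall x \ae cell d, f x = g x) -> approximable g.
Proof.
move=> [mf uf fe] mg ug fg; split => // e e0.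
have [q [tq uq qe]] := fe e e0; exists q; split => //.
have mq := trig_measurable tq.
apply: le_trans qe; rewrite le_eqVlt; apply/orP; left; apply/eqP.
rewrite /Rintegral; congr fine; apply: ae_eq_integral => //.
- exact: (measurable_int _ (integ_dist mg mq ug uq)).
- exact: (measurable_int _ (integ_dist mf mq uf uq)).
by apply: filterS fg => x -> _.
Qed.

Lemma approximable_X f n : approximable f -> approximable (fun x => f x ^+ n).
Proof.
move=> af; elim: n => [|n IH].
  apply: approximable_trig; last by move=> x; rewrite expr0 ler01 lexx.
  by apply: (trig_ext (trig_cst 1)) => x; rewrite expr0.
by under eq_fun do rewrite exprS; exact: approximableM.
Qed.

Definition approximable_set A := approximable (\1_A).

(** Up to an affine change of [p], the set is [w < 1/2] with [w] between 0 and 1. *)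
Lemma approximable_pos p : trig p -> approximable_set [set x | 0 < p x].
Proof.
move=> tp; have [M pM] := trig_bounded tp.
pose M1 := `|M| + 1; have M0 : 0 < M1 by rewrite ltr_wpDl.
pose w x := 2^-1 * (1 - M1^-1 * p x).
have tw : trig w.
  apply: (trig_ext (trigZ (2^-1) (trigD (trig_cst 1) (trigZ (- M1^-1) tp)))) => x.
  by rewrite /w; ring.
have uw : unit_valued w.
  move=> x; have : `|M1^-1 * p x| <= 1.
    rewrite normrM gtr0_norm ?invr_gt0// mulrC ler_pdivrMr// mul1r.
    by apply: le_trans (pM x) _; have := ler_norm M; rewrite /M1; lra.
  by rewrite ler_norml /w => /andP[? ?]; apply/andP; split; lra.
have wE x : (0 < p x) = (w x < 2^-1).
  rewrite -[RHS]subr_lt0 (_ : w x - _ = - (2^-1 * M1^-1 * p x)); last by rewrite /w; ring.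
  by rewrite oppr_lt0 pmulr_rgt0// mulr_gt0 ?invr_gt0.
apply: (@approximable_lim (fun n x => (1 - w x ^+ n) ^+ (n * 2 ^ n))).
  move=> n; apply: approximable_X; apply: approximableC; apply: approximable_X.
  exact: approximable_trig.
move=> x; rewrite indicE (_ : (x \in _) = (w x < 2^-1)); first exact: cvg_threshold.
by apply/idP/idP; rewrite inE /= wE.
Qed.

Lemma approximable_setC A : approximable_set A -> approximable_set (~` A).
Proof.
move=> aA; have := approximableC aA; rewrite /approximable_set.
rewrite (_ : \1_(~` A) = (fun x => 1 - \1_A x))//.
by apply/funext => x; rewrite indicC indicE; case: (x \in A); rewrite /= ?subrr ?subr0.
Qed.

Lemma approximable_setI A B : approximable_set A -> approximable_set B ->
  approximable_set (A `&` B).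
Proof. by move=> aA aB; rewrite /approximable_set indicI; exact: approximableM. Qed.

Lemma approximable_set_bigcup (F : nat -> set (rvec R d)) :
  (forall n, approximable_set (F n)) -> approximable_set (\bigcup_n F n).
Proof.
move=> aF.
apply: (@approximable_lim (fun n => \1_(~` (\big[setI/setT]_(i < n) (~` F i))))).
  move=> n; apply: approximable_setC.
  elim: n => [|n IH].
    rewrite big_ord0; apply: approximable_trig.
      by apply: (trig_ext (trig_cst 1)) => x; rewrite indicT.
    by move=> x; rewrite indicT ler01 lexx.
  by rewrite big_ord_recr/=; apply: approximable_setI => //; exact: approximable_setC.
move=> x; have [[n _ Fn]|nF] := pselect ((\bigcup_n F n) x).
  apply: cvg_near_cst; exists n.+1 => // m /= nm.
  rewrite !indicE !mem_set//; first by exists n.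
  rewrite -(bigcap_mkord m (fun i => ~` F i)) => hm; exact: (hm n nm).
apply: cvg_near_cst; exists 0%N => // m _.
rewrite !indicE [in RHS]memNset// memNset//=.
by apply; rewrite -(bigcap_mkord m (fun i => ~` F i)) => i _ Fi; apply: nF; exists i.
Qed.

End density.

(** * Completeness of the trigonometric system *)

Section density_full.
Context {R : realType} {d : nat}.
Implicit Types (x y : rvec R d) (f p q : rvec R d -> R) (A B : set (rvec R d)).

Lemma sin_2pi_gt0 (t : R) : 0 < t -> t < 2^-1 -> 0 < sin (2 * pi * t).
Proof.
move=> t0 t1; apply: sin_gt0_pi; have p0 := pi_gt0 R.
by apply/andP; split; [rewrite !mulr_gt0|rewrite mulrAC -[ltRHS]mul1r ltr_pM2r//; lra].
Qed.

Lemma sin_2pi_le0 (t : R) : - 2^-1 <= t -> t <= 0 -> sin (2 * pi * t) <= 0.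
Proof.
move=> t0 t1; have p0 := pi_gt0 R.
rewrite -oppr_ge0 -sinN -mulrN; apply: sin_ge0_pi; apply/andP; split.
  by rewrite !mulr_ge0 ?oppr_ge0// ltW.
by rewrite mulrAC -[leRHS]mul1r ler_pM2r//; lra.
Qed.

Lemma cos_2pi_gtN1 (t : R) : - 2^-1 < t -> t < 2^-1 -> 0 < 1 + cos (2 * pi * t).
Proof.
move=> t0 t1; have p0 := pi_gt0 R.
have -> : 2 * pi * t = pi * t + pi * t by ring.
have := cos2Dsin2 (pi * t); rewrite cosD -!expr2 => h.
have c0 : 0 < cos (pi * t).
  apply: cos_gt0_pihalf; apply/andP; split.
    by rewrite -mulrN ltr_pM2l//; lra.
  by rewrite ltr_pM2l//; lra.
have : 0 < cos (pi * t) ^+ 2 by rewrite exprn_gt0.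
lra.
Qed.

Definition unit_freq (i : 'I_d) : d.-tuple int := [tuple (if j == i then 1 else 0 : int) | j < d].

Lemma phase_angle_unit i x : phase_angle (unit_freq i) x = 2 * pi * tnth x i.
Proof.
rewrite /phase_angle (bigD1 i)//= big1 => [|j ji].
  by rewrite tnth_mktuple eqxx mulr1z mul1r addr0.
by rewrite tnth_mktuple (negbTE ji) mulr0z mul0r.
Qed.

Lemma trig_sin_coord i (c : R) : trig (fun x => sin (2 * pi * (tnth x i - c))).
Proof.
apply: (trig_ext (trigD (trigZ (cos (2 * pi * c)) (trig_sin (unit_freq i)))
   (trigZ (- sin (2 * pi * c)) (trig_cos (unit_freq i))))) => x.
by rewrite phase_angle_unit mulrBr sinB; ring.
Qed.

Lemma trig_cos_coord i : trig (fun x => 1 + cos (2 * pi * tnth x i)).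
Proof.
apply: (trig_ext (trigD (trig_cst 1) (trig_cos (unit_freq i)))) => x.
by rewrite phase_angle_unit.
Qed.

Lemma ae_cell_coord (i : 'I_d) : \forall x \ae cell d, - 2^-1 <= (tnth x i : R) < 2^-1.
Proof.
pose u : measurableTypeR R -> R := \1_(~` side Torus).
have mu_ : measurable_fun setT u.
  by apply: measurable_indic; apply: measurableC; exact: (@measurable_side R Torus).
have u0 : (\int[@leb_side R Torus]_z (u z)%:E = 0)%E.
  rewrite integral_indic//= ?setIT.
    by rewrite /leb_side /mrestr setICl measure0.
  by apply: measurableC; exact: (@measurable_side R Torus).
have I0 n (j : 'I_n) : (\int[cell n]_x (u (tnth x j))%:E = 0)%E.
  elim: n j => [[]//|n IH] j.
  have mE (k : 'I_n.+1) : measurable_fun setT (fun x : rvec R n.+1 => (u (tnth x k))%:E).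
    by apply/measurable_EFinP; exact: (measurableT_comp mu_ (measurable_tnth k)).
  have uE0 (k : 'I_n.+1) (x : rvec R n.+1) : (0 <= (u (tnth x k))%:E)%E by rewrite lee_fin.
  rewrite (ge0_integral_mpowS (@leb_side R Torus) (mE j) (uE0 j)).
  have [j' ->|->] := unliftP ord0 j.
    rewrite -[RHS](IH j'); apply: eq_integral => t _.
    transitivity (\int[@leb_side R Torus]_z cst (u (tnth t j'))%:E z)%E.
      by apply: eq_integral => z _; rewrite tnthS.
    rewrite integral_cst// [X in (_ * X)%E](_ : _ = 1%E) ?mule1//.
    exact: (probability_setT (@leb_side R Torus)).
  under eq_integral => t _.
    under eq_integral do rewrite tnth0.
    rewrite u0; over.
  by rewrite integral0.
have mE : measurable_fun setT (fun x : rvec R d => (u (tnth x i))%:E).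
  by apply/measurable_EFinP; exact: (measurableT_comp mu_ (measurable_tnth i)).
have : ae_eq (cell d) setT (fun x => (u (tnth x i))%:E) (cst 0%E).
  apply/(ae_eq_integral_abs (cell d) measurableT mE).
  rewrite -[RHS](I0 d i); apply: eq_integral => x _.
  by rewrite gee0_abs// lee_fin.
apply: filterS => x /(_ I) []; rewrite /u indicE.
have [/[!inE] xs|/negP] := boolP (tnth x i \in ~` side Torus).
  by move=> /eqP; rewrite oner_eq0.
move=> xs _; apply: contrapT => h; apply: xs; rewrite inE /= => hx; apply: h.
by move: hx; rewrite in_itv.
Qed.

Section weight.
Variable h : rvec R d -> R.
Hypotheses (hi : integ (cell d) h) (h0 : forall x, 0 <= h x).
Notation approx := (approximable_set h).

Let pos p : trig p -> approx [set x | 0 < p x].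
Proof. exact: approximable_pos. Qed.

Let setC A : approx A -> approx (~` A).
Proof. exact: approximable_setC. Qed.

Let setI A B : approx A -> approx B -> approx (A `&` B).
Proof. exact: approximable_setI. Qed.

Let setU A B : approx A -> approx B -> approx (A `|` B).
Proof.
by move=> aA aB; rewrite -[_ `|` _]setCK setCU; apply: setC; apply: setI; exact: setC.
Qed.

Let setTh : approx setT.
Proof.
apply: approximable_trig; last by move=> x; rewrite indicT ler01 lexx.
by apply: (trig_ext (trig_cst 1)) => x; rewrite indicT.
Qed.

Let cell_ae i A B : approx A -> measurable B ->
  (forall x, - 2^-1 <= (tnth x i : R) -> (tnth x i : R) < 2^-1 -> A x <-> B x) -> approx B.
Proof.
move=> aA mB AB; apply: (approximable_ae hi h0 aA).
- exact: measurable_indic.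
- by move=> x; rewrite indicE; case: (_ \in _); rewrite /= ?ler01 ?lexx.
have := ae_cell_coord i; apply: (@filterS _ _ (ae_filter_ringOfSetsType (cell d))) => x /andP[x1 x2].
rewrite !indicE; congr (_%:R); congr nat_of_bool.
by apply/idP/idP; rewrite !inE; have [? ?] := AB x x1 x2.
Qed.

(** On the cell a ray in the [i]-th coordinate is described by the signs of
   [sin (2 pi x_i)] and of [sin (2 pi (x_i - c))]. *)
Lemma approximable_ray i (c : R) : approx [set x | c < (tnth x i : R)].
Proof.
have mB : measurable [set x : rvec R d | c < (tnth x i : R)].
  rewrite -[X in measurable X]setTI.
  have -> : [set x : rvec R d | c < (tnth x i : R)] = (fun x => tnth x i) @^-1` `]c, +oo[%classic.
    by apply/seteqP; split => x /=; rewrite in_itv/= andbT.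
  by apply: (measurable_tnth i) => //; exact: measurable_itv.
have [c1|c1] := ltP c (- 2^-1).
  by apply: (cell_ae (i := i) setTh mB) => x x1 x2; split => //= _; lra.
have [c2|c2] := leP 2^-1 c.
  apply: (cell_ae (i := i) (setC setTh) mB) => x x1 x2; split => /=; first by move=> [].
  by move=> ?; exfalso; lra.
have [c3|c3] := eqVneq c (- 2^-1).
  apply: (cell_ae (i := i) (pos (trig_cos_coord i)) mB) => x x1 x2; rewrite c3 /=; split => hc.
    rewrite lt_neqAle x1 andbT; apply/eqP => e; move: hc; rewrite -e.
    have -> : 2 * pi * - 2^-1 = - pi :> R by field.
    by rewrite cosN cospi subrr ltxx.
  exact: cos_2pi_gtN1.
have c4 : - 2^-1 < c by rewrite lt_neqAle eq_sym c3.
have s0 (x : rvec R d) : sin (2 * pi * (tnth x i - 0)) = sin (2 * pi * tnth x i) by rewrite subr0.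
have [c5|c5] := ltP c 0.
  apply: (cell_ae (i := i) (setU (pos (trig_sin_coord i 0)) (pos (trig_sin_coord i c))) mB)
    => x x1 x2 /=; rewrite s0; split.
    move=> [] hc; rewrite ltNge; apply/negP => xc.
      have := sin_2pi_le0 x1 (ltW (le_lt_trans xc c5)); lra.
    have : sin (2 * pi * (tnth x i - c)) <= 0 by apply: sin_2pi_le0; lra.
    by rewrite leNgt hc.
  move=> xc; have [x0|x0] := ltP 0 (tnth x i : R); [left|right].
    exact: sin_2pi_gt0.
  by apply: sin_2pi_gt0; lra.
apply: (cell_ae (i := i) (setI (pos (trig_sin_coord i 0)) (pos (trig_sin_coord i c))) mB)
    => x x1 x2 /=; rewrite s0; split.
  move=> [h1 h2]; rewrite ltNge; apply/negP => xc.
  have x0 : 0 < (tnth x i : R).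
    rewrite ltNge; apply/negP => x0; have := sin_2pi_le0 x1 x0; lra.
  have : sin (2 * pi * (tnth x i - c)) <= 0 by apply: sin_2pi_le0; lra.
  by rewrite leNgt h2.
by move=> xc; split; apply: sin_2pi_gt0; lra.
Qed.

Lemma approximable_coord i (B : set (measurableTypeR R)) : measurable B ->
  approx ((fun x => tnth x i) @^-1` B).
Proof.
rewrite RGenOInfty.measurableE => mB.
apply: (@smallest_sub _ _ _ [set C | approx ((fun x => tnth x i) @^-1` C)] _ _ B mB); last first.
  move=> _ [c ->] /=; have := approximable_ray i c; congr (approx _).
  by apply/seteqP; split => x /=; rewrite in_itv/= andbT.
split.
- by rewrite /= preimage_set0 -setCT; exact: setC.
- by move=> A aA; rewrite setTD preimage_setC; exact: setC.
- by move=> F aF; rewrite /= preimage_bigcup; exact: approximable_set_bigcup.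
Qed.

(** The approximable sets form a sigma-algebra that contains the rays: this is the
   completeness of the trigonometric system. *)
Lemma approximable_measurable A : measurable A -> approx A.
Proof.
apply: smallest_sub.
  split.
  - by rewrite -setCT; exact: setC.
  - by move=> B aB; rewrite setTD; exact: setC.
  - by move=> F aF; exact: approximable_set_bigcup.
elim/big_ind: _ => [//|S1 S2 h1 h2|i _]; first by rewrite subUset.
by move=> _ [B mB <-]; rewrite setTI; exact: approximable_coord.
Qed.

End weight.
End density_full.

(** * Inequalities tested on trigonometric polynomials *)

Section duality.
Import HBNNSimple.
Context {R : realType} {d : nat}.
Implicit Types (x : rvec R d) (f p q : rvec R d -> R) (A B : set (rvec R d)).
Variable u : rvec R d -> R.
Hypothesis ui : integ (cell d) u.

Let mu : measurable_fun setT u. Proof. exact: (integ_measurable ui). Qed.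

Let unit_bound q : unit_valued q -> forall x, `|q x| <= 1.
Proof. by move=> uq x; have /andP[q0 q1] := uq x; rewrite ger0_norm. Qed.

(** The indicator of [u < 0] is a limit of admissible test functions. *)
Lemma negpart_of_trig :
  (forall q, trig q -> unit_valued q -> 0 <= \int[cell d]_x (u x * q x)) ->
  (\int[cell d]_x (maxr (- u x) 0)%:E = 0)%E.
Proof.
move=> uq; pose E := [set x | u x < 0].
have mE : measurable E.
  rewrite -[X in measurable X]setTI.
  have -> : E = u @^-1` `]-oo, 0[%classic by apply/seteqP; split => x /=; rewrite in_itv.
  by apply: mu => //; exact: measurable_itv.
have mI : measurable_fun setT (\1_E : rvec R d -> R) by exact: measurable_indic.
have uI : unit_valued (\1_E : rvec R d -> R).
  by move=> x; rewrite indicE; case: (_ \in _); rewrite /= ?ler01 ?lexx.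
have iuE := integM_bdd ui mI (unit_bound uI).
have uE : 0 <= \int[cell d]_x (u x * \1_E x).
  apply/ler_addgt0Pr => e e0.
  have h0 x : 0 <= `|u x| by [].
  have [_ _ /(_ e e0) [q [tq vq qe]]] := approximable_measurable (integ_norm ui) h0 mE.
  have iq := integM_trig ui tq.
  apply: le_trans (uq q tq vq) _; rewrite -lerBlDl -RintB//.
  apply: le_trans qe; apply: Rint_le; first exact: integB.
    apply: (integ_dom _ _ (integ_norm ui)).
      apply: measurable_funM; last exact: measurableT_comp.
      by apply: measurableT_comp => //; apply: measurable_funB => //; exact: trig_measurable.
    move=> x; rewrite normrM !normr_id ler_piMl// ler_norml.
    have /andP[? ?] := uI x; have /andP[? ?] := vq x; apply/andP; split; lra.
  move=> x; rewrite -mulrBr; apply: le_trans (ler_norm _) _.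
  by rewrite normrM mulrC distrC.
have maxE x : maxr (- u x) 0 = - (u x * \1_E x).
  rewrite indicE; have [h|h] := ltP (u x) 0.
    by rewrite mem_set// mulr1; apply: max_l; lra.
  by rewrite memNset ?mulr0 ?oppr0; [apply: max_r; lra|apply/negP; rewrite -leNgt].
have im : integ (cell d) (fun x => maxr (- u x) 0).
  by apply: eq_integrable (integN iuE) => // x _ /=; rewrite maxE.
rewrite -Rint_EFin//; congr (_%:E); apply/eqP; rewrite eq_le; apply/andP; split.
  by under eq_Rintegral do rewrite maxE; rewrite RintN oppr_le0.
by apply: Rintegral_ge0 => x _; rewrite le_max lexx orbT.
Qed.

Lemma simple_approx (h : rvec R d -> R) (L : seq R) (A : R -> set (rvec R d)) (e : R) :
  integ (cell d) h -> (forall x, 0 <= h x) -> (forall t, measurable (A t)) -> 0 < e ->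
  exists q, [/\ trig q, forall x, `|q x| <= \sum_(y <- L) `|y| &
    \int[cell d]_x (`|\sum_(y <- L) y * \1_(A y) x - q x| * h x) <= e].
Proof.
move=> hi h0 mA e0; pose C := \sum_(y <- L) `|y|.
have C0 : 0 <= C by exact: sumr_ge0.
have e1 : 0 < e / (C + 1) by rewrite divr_gt0// ltr_wpDl.
have H (y : R) : exists q, [/\ trig q, unit_valued q &
    \int[cell d]_x (`|\1_(A y) x - q x| * h x) <= e / (C + 1)].
  by have [_ _ /(_ _ e1)] := approximable_measurable hi h0 (mA y).
have [q Hq] := choice H.
have tq y : trig (q y) by have [] := Hq y.
have vq y : unit_valued (q y) by have [] := Hq y.
have mh := integ_measurable hi.
have mI y : measurable_fun setT (\1_(A y) : rvec R d -> R) by exact: measurable_indic.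
have ii y : integ (cell d) (fun x => `|\1_(A y) x - q y x| * h x).
  apply: (integ_dom _ _ hi).
    apply: measurable_funM => //; apply: measurableT_comp => //.
    by apply: measurable_funB => //; exact: trig_measurable.
  move=> x; rewrite normrM normr_id (ger0_norm (h0 x)) ler_piMl// ler_norml indicE.
  have /andP[? ?] := vq y x.
  by case: (_ \in _) => /=; apply/andP; split; lra.
exists (fun x => \sum_(y <- L) y * q y x); split.
- by apply: trig_sum => y; apply: trigZ.
- move=> x; apply: le_trans (ler_norm_sum _ _ _) _; apply: ler_sum => y _.
  by rewrite normrM ler_piMr// unit_bound.
apply: (@le_trans _ _ (\int[cell d]_x (\sum_(y <- L) `|y| * (`|\1_(A y) x - q y x| * h x)))).
  apply: Rint_le.
  - apply: (integ_dom _ _ (integ_sum L (fun y => integZ `|y| (ii y)))).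
      apply: measurable_funM => //; apply: measurableT_comp => //; apply: measurable_funB.
        by apply: measurable_sum => y; exact: measurable_funM.
      by apply: measurable_sum => y; apply: measurable_funM => //; exact: trig_measurable.
    move=> x; rewrite normrM normr_id (ger0_norm (h0 x)) -sumrB.
    under [leRHS]eq_bigr do rewrite mulrA; rewrite -mulr_suml ler_wpM2r//.
    apply: le_trans (ler_norm_sum _ _ _) _; apply: ler_sum => y _.
    by rewrite -mulrBr normrM.
  - by apply: integ_sum => y; exact: integZ.
  move=> x; rewrite -sumrB.
  under [leRHS]eq_bigr do rewrite mulrA; rewrite -mulr_suml ler_wpM2r//.
  apply: le_trans (ler_norm_sum _ _ _) _; apply: ler_sum => y _.
  by rewrite -mulrBr normrM.
rewrite Rint_sum => [|y]; last exact: integZ.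
apply: (@le_trans _ _ (\sum_(y <- L) `|y| * (e / (C + 1)))).
  by apply: ler_sum => y _; rewrite RintZ// ler_wpM2l//; have [] := Hq y.
rewrite -mulr_suml -/C mulrCA ler_piMr ?(ltW e0)//.
by rewrite ler_pdivrMr ?mul1r ?lerDl// ltr_wpDl.
Qed.

Variable K : R.
Hypothesis uK : forall q, trig q ->
  (\int[cell d]_x (u x * q x)) ^+ 2 <= K * \int[cell d]_x (q x ^+ 2).

Lemma simple_duality (L : seq R) (A : R -> set (rvec R d)) :
  (forall t, measurable (A t)) ->
  (\int[cell d]_x (u x * \sum_(y <- L) y * \1_(A y) x)) ^+ 2 <=
  K * \int[cell d]_x ((\sum_(y <- L) y * \1_(A y) x) ^+ 2).
Proof.
move=> mA; pose f x : R := \sum_(y <- L) y * \1_(A y) x; pose h x := `|u x| + 1; pose C := \sum_(y <- L) `|y|.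
have hi : integ (cell d) h by apply: integD; [exact: integ_norm|exact: integ_cst].
have h0 x : 0 <= h x by rewrite addr_ge0.
have [q Hq] := choice (fun n : nat => simple_approx L hi h0 mA (e := n.+1%:R^-1) ltac:(by rewrite invr_gt0)).
have tq n : trig (q n) by have [] := Hq n.
have qC n x : `|q n x| <= C by have [] := Hq n.
have fC x : `|f x| <= C.
  apply: le_trans (ler_norm_sum _ _ _) _; apply: ler_sum => y _.
  by rewrite normrM ler_piMr// indicE; case: (_ \in _); rewrite /= ?normr1 ?normr0.
have mf : measurable_fun setT f.
  by apply: measurable_sum => y; apply: measurable_funM => //; exact: measurable_indic.
have mq n := trig_measurable (tq n).
have dn n : \int[cell d]_x (`|f x - q n x| * h x) <= n.+1%:R^-1 by have [] := Hq n.
have mfq n : measurable_fun setT (fun x => `|f x - q n x|).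
  by apply: measurableT_comp => //; exact: measurable_funB.
have ifq n : integ (cell d) (fun x => `|f x - q n x| * h x).
  have b x : `|(fun x => `|f x - q n x|) x| <= C + C.
    by rewrite /= normr_id; apply: le_trans (ler_normB _ _) _; exact: lerD.
  have := integM_bdd hi (mfq n) b; apply: eq_integrable => // x _ /=.
  by rewrite mulrC.
have c1 : \int[cell d]_x (u x * q n x) @[n --> \oo] --> \int[cell d]_x (u x * f x).
  apply: (@cvg_err _ _ (fun n => n.+1%:R^-1)); last exact: cvg_invn.
  move=> n; have iuf := integM_bdd ui mf fC; have iuq := integM_trig ui (tq n).
  rewrite -RintB//; apply: le_trans (le_Rint_norm (integB iuq iuf)) _.
  apply: le_trans (dn n); apply: Rint_le => //; first exact/integ_norm/integB.
  move=> x; rewrite -mulrBr normrM mulrC distrC ler_wpM2l//.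
  by rewrite /h lerDl.
have i2 (p : rvec R d -> R) : measurable_fun setT p -> (forall x, `|p x| <= C) ->
    integ (cell d) (fun x => p x ^+ 2).
  move=> mp pC; apply: (@integ_bdd _ _ _ _ _ (C ^+ 2)); first exact: measurable_funX.
  by move=> x; rewrite normrX lerXn2r// nnegrE// (le_trans _ (pC x)).
have c2 : \int[cell d]_x (q n x ^+ 2) @[n --> \oo] --> \int[cell d]_x (f x ^+ 2).
  apply: (@cvg_err _ _ (fun n => (C + C) * n.+1%:R^-1)); last first.
    by rewrite -(mulr0 (C + C)); apply: cvgM; [exact: cvg_cst|exact: cvg_invn].
  move=> n; have if2 := i2 f mf fC; have iq2 := i2 (q n) (mq n) (qC n).
  have C0 : 0 <= C + C by rewrite addr_ge0// sumr_ge0.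
  rewrite -RintB//; apply: le_trans (le_Rint_norm (integB iq2 if2)) _.
  apply: (@le_trans _ _ ((C + C) * \int[cell d]_x (`|f x - q n x| * h x))); last first.
    by rewrite ler_wpM2l.
  rewrite -RintZ//; apply: Rint_le; [exact/integ_norm/integB|exact: integZ|].
  move=> x; rewrite subr_sqr normrM mulrC distrC ler_pM//.
    by apply: le_trans (ler_normD _ _) _; exact: lerD.
  by rewrite ler_peMr// /h lerDr.
rewrite -subr_ge0 -/(f _).
apply: (@cvg_ge0 _ (fun n => K * \int[cell d]_x (q n x ^+ 2) - (\int[cell d]_x (u x * q n x)) ^+ 2)).
  by move=> n; rewrite subr_ge0; exact: uK.
apply: cvgB; first by apply: cvgM; [exact: cvg_cst|exact: c2].
by rewrite expr2; under eq_fun do rewrite expr2; exact: cvgM.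
Qed.

(** A simple function [s] below the positive part satisfies [int s^2 <= int u s],
   and duality bounds [int u s] by the norm of [s]; monotone convergence concludes. *)
Lemma pospart_sq_le : 0 <= K ->
  (\int[cell d]_x (maxr (u x) 0 ^+ 2)%:E <= K%:E)%E.
Proof.
move=> K0; pose up x := maxr (u x) 0.
have mup : measurable_fun setT (EFin \o up).
  by apply/measurable_EFinP; exact: measurable_maxr.
have up0 x : (0 <= up x)%R by rewrite le_max lexx orbT.
have up0E x : setT x -> (0 <= (EFin \o up) x)%E by rewrite lee_fin.
pose s n : rvec R d -> R := nnsfun_approx measurableT mup n.
have cs x : s n x @[n --> \oo] --> up x.
  have hc : EFin \o (fun n => s n x) @ \oo --> (up x)%:E.
    exact: (cvg_nnsfun_approx measurableT mup up0E).
  exact: (fine_cvg hc).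
have nd x m n : (m <= n)%N -> s m x <= s n x.
  by move=> mn; exact/lefP/nd_nnsfun_approx.
have s0 n x : 0 <= s n x by exact: fun_ge0.
have sup n x : s n x <= up x.
  rewrite -subr_ge0; apply: (@cvg_ge0 _ (fun m => s (n + m)%N x - s n x)).
    by move=> m; rewrite subr_ge0 nd// leq_addr.
  apply: cvgB; last exact: cvg_cst.
  by apply: (cvg_comp _ _ (cvg_addnl n) (cs x)).
have ms n : measurable_fun setT (s n) by exact: measurable_funP.
have sK n : (\int[cell d]_x (s n x ^+ 2)%:E <= K%:E)%E.
  pose L := finmap.enum_fset (fset_set (range (s n))).
  have sE x : s n x = \sum_(y <- L) y * \1_(s n @^-1` [set y]) x.
    by rewrite /s fimfunE fsbig_finite.
  have mA (y : R) : measurable (s n @^-1` [set y]) by exact: measurable_sfunP.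
  have := simple_duality L mA; rewrite /=.
  under eq_Rintegral do rewrite -sE; under [X in _ <= _ * X -> _]eq_Rintegral do rewrite -sE.
  have [M sM] : exists M, forall x, `|s n x| <= M.
    exists (\sum_(y <- L) `|y|) => x; rewrite sE.
    apply: le_trans (ler_norm_sum _ _ _) _; apply: ler_sum => y _.
    by rewrite normrM ler_piMr// indicE; case: (_ \in _); rewrite /= ?normr1 ?normr0.
  have is2 : integ (cell d) (fun x => s n x ^+ 2).
    apply: (@integ_bdd _ _ _ _ _ (M ^+ 2)); first exact: measurable_funX.
    by move=> x; rewrite normrX lerXn2r// nnegrE// (le_trans _ (sM x)).
  have ius := integM_bdd ui (ms n) sM.
  have le : \int[cell d]_x (s n x ^+ 2) <= \int[cell d]_x (u x * s n x).
    apply: Rint_le => // x; rewrite expr2 -subr_ge0 -mulrBl.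
    have := s0 n x; have := sup n x; rewrite /up; case: (leP (u x) 0) => ux su sx.
      have -> : s n x = 0 by apply/eqP; rewrite eq_le su sx.
      by rewrite mulr0.
    by rewrite mulr_ge0// subr_ge0.
  have X0 : 0 <= \int[cell d]_x (s n x ^+ 2) by apply: Rintegral_ge0 => x _; exact: sqr_ge0.
  move=> h; rewrite -Rint_EFin// lee_fin.
  move: X0 le h; move: (\int[cell d]_x (s n x ^+ 2)) (\int[cell d]_x (u x * s n x)) => X Y.
  move=> X0 XY h; rewrite leNgt; apply/negP => KX.
  have : X ^+ 2 <= Y ^+ 2 by rewrite lerXn2r// nnegrE (le_trans X0).
  have : K * X < X * X by rewrite ltr_pM2r// (le_lt_trans K0).
  rewrite expr2; lra.
pose g' n x := (s n x ^+ 2)%:E.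
have mg n : measurable_fun setT (g' n).
  by apply/measurable_EFinP; exact: measurable_funX.
have g0 n x : setT x -> (0 <= g' n x)%E by rewrite lee_fin sqr_ge0.
have ndg x : setT x -> nondecreasing_seq (g'^~ x).
  move=> _ m n mn; rewrite lee_fin lerXn2r// ?nnegrE//; exact: nd.
have fE x : limn (g'^~ x) = (up x ^+ 2)%:E.
  have c2 : s n x ^+ 2 @[n --> \oo] --> up x ^+ 2.
    by rewrite expr2; under eq_fun do rewrite expr2; exact: cvgM.
  by apply/cvg_lim => //; apply: cvg_EFin => //; exact: nearW.
have := monotone_convergence (cell d) measurableT mg g0 ndg.
have cg := @cvg_monotone_convergence _ _ _ (cell d) _ measurableT _ mg g0 ndg.
under [in LHS]eq_integral do rewrite fE; move=> ->.
apply: lime_le; first exact: cvgP cg.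
by apply: nearW => n; exact: sK.
Qed.

End duality.

(** * Sums over frequencies *)

Section frequency_sums.
Context {R : realType}.

Lemma sum_uniq_le (T : eqType) (F E : seq T) (w : T -> R) : uniq F ->
  {subset F <= E} -> (forall x, 0 <= w x) -> \sum_(x <- F) w x <= \sum_(x <- E) w x.
Proof.
move=> uF FE w0; elim: F E uF FE => [|x F IH] E /= => [_ _|/andP[xF uF] FE].
  by rewrite big_nil sumr_ge0.
have xE : x \in E by apply: FE; rewrite mem_head.
rewrite big_cons (perm_big _ (perm_to_rem xE))/= big_cons lerD2l; apply: IH => // y yF.
have yE : y \in E by apply: FE; rewrite inE yF orbT.
have := perm_mem (perm_to_rem xE) y; rewrite yE inE => /esym /orP[/eqP yx|//].
by rewrite -yx yF in xF.
Qed.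

(** Comparison with the integral of [t^-p], in telescoping form. *)
Lemma sum_pow_le (e : R) n : 0 < e ->
  \sum_(i < n) (i.+1%:R : R) `^ (- (1 + e)) <= 1 + e^-1.
Proof.
move=> e0; have ei : 0 < e^-1 by rewrite invr_gt0.
have key (A B y : R) : A * (1 + e * y) <= A * B -> A * y * e <= A * B - A.
  move=> h; have -> : A * y * e = A * (1 + e * y) - A by ring.
  by rewrite lerD2r.
have step m : (m.+2%:R : R) `^ (- (1 + e)) <=
    e^-1 * (m.+1%:R `^ (- e) - m.+2%:R `^ (- e)).
  pose x : R := m.+2%:R; have x0 : 0 < x by rewrite ltr0n.
  have y0 : 0 < (m.+1%:R : R) by rewrite ltr0n.
  have x1 : x = m.+1%:R + 1 by rewrite natr1.
  rewrite mulrC ler_pdivlMr// -/x.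
  have -> : x `^ (- (1 + e)) = x `^ (- e) * x^-1.
    by rewrite opprD addrC powRD ?powR_inv1 ?(ltW x0)//; rewrite (gt_eqF x0) implybT.
  have h : ln (m.+1%:R / x) <= - x^-1.
    have -> : m.+1%:R / x = 1 + (- x^-1).
      have xn : x != 0 by rewrite gt_eqF.
      rewrite -[X in _ = X - _](divff xn) -[X in _ - X]mul1r -mulrBl.
      by congr (_ / _); rewrite x1; ring.
    apply: le_ln1Dx; rewrite ltrN2 invf_lt1// x1; lra.
  have -> : m.+1%:R `^ (- e) = x `^ (- e) * expR (- e * ln (m.+1%:R / x)).
    rewrite /powR (gt_eqF x0) (gt_eqF y0) -expRD lnM ?posrE ?invr_gt0// lnV ?posrE//.
    by congr expR; ring.
  have h2 : 1 + e * x^-1 <= expR (- e * ln (m.+1%:R / x)).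
    apply: le_trans (expR_ge1Dx _); rewrite lerD2l.
    by rewrite -[leLHS]opprK -mulrN mulNr lerN2 ler_pM2l.
  have : x `^ (- e) * (1 + e * x^-1) <= x `^ (- e) * expR (- e * ln (m.+1%:R / x)).
    by rewrite ler_wpM2l// powR_ge0.
  exact: key.
suff: \sum_(i < n.+1) (i.+1%:R : R) `^ (- (1 + e)) <= 1 + e^-1 * (1 - n.+1%:R `^ (- e)).
  rewrite big_ord_recr/= => h.
  have : 0 <= e^-1 * n.+1%:R `^ (- e) by rewrite mulr_ge0 ?powR_ge0// ltW.
  have := powR_ge0 (n.+1%:R : R) (- (1 + e)); lra.
elim: n => [|n IH]; first by rewrite big_ord1 !powR1 subrr mulr0 addr0.
rewrite big_ord_recr/=; have := step n; lra.
Qed.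

Section box.
Variables (d n : nat).
Notation sgnd := (bool * 'I_n.+1)%type.

Definition signed (x : sgnd) : int := if x.1 then x.2%:Z else - x.2%:Z.

Definition box_freqs : seq (d.-tuple int) :=
  [seq [tuple signed (f i) | i < d] | f : {ffun 'I_d -> sgnd}].

Lemma mem_box_freqs (k : d.-tuple int) : (forall i, `|tnth k i| <= n%:Z) -> k \in box_freqs.
Proof.
move=> kn; apply/mapP.
exists [ffun i => (0 <= tnth k i, inord `|tnth k i|%N)]; first by rewrite mem_enum.
apply: eq_from_tnth => i; rewrite tnth_mktuple ffunE /signed /=.
have h : (`|tnth k i| < n.+1)%N by rewrite ltnS -lez_nat abszE.
rewrite inordK//; case: ifPn => [k0|k0]; first by rewrite gez0_abs.
by rewrite ltz0_abs ?opprK// ltNge.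
Qed.

Lemma sum_box_freqs (b : nat -> R) :
  \sum_(k <- box_freqs) \prod_(i < d) b `|tnth k i|%N =
  (2 * \sum_(j < n.+1) b j) ^+ d.
Proof.
rewrite /box_freqs big_map big_enum/=.
under eq_bigr => f _.
  under eq_bigr => i _ do rewrite tnth_mktuple.
  over.
rewrite -(bigA_distr_bigA (fun (i : 'I_d) (x : sgnd) => b `|signed x|%N)).
rewrite prodr_const card_ord; congr (_ ^+ d).
rewrite -(pair_bigA _ (fun (c : bool) (j : 'I_n.+1) => b `|signed (c, j)|%N))/=.
rewrite big_bool/= /signed/= mulr_natl mulr2n; congr (_ + _); apply: eq_bigr => j _ //.
by rewrite abszN.
Qed.

End box.

Variable d : nat.
Notation freq := (d.-tuple int).

Lemma sum_freq_prod_le (F : seq freq) (b : nat -> R) (C : R) : uniq F ->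
  (forall j, 0 <= b j) -> (forall n, \sum_(j < n) b j <= C) ->
  \sum_(k <- F) \prod_(i < d) b `|tnth k i|%N <= (2 * C) ^+ d.
Proof.
move=> uF b0 bC.
pose n := (\max_(k <- F) \max_(i < d) `|tnth k i|)%N.
apply: (@le_trans _ _ (\sum_(k <- box_freqs d n) \prod_(i < d) b `|tnth k i|%N)).
  apply: sum_uniq_le => // [k kF|k]; last exact: prodr_ge0.
  apply: mem_box_freqs => i; rewrite -abszE lez_nat /n.
  apply: leq_trans (leq_bigmax_seq _ kF isT).
  exact: (leq_bigmax (F := fun i => `|tnth k i|%N)).
rewrite sum_box_freqs lerXn2r ?nnegrE ?mulr_ge0 ?sumr_ge0//.
  by rewrite (le_trans _ (bC 0%N))// big_ord0.
by rewrite ler_wpM2l.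
Qed.

(** A finite sum within [e] of the supremum leaves less than [e] to the other
   frequencies. *)
Lemma freq_tail (a : freq -> R) (C : R) : (forall k, 0 <= a k) ->
  (forall F, uniq F -> freq0 \notin F -> \sum_(k <- F) a k <= C) ->
  forall e : R, 0 < e -> exists K : seq freq,
    forall F, uniq F -> freq0 \notin F -> {in F, forall k, k \notin K} ->
    \sum_(k <- F) a k <= e.
Proof.
move=> a0 aC e e0.
pose S := [set x : R | exists F, [/\ uniq F, freq0 \notin F & x = \sum_(k <- F) a k]].
have hS : has_sup S.
  split; first by exists 0, [::]; rewrite big_nil.
  by exists C => x [F [uF nF ->]]; exact: aC.
have [x [K [uK nK ->]] xe] := sup_adherent e0 hS.
exists K => F uF nF dF.
have : \sum_(k <- K ++ F) a k <= sup S.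
  apply: sup_upper_bound => //; exists (K ++ F); split => //.
    rewrite cat_uniq uK uF andbT/=; apply/hasPn => k kF /=; exact: dF.
  by rewrite mem_cat negb_or nK.
by rewrite big_cat/=; lra.
Qed.

Definition symmetrise (K : seq freq) : seq freq :=
  undup [seq k <- K ++ [seq freqN k | k <- K] | k != freq0].

Lemma symmetrise_uniq K : uniq (symmetrise K). Proof. exact: undup_uniq. Qed.

Lemma symmetrise0 K : freq0 \notin symmetrise K.
Proof. by rewrite mem_undup mem_filter eqxx. Qed.

Lemma mem_symmetrise K k : k \in K -> k != freq0 -> k \in symmetrise K.
Proof. by move=> kK k0; rewrite mem_undup mem_filter k0 mem_cat kK. Qed.

Lemma freqN_eq0 (k : freq) : (freqN k == freq0) = (k == freq0).
Proof. by rewrite -(inj_eq (inv_inj freqNK)) freqNK freqN0. Qed.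

Lemma symmetriseN K k : (freqN k \in symmetrise K) = (k \in symmetrise K).
Proof.
rewrite !mem_undup !mem_filter freqN_eq0 !mem_cat; congr (_ && _).
rewrite (mem_map (inv_inj freqNK)).
have -> : (k \in [seq freqN i | i <- K]) = (freqN k \in K).
  by rewrite -{1}[k]freqNK (mem_map (inv_inj freqNK)).
exact: orbC.
Qed.

End frequency_sums.

(** * Truncated powers and Fourier coefficients *)

Section coefficient_split.
Context {R : realType}.
Variables (alpha : R) (n : nat).
Hypotheses (a0 : 0 < alpha) (an : alpha <= n.+1%:R).

(** A smooth truncation of [l^-alpha] at scale [M]: since
   [l^-alpha = (M + l)^-alpha exp (- alpha ln (1 - u))] with [u = M / (M + l)],
   keeping finitely many terms of the logarithmic series leaves a remainder that
   decays faster than [l^-alpha]. *)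
Definition trunc_pow (M l : R) : R :=
  (M + l) `^ (- alpha) * expR (alpha * logtaylor n (M * (M + l) `^ (- 1))).

Variables M l : R.
Hypotheses (M0 : 0 < M).

Lemma trunc_pow_ge0 : 0 <= trunc_pow M l.
Proof. by rewrite mulr_ge0 ?powR_ge0 ?expR_ge0. Qed.

Let ratio_itv : 0 <= l -> 0 <= M * (M + l) `^ (- 1) <= 1.
Proof.
move=> l0; have Ml : 0 < M + l by have := M0; lra.
rewrite (powR_inv1 (ltW Ml)) ler_pdivrMr// mul1r lerDl l0 andbT.
exact: divr_ge0 (ltW M0) (ltW Ml).
Qed.

Lemma trunc_pow_le : 0 <= l -> trunc_pow M l <= expR (alpha * n%:R) * M `^ (- alpha).
Proof.
move=> l0; have Ml : 0 < M + l by have := M0; lra.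
have /andP[u0 u1] := ratio_itv l0.
rewrite /trunc_pow mulrC; apply: ler_pM; rewrite ?expR_ge0 ?powR_ge0//.
  rewrite ler_expR ler_pM2l// -[X in _ <= X%:R]card_ord -sumr_const.
  apply: ler_sum => i _; rewrite ler_pdivrMr// mul1r.
  by apply: (@le_trans _ _ 1); [exact: exprn_ile1|rewrite ler1n].
rewrite !powRN lef_pV2 ?posrE ?powR_gt0//.
by apply: ge0_ler_powR; rewrite ?nnegrE ?lerDl//; exact: ltW.
Qed.

Hypothesis l0 : 0 < l.
Let u := M * (M + l) `^ (- 1).

Let Ml : 0 < M + l. Proof. exact: addr_gt0. Qed.

Let uE : u = M / (M + l). Proof. by rewrite /u powR_inv1// ltW. Qed.

Let u0 : 0 <= u. Proof. by have /andP[] := ratio_itv (ltW l0). Qed.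

Let uE1 : 1 - u = l / (M + l).
Proof. by rewrite uE; field; rewrite gt_eqF. Qed.

Let u1 : u < 1.
Proof. by rewrite -subr_gt0 uE1 divr_gt0. Qed.

Let powE : l `^ (- alpha) = (M + l) `^ (- alpha) * expR (alpha * - ln (1 - u)).
Proof.
rewrite /powR (gt_eqF l0) (gt_eqF Ml) -expRD uE1 lnM ?posrE ?invr_gt0// lnV ?posrE//.
by congr expR; ring.
Qed.

Lemma trunc_pow_le_pow : trunc_pow M l <= l `^ (- alpha).
Proof.
by rewrite powE ler_wpM2l ?powR_ge0// ler_expR ler_pM2l// logtaylor_le.
Qed.

Lemma pow_sub_trunc_le : 1 <= l ->
  l `^ (- alpha) - trunc_pow M l <= alpha * M ^+ n.+1 * l `^ (- (2 * alpha)).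
Proof.
move=> l1; pose rem := - ln (1 - u) - logtaylor n u.
have tE : trunc_pow M l = l `^ (- alpha) * expR (- (alpha * rem)).
  rewrite powE -mulrA -expRD /trunc_pow -/u; congr (_ * expR _).
  by rewrite /rem; ring.
have rle : rem <= (M / l) ^+ n.+1.
  have := logtaylor_rem n (t := u); rewrite (ger0_norm u0) => /(_ u1).
  move/(le_trans (ler_norm _)); rewrite -/rem => /le_trans; apply.
  have ul : u <= M / l.
    by rewrite uE ler_pM2l// lef_pV2 ?posrE//; have := M0; lra.
  rewrite uE1 exprS.
  have -> : u * u ^+ n / (l / (M + l)) = M / l * u ^+ n.
    have : u * (M + l) = M by rewrite uE mulfVK// gt_eqF.
    move=> h; rewrite -[in RHS]h invf_div; ring.
  by rewrite exprS ler_wpM2l ?divr_ge0 ?(ltW M0) ?(ltW l0)// lerXn2r ?nnegrE// divr_ge0// ltW.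
have P0 : 0 <= l `^ (- alpha) by exact: powR_ge0.
apply: (@le_trans _ _ (l `^ (- alpha) * (alpha * (M / l) ^+ n.+1))).
  rewrite tE -[X in X - _]mulr1 -mulrBr ler_wpM2l//.
  apply: (@le_trans _ _ (alpha * rem)); last by rewrite ler_pM2l.
  have := expR_ge1Dx (- (alpha * rem)); lra.
have -> : l `^ (- (2 * alpha)) = l `^ (- alpha) * l `^ (- alpha).
  by rewrite -powRD ?(gt_eqF l0) ?implybT//; congr (_ `^ _); ring.
have -> : alpha * M ^+ n.+1 * (l `^ (- alpha) * l `^ (- alpha)) =
    l `^ (- alpha) * (alpha * (M ^+ n.+1 * l `^ (- alpha))) by ring.
rewrite ler_wpM2l// ler_pM2l// expr_div_n ler_pM2l ?exprn_gt0//.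
rewrite -powR_mulrn ?(ltW l0)// -powRN ler_powR// lerN2//.
Qed.

End coefficient_split.

Section coefficients.
Context (R : realType) (d : nat) (s cd : R).
Hypotheses (hs0 : 0 <= s) (hsd : s < d%:R / 2) (hcd : 0 < cd).
Notation freq := (d.-tuple int).

Let d0 : (0 < d)%N.
Proof.
rewrite lt0n; apply/eqP => dz; move: hsd; rewrite dz mul0r => /(le_lt_trans hs0).
by rewrite ltxx.
Qed.

Let dR : 0 < d%:R :> R. Proof. by rewrite ltr0n. Qed.

Definition spectral_exponent : R := (d%:R - s) / 2.
Local Notation alpha := spectral_exponent.

Lemma spectral_exponent_gt0 : 0 < alpha.
Proof. by have := hsd; have := dR; rewrite /spectral_exponent; lra. Qed.

Lemma spectral_exponent_le : alpha <= d.+1%:R.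
Proof. by have := hs0; have := dR; rewrite /spectral_exponent -[d.+1%:R]natr1; lra. Qed.

Definition sqfreq (k : freq) : R := sqnorm (freq_vec k).

Lemma sqfreqN k : sqfreq (freqN k) = sqfreq k.
Proof.
apply: eq_bigr => i _; rewrite !tnth_mktuple mulrNz mulrN sqrrN //.
Qed.

Lemma freq_norm_pow k : @freq_norm R d k `^ (- (d%:R - s)) = sqfreq k `^ (- alpha) :> R.
Proof.
have f0 : 0 <= @freq_norm R d k by rewrite mulr_ge0 ?sqrtr_ge0// mulr_ge0 ?pi_ge0.
have -> : sqfreq k = @freq_norm R d k ^+ 2.
  rewrite /freq_norm exprMn sqr_sqrtr; last by apply: sumr_ge0 => i _; exact: sqr_ge0.
  rewrite /sqfreq /sqnorm mulr_sumr; apply: eq_bigr => i _.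
  by rewrite tnth_mktuple exprMn.
rewrite -[in RHS]powR_mulrn// -powRrM; congr (_ `^ _).
by rewrite /spectral_exponent; field.
Qed.

Lemma sqfreq_ge (k : freq) (i : 'I_d) : k != freq0 ->
  (maxn 1 `|tnth k i|)%:R ^+ 2 <= sqfreq k.
Proof.
move=> k0.
have coord j : (`|tnth k j|%N)%:R ^+ 2 <= sqfreq k :> R.
  apply: le_trans (sqnorm_coord_le (freq_vec k) j).
  rewrite tnth_mktuple exprMn.
  have -> : ((tnth k j)%:~R : R) ^+ 2 = (`|tnth k j|%N)%:R ^+ 2.
    by rewrite -[RHS]real_normK ?num_real// pmulrn abszE intr_norm normr_id real_normK ?num_real.
  rewrite ler_peMl ?sqr_ge0// exprn_ege1//.
  have := pihalf_ge1 R; lra.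
rewrite /maxn; case: ifP => // _.
have [j kj] : exists j, tnth k j != 0.
  apply/existsP; rewrite -negb_forall; apply: contra k0 => /forallP h.
  by apply/eqP/eq_from_tnth => j; rewrite tnth_mktuple; exact/eqP.
apply: le_trans (coord j); rewrite lerXn2r ?nnegrE// ler_nat.
by rewrite absz_gt0.
Qed.

Lemma sqfreq_ge1 k : k != freq0 -> 1 <= sqfreq k.
Proof.
move=> k0; apply: le_trans (sqfreq_ge (Ordinal d0) k0).
by rewrite exprn_ege1// ler1n leq_max.
Qed.

(** Square summability of the Fourier coefficients: this is where [s < d / 2]
   enters. *)
Lemma sqfreq_summable : exists C : R, forall F : seq freq, uniq F -> freq0 \notin F ->
  \sum_(k <- F) sqfreq k `^ (- (2 * alpha)) <= C.
Proof.
(* Each coordinate gets the exponent [- 4 alpha / d = - (1 + e)]. *)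
pose e : R := 4 * alpha / d%:R - 1.
have e0 : 0 < e.
  rewrite subr_gt0 ltr_pdivlMr// mul1r.
  by have := hsd; rewrite /spectral_exponent; lra.
pose b (j : nat) : R := (maxn 1 j)%:R `^ (- (1 + e)).
have b0 j : 0 <= b j by exact: powR_ge0.
have bC n : \sum_(j < n) b j <= 2 + e^-1.
  case: n => [|n]; first by rewrite big_ord0 addr_ge0// invr_ge0 ltW.
  rewrite big_ord_recl {1}/b /= powR1.
  have := sum_pow_le n e0.
  have -> : \sum_(i < n) b (lift ord0 i) = \sum_(i < n) (i.+1%:R : R) `^ (- (1 + e)).
    by apply: eq_bigr => i _; rewrite /b /= /bump/= add1n (maxn_idPr _).
  lra.
exists ((2 * (2 + e^-1)) ^+ d) => F uF nF.
apply: le_trans (sum_freq_prod_le uF b0 bC).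
rewrite big_seq [leRHS]big_seq; apply: ler_sum => k kF.
have k0 : k != freq0 by apply: contraNneq nF => <-.
have l1 := sqfreq_ge1 k0; have l0 : 0 < sqfreq k by lra.
have -> : sqfreq k `^ (- (2 * alpha)) = \prod_(i < d) (sqfreq k `^ (- (2 * alpha / d%:R))).
  rewrite prodr_const card_ord -powR_mulrn ?powR_ge0// -powRrM; congr (_ `^ _).
  by field; rewrite gt_eqF.
apply: ler_prod => i _; rewrite powR_ge0/= /b.
have m1 : 1 <= (maxn 1 `|tnth k i|)%:R :> R by rewrite ler1n leq_max.
have -> : - (1 + e) = 2%:R * - (2 * alpha / d%:R) by rewrite /e; field; rewrite gt_eqF.
have m0 := lt_le_trans ltr01 m1.
rewrite powRrM (powR_mulrn _ (ltW m0)).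
rewrite !powRN lef_pV2 ?posrE ?powR_gt0 ?exprn_gt0//.
apply: ge0_ler_powR; rewrite ?nnegrE ?sqr_ge0 ?(ltW l0)//.
  by rewrite divr_ge0// mulr_ge0// ltW// spectral_exponent_gt0.
exact: sqfreq_ge.
Qed.

Lemma fourier_const_ge0 : 0 <= fourier_const d s cd.
Proof.
have gam z : 0 <= @gamma_fun R z.
  by apply: Rintegral_ge0 => t _; rewrite mulr_ge0 ?powR_ge0 ?expR_ge0.
by rewrite /fourier_const; case: ifP => // _; rewrite !mulr_ge0 ?powR_ge0// ltW.
Qed.

Lemma posdef_trunc_pow (M : R) : 0 < M ->
  posdef (fun x : rvec R d => trunc_pow alpha d M (sqnorm x)).
Proof.
move=> M0; have a0 := spectral_exponent_gt0.
apply: posdefM; first by apply: posdef_pow => //; exact: ltW.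
apply: posdef_expR; apply: posdefZ; first exact: ltW.
apply: posdef_sum => i.
have p1 : posdef (fun x : rvec R d => (M + sqnorm x) `^ (- 1)) by exact: posdef_pow.
have i0 : 0 <= i.+1%:R^-1 :> R by rewrite invr_ge0.
apply: (posdef_ext (posdefZ i0 (posdefX i.+1 (posdefZ (ltW M0) p1)))) => x /=.
by rewrite mulrC.
Qed.

End coefficients.

(** * Splitting the periodic interaction *)

Section torus.
Context (R : realType) (d : nat) (s cd : R) (g : {mfun rvec R d >-> R}).
Hypotheses (hs0 : 0 <= s) (hsd : s < d%:R / 2) (hcd : 0 < cd).
Hypothesis hg : periodic_riesz s cd g.
Notation freq := (d.-tuple int).
Local Notation alpha := (spectral_exponent d s).
Let kappa : R := fourier_const d s cd.

Let kappa0 : 0 <= kappa. Proof. exact: fourier_const_ge0. Qed.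

Let a0 : 0 < alpha. Proof. exact: spectral_exponent_gt0. Qed.

Let an : alpha <= d.+1%:R. Proof. exact: spectral_exponent_le. Qed.

Let gper x k : g (vaddz x k) = g x. Proof. by have [h _ _ _] := hg; exact: h. Qed.

Let gint : integ (cell d) g. Proof. by have [_ h _ _] := hg; exact: h. Qed.

Definition riesz_coef (k : freq) : R := if k == freq0 then 0 else kappa * sqfreq R k `^ (- alpha).

Lemma fourier_riesz : fourier g riesz_coef.
Proof.
split => // k; rewrite /riesz_coef; have [_ _ g0 gk] := hg.
have [->|k0] := eqVneq k freq0.
  split.
    rewrite -[RHS]g0; apply: eq_Rintegral => x _.
    by rewrite phase_angle0 cos0 mulr1.
  rewrite -[RHS](Rint_cst (cell d) 0); apply: eq_Rintegral => x _.
  by rewrite phase_angle0 sin0 mulr0.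
have [|h1 h2] := gk k.
  apply/existsP; rewrite -negb_forall; apply: contra k0 => /forallP h.
  by apply/eqP/eq_from_tnth => j; rewrite tnth_mktuple; exact/eqP.
by split; [rewrite -freq_norm_pow; exact: h1|exact: h2].
Qed.

Section splitting.
Variables (M : R) (K : seq freq).
Hypotheses (M0 : 0 < M) (uK : uniq K) (nK : freq0 \notin K).
Hypothesis sK : forall k, (freqN k \in K) = (k \in K).

Definition trunc_coef (k : freq) : R := kappa * trunc_pow alpha d M (sqfreq R k).
(** The part of the coefficient removed by the truncation, summable over the
   frequencies. *)
Definition decaying_coef (k : freq) : R := kappa * (sqfreq R k `^ (- alpha) - trunc_pow alpha d M (sqfreq R k)).

Let freq_gt0 (k : freq) : k != freq0 -> 0 < sqfreq R k.
Proof. by move=> k0; apply: lt_le_trans (sqfreq_ge1 hs0 hsd k0). Qed.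

Lemma decaying_coef_ge0 k : k != freq0 -> 0 <= decaying_coef k.
Proof. by move=> k0; rewrite mulr_ge0// subr_ge0 trunc_pow_le_pow// freq_gt0. Qed.

Lemma decaying_coef_le k : k != freq0 ->
  decaying_coef k <= kappa * (alpha * M ^+ d.+1) * sqfreq R k `^ (- (2 * alpha)).
Proof.
move=> k0; rewrite -mulrA ler_wpM2l//.
by apply: pow_sub_trunc_le => //; [exact: freq_gt0|exact: (sqfreq_ge1 hs0 hsd k0)].
Qed.

Definition smooth_part : rvec R d -> R := cosum K decaying_coef.

Definition rough_part (x : rvec R d) : R := g x - smooth_part x.

Definition rough_coef (k : freq) : R := riesz_coef k - (if k \in K then decaying_coef k else 0).

Lemma fourier_rough_part : fourier rough_part rough_coef.
Proof.
have hN k : decaying_coef (freqN k) = decaying_coef k by rewrite /decaying_coef sqfreqN.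
have h := fourier_cosum uK sK hN.
have := fourierB fourier_riesz h.
by [].
Qed.

Lemma posdef_smooth_part : posdef smooth_part.
Proof.
apply: (posdef_ext (F := fun x => \sum_(k <- K) (if k == freq0 then 0 else decaying_coef k) *
    cos (dot (freq_vec k) x))).
  apply: posdef_sum => k; apply: posdef_cos; case: eqVneq => // k0; exact: decaying_coef_ge0.
move=> x; rewrite /smooth_part /cosum big_seq [RHS]big_seq; apply: eq_bigr => k kK.
have k0 : k != freq0 by apply: contraNneq nK => <-.
by rewrite (negbTE k0) dotC dot_freq_vec.
Qed.

(** Pairing with a nonnegative trigonometric polynomial: the truncated powers are
   positive definite and pair nonnegatively, except for the missing zero mode,
   and the modes outside [K] are uniformly small. *)
Lemma rough_part_lower (delta : R) (q : rvec R d -> R) :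
  (forall F, uniq F -> freq0 \notin F -> {in F, forall k, k \notin K} ->
     \sum_(k <- F) decaying_coef k <= delta) ->
  trig q -> (forall x, 0 <= q x) ->
  - (kappa * trunc_pow alpha d M 0 + delta) * \int[cell d]_x q x <=
  \int[cell d]_x (rough_part x * q x).
Proof.
move=> tail tq q0; have [l ql] := tq.
have iq := integ_trig tq.
have q0' x : 0 <= teval l x by rewrite -ql.
have -> : \int[cell d]_x (rough_part x * q x) = \sum_(t <- l) t.2.1 * rough_coef t.1.
  rewrite -(fourier_teval l fourier_rough_part); apply: eq_Rintegral => x _.
  by rewrite ql.
pose T := [seq k <- symmetrise [seq t.1 | t <- l] | k \notin K].
have uT : uniq T by rewrite filter_uniq// symmetrise_uniq.
have nT : freq0 \notin T by rewrite mem_filter negb_and symmetrise0 orbT.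
have sT k : (freqN k \in T) = (k \in T) by rewrite !mem_filter sK symmetriseN.
have hN k : decaying_coef (freqN k) = decaying_coef k by rewrite /decaying_coef sqfreqN.
have rE t : t \in l -> rough_coef t.1 = trunc_coef t.1 + (if t.1 \in T then decaying_coef t.1 else 0) -
    trunc_coef freq0 * (t.1 == freq0)%:R.
  move=> tl; rewrite /rough_coef /riesz_coef; have [->|k0] := eqVneq t.1 freq0.
    by rewrite (negbTE nK) (negbTE nT) mulr1 subr0 addr0 subrr.
  have tT : (t.1 \in T) = (t.1 \notin K).
    by rewrite mem_filter (mem_symmetrise (map_f _ tl) k0) andbT.
  rewrite tT /trunc_coef /decaying_coef mulr0 subr0.
  move: (_ `^ _) (trunc_pow _ _ _ _) => p r.
  by case: (t.1 \in K) => /=; ring.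
have -> : \sum_(t <- l) t.2.1 * rough_coef t.1 =
    \sum_(t <- l) t.2.1 * trunc_coef t.1 +
    \sum_(t <- l) t.2.1 * (if t.1 \in T then decaying_coef t.1 else 0) -
    trunc_coef freq0 * \sum_(t <- l) t.2.1 * (t.1 == freq0)%:R.
  rewrite mulr_sumr -big_split/= -sumrB big_seq [RHS]big_seq; apply: eq_bigr => t tl.
  rewrite rE//; move: (trunc_coef t.1) (trunc_coef freq0) (if _ then _ else _) (_ == _) => w w0 h e.
  by ring.
have l1 : 0 <= \sum_(t <- l) t.2.1 * trunc_coef t.1.
  have := posdef_teval_ge0 (posdefZ kappa0 (posdef_trunc_pow hs0 hsd M0)) q0'.
  exact.
have l2 : \sum_(t <- l) t.2.1 * (t.1 == freq0)%:R = \int[cell d]_x q x.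
  have f1 : fourier (fun=> 1 : R) (fun k : freq => (k == freq0)%:R).
    split; first exact: integ_cst.
    move=> k; split; under eq_Rintegral do rewrite mul1r; first exact: Rint_cos.
    exact: Rint_sin.
  rewrite -(fourier_teval l f1); apply: eq_Rintegral => x _.
  by rewrite mul1r ql.
have l3 : - delta * \int[cell d]_x q x <=
    \sum_(t <- l) t.2.1 * (if t.1 \in T then decaying_coef t.1 else 0).
  rewrite -(fourier_teval l (fourier_cosum uT sT hN)).
  rewrite -RintZ//; apply: Rint_le; first exact: integZ.
    have := integM_trig (integ_trig (trig_cosum T decaying_coef)) tq.
    by apply: eq_integrable => // x _ /=; rewrite ql.
  move=> x; rewrite ql ler_wpM2r//.
  have dis : {in T, forall k, k \notin K} by move=> k; rewrite mem_filter => /andP[].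
  have := tail T uT nT dis.
  rewrite lerNl => /(le_trans _); apply; rewrite -sumrN big_seq [leRHS]big_seq.
  apply: ler_sum => k kT; have k0 : k != freq0 by apply: contraNneq nT => <-.
  by rewrite -mulrN ler_piMr ?decaying_coef_ge0// lerNl cos_geN1.
have lz : trunc_coef freq0 = kappa * trunc_pow alpha d M 0.
  by rewrite /trunc_coef /sqfreq /sqnorm big1// => i _; rewrite !tnth_mktuple mulr0 expr0n.
rewrite l2 lz; move: l1 l3.
move: (\sum_(t <- l) _) (\sum_(t <- l) _) (\int[_]_x _) (kappa * _) => p r i w; lra.
Qed.

(** Against [q] the rough part acts like a cosine sum over the frequencies of [q],
   whose norm is given by the coefficients. *)
Lemma rough_part_duality (S : R) (q : rvec R d -> R) :
  (forall F, uniq F -> freq0 \notin F -> \sum_(k <- F) rough_coef k ^+ 2 <= S) ->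
  trig q ->
  (\int[cell d]_x (rough_part x * q x)) ^+ 2 <= S * \int[cell d]_x (q x ^+ 2).
Proof.
move=> FS tq; have [l ql] := tq.
pose F := symmetrise [seq t.1 | t <- l].
have uF : uniq F by exact: symmetrise_uniq.
have nF : freq0 \notin F by exact: symmetrise0.
have sF k : (freqN k \in F) = (k \in F) by exact: symmetriseN.
have rN k : rough_coef (freqN k) = rough_coef k.
  by rewrite /rough_coef /riesz_coef freqN_eq0 sK /decaying_coef sqfreqN.
pose p := cosum F rough_coef.
have tp : trig p by exact: trig_cosum.
have fp := fourier_cosum uF sF rN.
have -> : \int[cell d]_x (rough_part x * q x) = \int[cell d]_x (p x * q x).
  transitivity (\int[cell d]_x (rough_part x * teval l x)).
    by apply: eq_Rintegral => x _; rewrite ql.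
  transitivity (\int[cell d]_x (p x * teval l x)); last first.
    by apply: eq_Rintegral => x _; rewrite ql.
  rewrite (fourier_teval l fourier_rough_part) (fourier_teval l fp).
  rewrite big_seq [RHS]big_seq; apply: eq_bigr => t tl; congr (_ * _).
  case: ifPn => // tF.
  have /eqP -> : t.1 == freq0 by apply: contraNT tF => k0; exact: mem_symmetrise (map_f _ tl) k0.
  by rewrite /rough_coef /riesz_coef eqxx (negbTE nK) subr0.
have pp : \int[cell d]_x (p x ^+ 2) <= S.
  have -> : \int[cell d]_x (p x ^+ 2) = \sum_(k <- F) rough_coef k ^+ 2.
    transitivity (\int[cell d]_x (p x * teval [seq (k, (rough_coef k, 0)) | k <- F] x)).
      by apply: eq_Rintegral => x _; rewrite -cosum_teval.
    rewrite (fourier_teval _ fp) big_map big_seq [RHS]big_seq; apply: eq_bigr => k kF /=.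
    by rewrite kF.
  exact: FS.
have L2t (w : rvec R d -> R) : trig w -> L2 (cell d) w.
  move=> tw; split; first exact: trig_measurable.
  by apply: integ_trig; exact: trigX.
apply: le_trans (CauchySchwarz (L2t p tp) (L2t q tq)) _.
by rewrite ler_wpM2r//; apply: Rintegral_ge0 => x _; exact: sqr_ge0.
Qed.

Lemma rough_coef_sq_le k : k != freq0 ->
  rough_coef k ^+ 2 <= kappa ^+ 2 * sqfreq R k `^ (- (2 * alpha)) /\
  (k \in K -> rough_coef k ^+ 2 <= (kappa * (expR (alpha * d%:R) * M `^ (- alpha))) ^+ 2).
Proof.
move=> k0; have l0 := freq_gt0 k0; have l1 : 1 <= sqfreq R k by exact: (sqfreq_ge1 hs0 hsd k0).
have p2 : sqfreq R k `^ (- (2 * alpha)) = (sqfreq R k `^ (- alpha)) ^+ 2.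
  by rewrite -powR_mulrn ?powR_ge0// -powRrM; congr (_ `^ _); ring.
have t0 : 0 <= trunc_pow alpha d M (sqfreq R k) by exact: trunc_pow_ge0.
have tl : trunc_pow alpha d M (sqfreq R k) <= sqfreq R k `^ (- alpha).
  exact: trunc_pow_le_pow.
have tM : trunc_pow alpha d M (sqfreq R k) <= expR (alpha * d%:R) * M `^ (- alpha).
  by apply: trunc_pow_le => //; exact: ltW.
rewrite /rough_coef /riesz_coef (negbTE k0) p2 -exprMn.
have P0 := powR_ge0 (sqfreq R k) (- alpha).
split; last first.
  move=> ->; rewrite /decaying_coef.
  have -> : kappa * sqfreq R k `^ (- alpha) -
    kappa * (sqfreq R k `^ (- alpha) - trunc_pow alpha d M (sqfreq R k)) =
    kappa * trunc_pow alpha d M (sqfreq R k) by ring.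
  rewrite lerXn2r ?nnegrE ?mulr_ge0// ?expR_ge0 ?powR_ge0//.
  by rewrite ler_wpM2l.
case: ifP => _; last by rewrite subr0.
rewrite /decaying_coef.
have -> : kappa * sqfreq R k `^ (- alpha) -
    kappa * (sqfreq R k `^ (- alpha) - trunc_pow alpha d M (sqfreq R k)) =
    kappa * trunc_pow alpha d M (sqfreq R k) by ring.
have le : kappa * trunc_pow alpha d M (sqfreq R k) <= kappa * sqfreq R k `^ (- alpha).
  by rewrite ler_wpM2l.
by rewrite lerXn2r// nnegrE mulr_ge0.
Qed.

End splitting.

End torus.

(** * Choice of the cut-off *)

Section torus_regularisation.
Context (R : realType) (d : nat) (s cd : R) (g : {mfun rvec R d >-> R}).
Hypotheses (hs0 : 0 <= s) (hsd : s < d%:R / 2) (hcd : 0 < cd).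
Hypothesis hg : periodic_riesz s cd g.
Notation freq := (d.-tuple int).
Local Notation alpha := (spectral_exponent d s).
Let kappa : R := fourier_const d s cd.

Let kappa0 : 0 <= kappa. Proof. exact: fourier_const_ge0. Qed.

Let a0 : 0 < alpha. Proof. exact: spectral_exponent_gt0. Qed.

Let gint : integ (cell d) g. Proof. by have [_ h _ _] := hg; exact: h. Qed.

Let E0 : R := expR (alpha * d%:R).

(** The modes are cut in two steps: outside a finite set [K1] the Fourier
   coefficients of [g] are square summable to little, and on [K1] the scale [M]
   makes the truncated powers small; then [K] catches the modes that matter for
   this [M] in the uniform norm. *)
Lemma choose_cutoff (e : R) : 0 < e -> exists (M : R) (K : seq freq),
  [/\ 0 < M, [/\ uniq K, freq0 \notin K & forall k, (freqN k \in K) = (k \in K)],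
   kappa * trunc_pow alpha d M 0 <= e / 2,
   forall F, uniq F -> freq0 \notin F -> {in F, forall k, k \notin K} ->
     \sum_(k <- F) decaying_coef s cd M k <= e / 2 &
   forall F, uniq F -> freq0 \notin F -> \sum_(k <- F) rough_coef s cd M K k ^+ 2 <= e / 2].
Proof.
move=> e0; have [C sumC] := sqfreq_summable hs0 hsd.
have tail := freq_tail (fun k => powR_ge0 (sqfreq R k) (- (2 * alpha))) sumC.
have k2 : 0 < 4 * (kappa ^+ 2 + 1) by rewrite mulr_gt0// ltr_wpDl ?sqr_ge0.
have [K1 hK1] := tail (e / (4 * (kappa ^+ 2 + 1))) (divr_gt0 e0 k2).
(* On [K1] each squared coefficient will be at most [m ^+ 2 <= m], and there are
   [n1] of them. *)
pose n1 : R := (size K1)%:R; have n10 : 0 <= n1 by [].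
pose m := minr (minr (e / 2) 1) (e / (4 * (n1 + 1))).
have n4 : 0 < 4 * (n1 + 1) by rewrite mulr_gt0// ltr_wpDl.
have m0 : 0 < m by rewrite !lt_min ltr01 !divr_gt0.
have [me m1 mn] : [/\ m <= e / 2, m <= 1 & m * (4 * (n1 + 1)) <= e].
  split; rewrite ?ge_min ?lexx ?orbT//.
  by rewrite -ler_pdivlMr// ge_min lexx orbT.
have E0_gt0 : 0 < E0 by exact: expR_gt0.
have kE : 0 < kappa * E0 + 1 by rewrite ltr_wpDl// mulr_ge0// ltW.
(* The scale [M] is chosen through [x = M^-alpha], which bounds the truncation. *)
pose x := m / (kappa * E0 + 1); have x0 : 0 < x by exact: divr_gt0.
pose M := x `^ (- alpha^-1); have M0 : 0 < M by exact: powR_gt0.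
have Mx : M `^ (- alpha) = x.
  by rewrite /M -powRrM mulrNN mulVf ?gt_eqF// powRr1// ltW.
have yle : kappa * (E0 * x) <= m.
  rewrite mulrA /x mulrA ler_pdivrMr// mulrC ler_pM2l// lerDl//.
have y0 : 0 <= kappa * (E0 * x) by apply: mulr_ge0 => //; apply: mulr_ge0; exact: ltW.
pose D := kappa * (alpha * M ^+ d.+1).
have D0 : 0 <= D.
  by apply: mulr_ge0 => //; apply: mulr_ge0; [exact: ltW|exact: exprn_ge0 (ltW M0)].
have D1 : 0 < D + 1 by rewrite ltr_wpDl.
have [K2 hK2] := tail (e / 2 / (D + 1)) (divr_gt0 (divr_gt0 e0 (ltr0n _ 2)) D1).
pose K := symmetrise (K1 ++ K2).
have K1K k : k \in K1 -> k != freq0 -> k \in K.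
  by move=> h; apply: mem_symmetrise; rewrite mem_cat h.
have K2K k : k \in K2 -> k != freq0 -> k \in K.
  by move=> h; apply: mem_symmetrise; rewrite mem_cat h orbT.
have nz (F : seq freq) k : freq0 \notin F -> k \in F -> k != freq0.
  by move=> nF kF; apply: contraNneq nF => <-.
exists M, K; split => //.
- by split; [exact: symmetrise_uniq|exact: symmetrise0|exact: symmetriseN].
- apply: le_trans me; apply: le_trans yle; rewrite ler_wpM2l// -Mx.
  by apply: trunc_pow_le.
- move=> F uF nF dF.
  apply: (@le_trans _ _ (D * \sum_(k <- F) sqfreq R k `^ (- (2 * alpha)))).
    rewrite mulr_sumr big_seq [leRHS]big_seq; apply: ler_sum => k kF.
    by apply: decaying_coef_le => //; exact: nz kF.
  have d2 : {in F, forall k, k \notin K2}.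
    by move=> k kF; apply: contra (dF k kF) => h; apply: K2K => //; exact: nz kF.
  apply: (@le_trans _ _ (D * (e / 2 / (D + 1)))).
    by rewrite ler_wpM2l//; exact: hK2.
  by rewrite mulrA ler_pdivrMr// mulrC ler_pM2l ?divr_gt0// lerDl.
move=> F uF nF.
pose F1 := [seq k <- F | k \in K1]; pose F2 := [seq k <- F | k \notin K1].
have -> : \sum_(k <- F) rough_coef s cd M K k ^+ 2 =
    \sum_(k <- F1) rough_coef s cd M K k ^+ 2 + \sum_(k <- F2) rough_coef s cd M K k ^+ 2.
  by rewrite (bigID (mem K1))/= !big_filter.
have rle k (k0 : k != freq0) := rough_coef_sq_le hs0 hsd hcd K M0 k0.
have s1 : \sum_(k <- F1) rough_coef s cd M K k ^+ 2 <= n1 * m.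
  apply: (@le_trans _ _ (\sum_(k <- F1) m)).
    rewrite big_seq [leRHS]big_seq; apply: ler_sum => k.
    rewrite mem_filter => /andP[kK1 kF]; have k0 := nz F k nF kF.
    have [_ /(_ (K1K k kK1 k0))] := rle k k0.
    move/le_trans; apply; rewrite -/kappa -/E0 Mx.
    apply: (@le_trans _ _ (kappa * (E0 * x))) => //.
    by rewrite expr2 ler_piMl// (le_trans yle).
  rewrite big_const_seq count_predT iter_addr_0 -mulr_natl ler_wpM2r ?(ltW m0)//.
  rewrite ler_nat; apply: uniq_leq_size; first by rewrite filter_uniq.
  by move=> k; rewrite mem_filter => /andP[].
have s2 : \sum_(k <- F2) rough_coef s cd M K k ^+ 2 <= e / 4.
  apply: (@le_trans _ _ (kappa ^+ 2 * \sum_(k <- F2) sqfreq R k `^ (- (2 * alpha)))).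
    rewrite mulr_sumr big_seq [leRHS]big_seq; apply: ler_sum => k.
    by rewrite mem_filter => /andP[_ kF]; have [] := rle k (nz F k nF kF).
  apply: (@le_trans _ _ (kappa ^+ 2 * (e / (4 * (kappa ^+ 2 + 1))))).
    rewrite ler_wpM2l ?sqr_ge0//; apply: hK1.
    - by rewrite filter_uniq.
    - by rewrite mem_filter negb_and nF orbT.
    - by move=> k; rewrite mem_filter => /andP[].
  rewrite mulrA ler_pdivrMr//.
  by move: (kappa ^+ 2) => k; move: e0; lra.
move: s1 s2; move: (\sum_(k <- F1) _) (\sum_(k <- F2) _) => p q s1 s2.
have : n1 * m * 4 <= e by move: mn m0; lra.
lra.
Qed.

(** Testing against trigonometric polynomials is enough, by completeness. *)
Lemma torus_split (e : R) : 0 < e -> exists A : rvec R d -> R,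
  [/\ posdef A, forall x k, A (vaddz x k) = A x,
    (\int[cell d]_x (maxr (- (g x - A x + e)) 0)%:E = 0)%E &
    (\int[cell d]_x ((g x - A x) ^+ 2)%:E <= e%:E)%E].
Proof.
move=> e0; have [M [K [M0 [uK nK sK] tr tailK sqK]]] := choose_cutoff e0.
pose A := smooth_part s cd M K.
have rE x : rough_part s cd g M K x = g x - A x by [].
have tA : trig A by exact: trig_cosum.
have mA := trig_measurable tA.
have ir : integ (cell d) (fun x => g x - A x) by apply: integB => //; exact: integ_trig.
have mr := integ_measurable ir.
exists A; split.
- exact: posdef_smooth_part.
- by move=> x k; apply: eq_bigr => m _; rewrite cos_angle_vaddz.
- apply: (negpart_of_trig (u := fun x => g x - A x + e)).
    by apply: integD => //; exact: integ_cst.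
  move=> q tq uq; have q0 x : 0 <= q x by have /andP[] := uq x.
  have := rough_part_lower hs0 hsd hcd hg M0 uK nK sK tailK tq q0.
  have iq := integ_trig tq.
  under [in X in _ -> X]eq_Rintegral do rewrite mulrDl.
  rewrite RintD; [|exact: integM_trig|exact: integZ].
  rewrite RintZ//.
  have I0 : 0 <= \int[cell d]_x q x by exact: Rintegral_ge0.
  move=> h; rewrite -lerBlDr sub0r; apply: le_trans h.
  rewrite -mulNr ler_wpM2r// lerN2 -/kappa; move: tr; lra.
have e20 : 0 <= e / 2 by rewrite divr_ge0// ltW.
have du q : trig q -> (\int[cell d]_x ((g x - A x) * q x)) ^+ 2 <= e / 2 * \int[cell d]_x (q x ^+ 2).
  exact: rough_part_duality.
have pos := pospart_sq_le ir du e20.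
have neg : (\int[cell d]_x (maxr (- (g x - A x)) 0 ^+ 2)%:E <= (e / 2)%:E)%E.
  apply: (pospart_sq_le (u := fun x => - (g x - A x)) (integN ir)) => // q tq.
  under eq_Rintegral do rewrite mulNr.
  by rewrite RintN sqrrN; exact: du.
have E x : ((g x - A x) ^+ 2)%:E =
    ((maxr (g x - A x) 0 ^+ 2)%:E + (maxr (- (g x - A x)) 0 ^+ 2)%:E)%E.
  rewrite -EFinD; congr (_%:E); move: (g x - A x) => r.
  have [r0|r0] := leP r 0.
    by rewrite (max_l (x := - r)) ?oppr_ge0// expr0n add0r sqrrN.
  by rewrite (max_r (x := - r)) ?expr0n ?addr0// oppr_le0 ltW.
under eq_integral do rewrite E.
rewrite ge0_integralD//; last 4 first.
- by move=> x _; rewrite lee_fin sqr_ge0.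
- by apply/measurable_EFinP; apply: measurable_funX; exact: measurable_maxr.
- by move=> x _; rewrite lee_fin sqr_ge0.
- apply/measurable_EFinP; apply: measurable_funX; apply: measurable_maxr => //.
  exact: measurableT_comp.
by rewrite [e]splitr EFinD leeD.
Qed.

End torus_regularisation.

(** * The torus *)

Lemma sqr_mean_le (R : realType) (x y : R) :
  ((x + y) / 2) ^+ 2 <= 2^-1 * (x ^+ 2 + y ^+ 2).
Proof. by have := sqr_ge0 (x - y); rewrite sqrrB; lra. Qed.

Section torus_controlled.
Context (R : realType) (d : nat) (s cd a b : R) (g : {mfun rvec R d >-> R}).
Hypotheses (hs0 : 0 <= s) (hsd : s < d%:R / 2) (hcd : 0 < cd).
Hypothesis hg : periodic_riesz s cd g.

Let d0 : (0 < d)%N.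
Proof.
rewrite lt0n; apply/eqP => dz; move: hsd; rewrite dz mul0r => /(le_lt_trans hs0).
by rewrite ltxx.
Qed.

Let gper x k : g (vaddz x k) = g x. Proof. by have [h _ _ _] := hg; exact: h. Qed.

Let gint : integ (cell d) g. Proof. by have [_ h _ _] := hg; exact: h. Qed.

Let G : R := \int[cell d]_x `|g x|.

Section fixed_class.
Variables (L M : R).
Hypothesis L0 : 0 <= L.
Variable f : density (phase_measure R Torus d).
Hypothesis hf : dens_class s a b L M f.
Let P : probability (phase R d) R := density_prob f.

Let int_position_le (phi : rvec R d -> \bar R) :
  measurable_fun setT phi -> (forall x, 0 <= phi x)%E ->
  (\int[P]_z phi z.1 <= L%:E * \int[cell d]_x phi x)%E.
Proof. by have [rL _] := hf; exact: (ge0_integral_position_le rL L0). Qed.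

(** Periodic functions of the displacement are integrated uniformly in its other
   end point. *)
Let int_left_le (x : rvec R d) (phi : rvec R d -> \bar R) :
  measurable_fun setT phi -> (forall x, 0 <= phi x)%E ->
  (forall y k, phi (vaddz y k) = phi y) ->
  (\int[P]_w phi (vsub x w.1) <= L%:E * \int[cell d]_x phi x)%E.
Proof.
move=> mphi phi0 per; rewrite -(ge0_integral_cell_reflect x mphi phi0 per).
apply: (int_position_le (phi := fun y => phi (vsub x y))) => //.
exact: (measurableT_comp mphi (measurable_vsubl x)).
Qed.

Let int_right_le (x : rvec R d) (phi : rvec R d -> \bar R) :
  measurable_fun setT phi -> (forall x, 0 <= phi x)%E ->
  (forall y k, phi (vaddz y k) = phi y) ->
  (\int[P]_w phi (vsub w.1 x) <= L%:E * \int[cell d]_x phi x)%E.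
Proof.
move=> mphi phi0 per; rewrite -(ge0_integral_cell_shift x mphi phi0 per).
apply: (int_position_le (phi := fun y => phi (vsub y x))) => //.
exact: (measurableT_comp mphi (measurable_vsubr x)).
Qed.

Let mg : measurable_fun setT (g : rvec R d -> R). Proof. exact: measurable_funP. Qed.

Let mabs : measurable_fun setT (fun x : rvec R d => (`|g x|)%:E).
Proof. by apply/measurable_EFinP; exact: measurableT_comp. Qed.

Lemma torus_summable : summable_interaction g f (L * G + L * G).
Proof.
pose V (x y : rvec R d) := `|g (vsub x y)| + `|g (vsub y x)|.
have ml (x : rvec R d) : measurable_fun setT (fun y => g (vsub x y)).
  exact: (measurableT_comp mg (measurable_vsubl x)).
have mr (x : rvec R d) : measurable_fun setT (fun y => g (vsub y x)).
  exact: (measurableT_comp mg (measurable_vsubr x)).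
rewrite -[X in summable_interaction _ _ X]add0r -{1}(mulr0 2).
apply: (@summable_of_bound _ _ _ _ _ (fun=> 0) V) => //.
- by rewrite integral0.
- by move=> x; apply: measurable_funD; exact: measurableT_comp.
- by move=> x y; rewrite addr_ge0.
- by move=> x y; rewrite /V addrC.
- move=> x; rewrite /V; under eq_integral do rewrite EFinD.
  rewrite ge0_integralD//; last 2 first.
  + apply/measurable_EFinP; apply: measurableT_comp => //.
    by apply: (measurableT_comp (ml x)); exact: measurable_fst.
  + apply/measurable_EFinP; apply: measurableT_comp => //.
    by apply: (measurableT_comp (mr x)); exact: measurable_fst.
  have GE : (\int[cell d]_y (`|g y|)%:E = G%:E)%E.
    by rewrite -(Rint_EFin (integ_norm gint)).
  have p0 (y : rvec R d) : (0 <= (`|g y|)%:E)%E by rewrite lee_fin.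
  have pp (y : rvec R d) k : (`|g (vaddz y k)|)%:E = (`|g y|)%:E by rewrite gper.
  rewrite EFinD EFinM -GE; apply: leeD.
    exact: (int_left_le x mabs p0 pp).
  exact: (int_right_le x mabs p0 pp).
move=> x y; rewrite !add0r /paircut; case: eqP => _.
  by rewrite normr0 addr_ge0.
by rewrite lerDl.
Qed.

Let pairkerE (z w : phase R d) : w.1 != z.1 ->
  pairker g z w = (g (vsub z.1 w.1) + g (vsub w.1 z.1)) / 2.
Proof.
move=> zw; rewrite /pairker /paircut (negbTE zw) eq_sym (negbTE zw).
by rewrite mulrC.
Qed.

Lemma torus_regularisation (eps e : R) (A : rvec R d -> R) :
  0 < eps -> 0 < e -> e <= eps -> L * e <= eps ^+ 2 -> posdef A ->
  (forall x k, A (vaddz x k) = A x) ->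
  (\int[cell d]_x (maxr (- (g x - A x + e)) 0)%:E = 0)%E ->
  (\int[cell d]_x ((g x - A x) ^+ 2)%:E <= e%:E)%E ->
  exists B, regularisation g f eps (A rvec0) B.
Proof.
move=> eps0 e0 ee Le pA Aper neg sq.
have mA := posdef_measurable pA.
have mX : measurable_fun setT (fst : phase R d -> rvec R d) by exact: measurable_fst.
exists (fun z w => A (vsub z.1 w.1)).
have mr : measurable_fun setT (fun x : rvec R d => g x - A x) by exact: measurable_funB.
pose phi (x : rvec R d) := (maxr (- (g x - A x + e)) 0)%:E.
have mphi : measurable_fun setT phi.
  apply/measurable_EFinP; apply: measurable_maxr => //; apply: measurableT_comp => //.
  exact: measurable_funD.
have phi0 x : (0 <= phi x)%E by rewrite lee_fin le_max lexx orbT.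
have phip x k : phi (vaddz x k) = phi x by rewrite /phi gper Aper.
have ae0 (psi : phase R d -> rvec R d) : measurable_fun setT psi ->
    (\int[P]_w phi (psi w) <= L%:E * \int[cell d]_x phi x)%E ->
    \forall w \ae P, - e <= g (psi w) - A (psi w).
  move=> mpsi; rewrite neg mule0 => h.
  have mpp := measurableT_comp mphi mpsi.
  have : ae_eq P setT (phi \o psi) (cst 0%E).
    apply/(ae_eq_integral_abs P measurableT mpp).
    apply/eqP; rewrite eq_le; apply/andP; split; last exact: integral_ge0.
    apply: le_trans h; rewrite le_eqVlt; apply/orP; left; apply/eqP.
    by apply: eq_integral => w _; rewrite gee0_abs// phi0.
  apply: (@filterS _ _ (ae_filter_ringOfSetsType P)) => w /(_ I) /= -[h1].
  have : - (g (psi w) - A (psi w) + e) <= maxr (- (g (psi w) - A (psi w) + e)) 0.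
    by rewrite le_max lexx.
  by rewrite h1; lra.
have lowl (z : phase R d) : \forall w \ae P, - e <= g (vsub z.1 w.1) - A (vsub z.1 w.1).
  apply: ae0; last exact: int_left_le.
  exact: (measurableT_comp (measurable_vsubl z.1) mX).
have lowr (z : phase R d) : \forall w \ae P, - e <= g (vsub w.1 z.1) - A (vsub w.1 z.1).
  apply: ae0; last exact: int_right_le.
  exact: (measurableT_comp (measurable_vsubr z.1) mX).
have [rL _] := hf.
have rE (z w : phase R d) : w.1 != z.1 -> pairker g z w - A (vsub z.1 w.1) =
    ((g (vsub z.1 w.1) - A (vsub z.1 w.1)) + (g (vsub w.1 z.1) - A (vsub w.1 z.1))) / 2.
  by move=> /pairkerE ->; rewrite (posdef_even pA w.1 z.1); field.
have mB : measurable_fun setT (fun p : phase R d * phase R d => A (vsub p.1.1 p.2.1)).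
  exact: (measurable_diffker mX mA).
have Fae := ae_filter_ringOfSetsType P.
split.
- by split => // z; rewrite vsubxx.
- by move=> z w; exact: posdef_even.
- by move=> N t N0 tN; exact: (energy_posdef_ge0 P mX pA N0 tN).
- move=> z.
  apply: (@filterS3 _ _ Fae _ _ _ _ _ (ae_neq_position rL L0 z.1 d0) (lowl z) (lowr z)) => w zw h1 h2.
  by rewrite rE//; lra.
move=> z.
have [kl kr kla kra _] := torus_summable.
have [mp _ _ _] := kernel_pairker kl kr kla kra.
pose psi (x : rvec R d) := ((g x - A x) ^+ 2)%:E.
have mpsi : measurable_fun setT psi by apply/measurable_EFinP; exact: measurable_funX.
have psi0 x : (0 <= psi x)%E by rewrite lee_fin sqr_ge0.
have psip x k : psi (vaddz x k) = psi x by rewrite /psi gper Aper.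
have m1 : measurable_fun setT (fun w : phase R d => psi (vsub z.1 w.1)).
  exact: (measurableT_comp mpsi (measurableT_comp (measurable_vsubl z.1) mX)).
have m2 : measurable_fun setT (fun w : phase R d => psi (vsub w.1 z.1)).
  exact: (measurableT_comp mpsi (measurableT_comp (measurable_vsubr z.1) mX)).
apply: (@le_trans _ _ (\int[P]_w ((2^-1)%:E * (psi (vsub z.1 w.1) + psi (vsub w.1 z.1))))%E).
  apply: ae_ge0_le_integral => //.
  - by move=> w _; rewrite lee_fin sqr_ge0.
  - apply/measurable_EFinP; apply: measurable_funX; apply: measurable_funB.
      exact: (measurableT_comp mp (pair1_measurable z)).
    exact: (measurableT_comp mB (pair1_measurable z)).
  - by move=> w _; rewrite mule_ge0 ?adde_ge0// lee_fin invr_ge0.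
  - by apply: measurable_funeM; exact: emeasurable_funD.
  apply: filterS (ae_neq_position rL L0 z.1 d0) => w zw _.
  rewrite rE// /psi -EFinD -EFinM lee_fin.
  exact: sqr_mean_le.
have half0 : (0 <= (2^-1 : R)%:E)%E by rewrite lee_fin invr_ge0.
rewrite ge0_integralZl; [|exact: measurableT|exact: emeasurable_funD|
  by move=> w _; exact: adde_ge0|exact: half0].
rewrite ge0_integralD//.
have b1 := int_left_le z.1 mpsi psi0 psip; have b2 := int_right_le z.1 mpsi psi0 psip.
have be : (L%:E * \int[cell d]_x psi x <= (eps ^+ 2)%:E)%E.
  by apply: (@le_trans _ _ (L%:E * e%:E)%E); [rewrite lee_wpmul2l ?lee_fin|rewrite -EFinM lee_fin].
apply: (@le_trans _ _ ((2^-1)%:E * ((eps ^+ 2)%:E + (eps ^+ 2)%:E))%E).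
  by rewrite lee_wpmul2l//; apply: leeD; [exact: le_trans b1 be|exact: le_trans b2 be].
rewrite -EFinD -EFinM lee_fin; move: (eps ^+ 2) => E.
by have -> : 2^-1 * (E + E) = E by field.
Qed.

End fixed_class.

Lemma controlled_torus L M : 0 <= L ->
  controlled g (dens_class (D := Torus) (d := d) s a b L M).
Proof.
move=> L0; split.
  by eexists => f hf; exact: (torus_summable L0 hf).
move=> eps eps0; have L1 : 0 < L + 1 by rewrite ltr_wpDl.
pose e := minr eps (eps ^+ 2 / (L + 1)).
have e0 : 0 < e by rewrite lt_min eps0 divr_gt0// exprn_gt0.
have ee : e <= eps by rewrite ge_min lexx.
have Le : L * e <= eps ^+ 2.
  have h : e * (L + 1) <= eps ^+ 2 by rewrite -ler_pdivlMr// ge_min lexx orbT.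
  lra.
have [A [pA Aper neg sq]] := torus_split hs0 hsd hcd hg e0.
exists (A rvec0) => f hf.
exact: (torus_regularisation L0 hf eps0 e0 ee Le pA Aper neg sq).
Qed.

End torus_controlled.

(** * The theorem *)

Theorem lemma2p7 (R : realType) (D : domain) (d : nat) (s beta cd a b : R)
    (g : {mfun rvec R d >-> R})
    (hbeta : 0 < beta) (hs0 : 0 <= s) (hsd : s < d%:R / 2)
    (hcd : 0 < cd) (hg : admissible D s cd g) (ha : 0 < a) (hb : 0 < b) :
  exists C : R -> R -> R,
    forall f : density (phase_measure R D d),
      ('N[phase_measure R D d]_(+oo)[EFin \o f] < +oo)%E ->
      ('N[space_measure R D d]_(+oo)[EFin \o rho f] < +oo)%E ->
      (s = 0 -> (exp_moment D a b f < +oo)%E) ->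
      let K := C (fine ('N[space_measure R D d]_(+oo)[EFin \o rho f])%E)
                 (if s == 0 then fine (exp_moment D a b f) else 0) in
      0 < K /\
      forall N : nat, (0 < N)%N ->
        (rel_entropy (modulated_gibbs N beta g f) (density_pow N f)
           <= (K / N%:R)%:E)%E /\
        (rel_entropy (density_pow N f) (modulated_gibbs N beta g f)
           <= (K / N%:R)%:E)%E.
Proof.
apply: (entropy_of_controlled (a := a) (b := b) hbeta) => L M L0.
case: D hg => hD.
- exact: (controlled_torus a b hs0 hsd hcd hD M L0).
- exact: (controlled_whole hs0 hsd hcd hD ha hb M L0).
Qed.
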